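(* Let $d=1$ and let $(\eta_t)_{t\ge0}$ be the birth process on $\mathbb{R}$ started at time $0$ from $\{0\}$ with birth rate $$b(x,\eta)=\min\Big\{2,\ \sum_{y\in\eta}\mathbf 1\{|x-y|\le1\}\Big\},\qquad x\in\mathbb{R},\ \eta\in\Gamma_0 .$$ Then the speed of propagation $\mu^{-1}$ of $(\eta_t)$ is $$\mu^{-1}=\frac{144\ln 3-144\ln 2-40}{25}.$$
   Context: $\Gamma_0$ is the set of finite subsets of $\mathbb{R}$ and $|\cdot|$ denotes absolute value or cardinality. Let $N$ be a Poisson point process on $\mathbb{R}_+\times\mathbb{R}\times\mathbb{R}_+$ with mean measure $ds\,dx\,du$. The birth process $(\eta_t)_{t\ge0}$ with birth rate $b$ started from $\{0\}$ is the a.s. unique cadlag $\Gamma_0$-valued process adapted to the completed natural filtration of $N$ such that a.s. for all $t\ge0$ and Borel $B\subset\mathbb{R}$, $|\eta_t\cap B|=\int_{(0,t]\times B\times[0,\infty)}\mathbf 1_{[0,b(x,\eta_{s-})]}(u)\,N(ds,dx,du)+|\{0\}\cap B|$ (that is, births occur in a Borel set $B$ at rate $\int_B b(x,\eta_{t})\,dx$). Speed of propagation: $\mu^{-1}\in(0,\infty)$ is the (unique) constant such that for all $\varepsilon\in(0,1)$, almost surely, $(1-\varepsilon)[-\mu^{-1},\mu^{-1}]\subset\frac1t\xi_t\subset(1+\varepsilon)[-\mu^{-1},\mu^{-1}]$ for all sufficiently large $t$, where $\xi_t=\bigcup_{x\in\eta_t}[x-1,x+1]$ (the existence of such a constant is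 given by the shape theorem). *)

(* Defs.v *)
From mathcomp Require Import all_boot all_order all_algebra finmap.
From mathcomp Require Import all_classical all_reals all_analysis.
From mathcomp Require Import measurable_realfun lebesgue_measure.

Set Implicit Arguments.
Unset Strict Implicit.
Unset Printing Implicit Defensive.
Import Order.TTheory GRing.Theory Num.Theory.
Import numFieldNormedType.Exports.

Local Open Scope classical_set_scope.
Local Open Scope ring_scope.

(** Points are triples [(s, x, u)].  The ambient space is [R * R * R]; the
    restriction to [R_+ * R * R_+] is carried by the mean measure, so that a
    Poisson process with this mean measure a.s. has no point elsewhere. *)
Notation space_time_mark R :=
  (measurableTypeR R * measurableTypeR R * measurableTypeR R)%type.

Definition state_space (R : realType) : set (space_time_mark R) :=
  `[0, +oo[ `*` [set: R] `*` `[0, +oo[.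

Definition mean_measure (R : realType) (B : set (space_time_mark R)) : \bar R :=
  (@lebesgue_measure R \x @lebesgue_measure R \x @lebesgue_measure R)%E
    (B `&` @state_space R).

(** A random measure is a kernel from the probability space. *)
Record poisson_point_process d (T : measurableType d) (R : realType)
    (P : probability T R) (N : R.-ker T ~> space_time_mark R) : Prop := {
  ppp_counting : forall w (B : set (space_time_mark R)), measurable B ->
    N w B = +oo%E \/ exists k : nat, N w B = k%:R%:E;
  ppp_locally_finite : forall w (r : R),
    (N w (`[- r, r] `*` `[- r, r] `*` `[- r, r])%R < +oo)%E;
  (* the second argument of [poisson_prob] is a dummy in the library *)
  ppp_poisson : forall (B : set (space_time_mark R)) (k : nat), measurable B ->
    (mean_measure B < +oo)%E ->
    P [set w | N w B = k%:R%:E] = poisson_prob (fine (mean_measure B)) 0 [set k];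
  ppp_independent : forall (n : nat) (B : 'I_n -> set (space_time_mark R))
      (A : 'I_n -> set (\bar R)),
    (forall i, measurable (B i)) -> trivIset setT B ->
    (forall i, measurable (A i)) ->
    P [set w | forall i, A i (N w (B i))] =
      (\prod_(i < n) P [set w | A i (N w (B i))])%E }.

(** Completion adjoins all subsets of [P]-null sets.  As the probability space
    itself need not be complete, members need not be measurable in [T]. *)
Definition completed_filtration d (T : measurableType d) (R : realType)
    (P : probability T R) (N : R.-ker T ~> space_time_mark R) (t : R) :
    set (set T) :=
  <<s [set E | exists (B : set (space_time_mark R)) (A : set (\bar R)),
         [/\ measurable B,
             B `<=` `[0, t] `*` [set: R] `*` `[0, +oo[,
             measurable A & E = [set w | A (N w B)]]]
      `|` P.-negligible >>.

Definition count_in (R : realType) (eta : {fset R}) (B : set R) : nat :=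
  #|` [fset x in eta | x \in B]%fset |.

(** Weak convergence of the associated counting measures; on finite
    configurations, testing against unbounded continuous functions as well
    gives the same topology. *)
Definition config_cvg (R : realType) (F : set_system R) (e : R -> {fset R})
    (l : {fset R}) : Prop :=
  forall f : R -> R, continuous f ->
    (fun s => \sum_(x <- e s) f x) @ F --> \sum_(x <- l) f x.

Definition cadlag (R : realType) (e : R -> {fset R}) : Prop :=
  forall t : R, 0 <= t ->
    config_cvg t^'+ e (e t) /\
    (0 < t -> exists l, config_cvg t^'- e l).

(** [e_{t-}], with junk value [fset0] when the left limit does not exist. *)
Definition left_limit (R : realType) (e : R -> {fset R}) (t : R) : {fset R} :=
  xget fset0%fset [set l | config_cvg t^'- e l].

Record birth_process d (T : measurableType d) (R : realType)
    (P : probability T R) (N : R.-ker T ~> space_time_mark R)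
    (b : R -> {fset R} -> R) (eta0 : {fset R})
    (eta : T -> R -> {fset R}) : Prop := {
  (* the sigma-algebra on configurations is generated by the counting maps *)
  birth_adapted : forall (t : R) (B : set (measurableTypeR R)) (k : nat),
    0 <= t -> measurable B ->
    completed_filtration P N t [set w | count_in (eta w t) B = k];
  birth_cadlag : {ae P, forall w, cadlag (eta w)};
  birth_equation : {ae P, forall w,
    forall (t : R) (B : set (measurableTypeR R)), 0 <= t -> measurable B ->
      (count_in (eta w t) B)%:R%:E =
      (\int[N w]_(z in `]0%R, t] `*` B `*` `[0%R, +oo[)
         (\1_(`[0%R, b z.1.2 (left_limit (eta w) z.1.1)]) z.2)%:E
       + (count_in eta0 B)%:R%:E)%E} }.

Definition truncated_rate (R : realType) (x : R) (eta : {fset R}) : R :=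
  Num.min 2 (\sum_(y <- eta) (`|x - y| <= 1)%R%:R).

Definition occupied (R : realType) (eta : {fset R}) : set R :=
  \bigcup_(x in [set` eta]) `[x - 1, x + 1]%classic.

Definition scale_set (R : realType) (a : R) (A : set R) : set R :=
  [set a * x | x in A].

Definition shape_constant d (T : measurableType d) (R : realType)
    (P : probability T R) (eta : T -> R -> {fset R}) (v : R) : Prop :=
  0 < v /\
  forall eps : R, 0 < eps < 1 ->
    {ae P, forall w, \forall t \near +oo_R,
       scale_set (1 - eps) `[- v, v] `<=` scale_set t^-1 (occupied (eta w t)) /\
       scale_set t^-1 (occupied (eta w t)) `<=` scale_set (1 + eps) `[- v, v]}.

Definition speed_of_propagation d (T : measurableType d) (R : realType)
    (P : probability T R) (eta : T -> R -> {fset R}) (v : R) : Prop :=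
  unique (shape_constant P eta) v.

(* Main.v *)
From HB Require Import structures.
Require Import Defs.
From mathcomp Require Import all_boot all_order all_algebra finmap.
From mathcomp Require Import all_classical all_reals all_analysis.
From mathcomp Require Import measurable_realfun lebesgue_measure.
From mathcomp Require Import ring lra.
Set Implicit Arguments.
Unset Strict Implicit.
Unset Printing Implicit Defensive.
Import Order.TTheory GRing.Theory Num.Theory.
Import numFieldNormedType.Exports.
Local Open Scope classical_set_scope.
Local Open Scope ring_scope.

(** Why the speed is what it is.  Follow the rightmost particle [X] and its distance
    [Z] to the second rightmost one.  Births never happen farther than 1 from an
    existing particle, so every particle other than the origin has a neighbour at
    distance at most 1 on the side of the origin ([path_connected]), and [0 < Z <= 1] as
    soon as there are two particles; a lone particle is given the gap [Z = 3].  A birth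
    changes the pair [(X, Z)] only if it falls to the right of both [X - Z] and [X - 1].
    At such a place [x] the truncation at 2 hides every particle behind the leading two:
    one of them can be within distance 1 of [x] only if both leading particles are.  The
    birth rate at [x] is therefore the number of leading particles within distance 1
    ([front_rate]), and [(X, Z)] is a Markov process on its own.

    For a function [h] of the gap, the drift of [X + h Z] in a state with gap [z <= 1] is
<<
  2 \int_0^z h + \int_0^1 h + \int_0^(1-z) h - (2+z) h(z) + 1/2 + (1-z)^2 / 2 .
>>
    There is an explicit [h], made of logarithms ([gap_potential]), for which this does
    not depend on [z]; the constant is then [(144 ln 3 - 144 ln 2 - 40) / 25]
    ([gap_potential_eq]), and the value of [h] at a lone particle is chosen to give the
    same drift.  So, with [F = X + h Z] and [v] that constant, [F - v t] is a martingale
    with bounded jumps occurring at bounded rate; its variance is [O(t)], and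
    [X / t --> v] because [h] is bounded.

    The second moment is bounded in discrete time.  The interval [0, t] is cut into
    steps of length [dt], and only the event that each step sees at most one point of the
    Poisson process in a window of width 5 around the front is considered.  A step
    without point leaves the front alone ([quiet_front]); a step with one point moves it
    by the explicit map [front_step] ([single_birth_front]).  Given the past and given
    that there is exactly one point, this point is uniform in the window ([freeze_point]),
    so one step changes the second moment of [F - v t] by a factor [1 + O(dt^2)] and a
    term [O(dt)] ([one_step_deviation]), and it is bad with probability [O(dt^2)]
    ([one_step_mass]).  With [t = n^2] and [dt = n^-4] both error probabilities are
    [O(n^-2)] ([square_time_estimate]); the Borel-Cantelli lemma handles the times [n^2],
    and monotonicity of [X] the times in between ([right_front_speed]).

    Since the configuration is known only up to null sets from the points before time
    [t], the pair [(X, Z)] is first replaced by an almost surely equal variable that is a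
    function of these points ([front_state]); independence of the past and of the next
    step then follows from the independence of counts in disjoint sets
    ([past_independent]).

    The left front is the right front of the process reflected at the origin, which is
    driven by the reflected Poisson process ([reflected_poisson], [reflected_path]).
    Gaps being at most 1, the occupied set is the interval between the two fronts,
    enlarged by 1 ([occupied_interval]); the shape constant follows, and two shape
    constants must agree ([shape_constant_unique]). *)

(** * Finite configurations *)

Section Configurations.
Variable R : realType.
Implicit Types (e l : {fset R}) (F : set_system R).

(** A continuous test function vanishing exactly on one of the two limits shows that the
    other limit is contained in it. *)
Lemma config_cvg_unique F (e : R -> {fset R}) l l' : ProperFilter F ->
  config_cvg F e l -> config_cvg F e l' -> l = l'.
Proof.
move=> FF; suff sub l1 l2 : config_cvg F e l1 -> config_cvg F e l2 ->
    (l1 `<=` l2)%fset.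
  by move=> h h'; apply/eqP; rewrite eqEfsubset !sub.
move=> h1 h2; apply/fsubsetP => x xl1; apply/negPn/negP => xl2.
pose f y := \prod_(z <- l2) `|y - z|.
have cf : continuous f.
  move=> y; apply: cvg_big => [|z _]; first exact: mul_continuous.
  by apply: cvg_norm; apply: cvgB; [exact: cvg_id|exact: cvg_cst].
have : \sum_(z <- l1) f z = \sum_(z <- l2) f z.
  exact: (cvg_unique _ (h1 f cf) (h2 f cf)).
rewrite [RHS]big_seq [RHS]big1; last first.
  by move=> z zl2; rewrite /f (big_rem z zl2)/= subrr normr0 mul0r.
have f0 y : 0 <= f y by apply: prodr_ge0.
rewrite (big_rem x)//= => /eqP; rewrite paddr_eq0//; last exact: sumr_ge0.
move=> /andP[/eqP fx0 _]; have : 0 < f x.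
  rewrite /f big_seq; apply: prodr_gt0 => z zl2.
  by rewrite normr_gt0 subr_eq0; apply: contraNneq xl2 => ->.
by rewrite fx0 ltxx.
Qed.

Lemma config_cvg_near F (e : R -> {fset R}) l : ProperFilter F ->
  (\forall s \near F, e s = l) -> config_cvg F e l.
Proof.
by move=> FF el f _; apply: cvg_near_cst; apply: filterS el => s ->.
Qed.

Lemma count_in_gt0 e (B : set R) :
  (0 < count_in e B)%N <-> exists2 x, x \in e & B x.
Proof.
rewrite /count_in cardfs_gt0; split => [/fset0Pn[x]|[x xe Bx]].
  by rewrite !inE => /andP[xe /set_mem Bx]; exists x.
by apply/fset0Pn; exists x; rewrite !inE xe; apply/mem_set.
Qed.

Lemma count_in_eq0 e (B : set R) :
  count_in e B = 0%N <-> forall x, x \in e -> ~ B x.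
Proof.
split=> [e0 x xe Bx|h].
  have /count_in_gt0 : exists2 x, x \in e & B x by exists x.
  by rewrite e0.
apply/eqP; rewrite -leqn0 leqNgt; apply/negP => /count_in_gt0[x xe].
exact: h.
Qed.

Lemma count_in_set1 e (x : R) : count_in e [set x] = (x \in e).
Proof.
rewrite /count_in; have [xe|xe] := boolP (x \in e).
  rewrite (_ : [fset y in e | y \in [set x]]%fset = [fset x]%fset) ?cardfs1//.
  apply/fsetP => y; rewrite !inE; apply/andP/eqP => [[_ /set_mem//]|->].
  by split => //; exact/mem_set.
rewrite (_ : [fset y in e | y \in [set x]]%fset = fset0) ?cardfs0//.
apply/fsetP => y; rewrite !inE; apply/negbTE/negP => /andP[ye /set_mem yx].
by move: xe; rewrite -yx ye.
Qed.

Lemma count_in_setT e : count_in e setT = #|` e|.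
Proof.
rewrite /count_in; congr #|` _|; apply/fsetP => x.
by rewrite !inE in_setT andbT.
Qed.

End Configurations.

(** * Paths of the birth process *)

Section NonmeasurableIntegral.
Import HBNNSimple.

(** The integral of a nonnegative function is a supremum over the simple functions below
    it, hence monotone without any measurability.  The rate along a path is measurable
    only after the path is known to be a step function, so this is what gives the first
    regularity properties of paths. *)
Lemma ge0_le_integral_nonmeas d (T : measurableType d) (R : realType)
    (mu : {measure set T -> \bar R}) (D1 D2 : set T) (f g : T -> \bar R) :
  (forall x, D1 x -> 0 <= f x)%E -> (forall x, D2 x -> 0 <= g x)%E -> D1 `<=` D2 ->
  (forall x, D1 x -> f x <= g x)%E ->
  (\int[mu]_(x in D1) f x <= \int[mu]_(x in D2) g x)%E.
Proof.
move=> f0 g0 D12 fg; rewrite !ge0_integralE//; apply: ereal_sup_le => _ [h hf <-].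
exists h => // x; apply: (le_trans (hf x)).
rewrite /patch; case: ifPn => [/set_mem xD1|_].
  by rewrite mem_set//; [exact: fg|exact: D12].
by case: ifPn => // /set_mem/g0.
Qed.

End NonmeasurableIntegral.

Section Paths.
Variable R : realType.
Local Notation point_type := (space_time_mark R).
Implicit Types (n : {measure set point_type -> \bar R}) (e el : R -> {fset R}).

(** The points that give birth, [el] being the process of left limits. *)
Definition accepted el : set point_type :=
  [set z | 0 <= z.2 <= truncated_rate z.1.2 (el z.1.1)].

Definition slab (s t : R) (B : set R) : set point_type :=
  [set z | s < z.1.1 <= t /\ B z.1.2].

(** The facts about one path that are used later: [e] is a nondecreasing step function,
    [el] is its left limit, and the births in a region between two times are counted by
    the accepted points.  The left limit is a parameter, so that the record is visibly
    preserved by reflection. *)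
Record regular_path n e el : Prop := {
  rp_counting : forall B, measurable B ->
    n B = +oo%E \/ exists k : nat, n B = k%:R%:E;
  rp_zero : n [set z | z.2 = 0] = 0%E;
  rp_start : e 0 = [fset 0]%fset;
  rp_mono : forall s t, 0 <= s -> s <= t -> (e s `<=` e t)%fset;
  rp_left : forall t, 0 < t ->
    exists2 r, 0 <= r < t & forall s, r <= s < t -> e s = el t;
  rp_right : forall t, 0 <= t ->
    exists2 r, t < r & forall s, t <= s <= r -> e s = e t;
  rp_measurable : forall s t (B : set (measurableTypeR R)),
    0 <= s -> measurable B -> measurable (accepted el `&` slab s t B);
  rp_birth : forall s t (B : set (measurableTypeR R)),
    0 <= s -> s <= t -> measurable B ->
    (count_in (e t) B)%:R%:E =
      (n (accepted el `&` slab s t B) + (count_in (e s) B)%:R%:E)%E }.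

Lemma slabE s t (B : set R) : slab s t B = `]s, t]%classic `*` B `*` setT.
Proof.
apply/seteqP; split => -[[a x] u] /=; rewrite /slab/= in_itv/=.
  by move=> [].
by move=> [[]].
Qed.

Lemma measurable_slab s t (B : set (measurableTypeR R)) :
  measurable B -> measurable (slab s t B).
Proof. by move=> mB; rewrite slabE; do 2 apply: measurableX => //. Qed.

Lemma truncated_rate_le2 x (c : {fset R}) : truncated_rate x c <= 2.
Proof. by rewrite ge_min lexx. Qed.

Lemma measurable_truncated_rate (c : {fset R}) :
  measurable_fun [set: measurableTypeR R]
    (fun x : measurableTypeR R => truncated_rate (x : R) c).
Proof.
apply: measurable_minr; first exact: measurable_cst.
apply: measurable_sum => y; rewrite (_ : (fun x => _) =
    \1_([set` `[y - 1, y + 1]])); first exact: measurable_indic.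
apply/funext => x; rewrite indicE mem_setE/= in_itv/= distrC ler_distl.
by congr (nat_of_bool _)%:R; apply/andP/andP => -[? ?]; split; lra.
Qed.

Section FromEquation.
Variables (n : {measure set point_type -> \bar R}) (e : R -> {fset R}).
Hypothesis e_cadlag : cadlag e.
Hypothesis e_eq : forall (t : R) (B : set (measurableTypeR R)),
  0 <= t -> measurable B ->
  (count_in (e t) B)%:R%:E =
   (\int[n]_(z in `]0%R, t] `*` B `*` `[0%R, +oo[)
       (\1_(`[0%R, truncated_rate z.1.2 (left_limit e z.1.1)]) z.2)%:E
     + (count_in [fset 0%R]%fset B)%:R%:E)%E.

Lemma path_start : e 0 = [fset 0]%fset.
Proof.
apply/fsetP => x; have := e_eq (lexx 0) (measurable_set1 x).
rewrite (_ : (_ `*` _ `*` _) = set0); last first.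
  apply/seteqP; split => -[[a y] u] //= [[]] /=.
  by rewrite in_itv/= => /andP[a0 a1]; have := lt_le_trans a0 a1; rewrite ltxx.
rewrite integral_set0 add0e !count_in_set1 => -[/eqP].
by rewrite eqr_nat; case: (x \in e 0); case: (x \in [fset 0]%fset).
Qed.

Lemma path_mono s t : 0 <= s -> s <= t -> (e s `<=` e t)%fset.
Proof.
move=> s0 st; apply/fsubsetP => x xs; have t0 := le_trans s0 st.
have : ((count_in (e s) [set x])%:R%:E <= (count_in (e t) [set x])%:R%:E :> \bar R)%E.
  rewrite (e_eq s0 (measurable_set1 x)) (e_eq t0 (measurable_set1 x)).
  apply: leeD2r; apply: ge0_le_integral_nonmeas => //.
  move=> -[[a y] u] /= [[]]; rewrite !in_itv/= => /andP[-> as_] -> ->.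
  by rewrite (le_trans as_).
by rewrite lee_fin ler_nat !count_in_set1 xs; case: (x \in e t).
Qed.

(** The number of particles is monotone in time and, before [t], bounded by its value at
    [t]; it is constant just before [t], and so is the configuration. *)
Lemma path_left t : 0 < t ->
  exists2 r, 0 <= r < t & forall s, r <= s < t -> e s = left_limit e t.
Proof.
move=> t0; have ub s : 0 <= s < t -> (#|` e s| <= #|` e t|)%N.
  by move=> /andP[s0 /ltW st]; exact/fsubset_leq_card/path_mono.
pose Q k := `[< exists2 s, 0 <= s < t & #|` e s| = k >].
have Q0 : exists k, Q k.
  by exists #|` e 0|; apply/asboolP; exists 0; rewrite ?lexx.
have Qub k : Q k -> (k <= #|` e t|)%N by move=> /asboolP[s /ub + <-].
case: (ex_maxnP Q0 Qub) => m /asboolP[r /andP[r0 rt] rm] mmax.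
have stab s : r <= s < t -> e s = e r.
  move=> /andP[rs st]; apply/esym/eqP; rewrite eqEfcard path_mono//= rm.
  by apply: mmax; apply/asboolP; exists s; rewrite // (le_trans r0).
have lim : config_cvg t^'- e (e r).
  apply: config_cvg_near; near=> s; apply: stab; apply/andP; split => //.
  by near: s; exact: nbhs_left_ge.
have -> : left_limit e t = e r.
  apply: (@config_cvg_unique _ t^'- e) => //.
  exact: (@xgetPex _ fset0%fset [set l | config_cvg t^'- e l] (ex_intro _ _ lim)).
by exists r => //; rewrite r0.
Unshelve. all: by end_near. Qed.

(** The number of particles right after [t] takes its minimum; from there down to [t] the
    configuration is constant, and right continuity identifies it with [e t]. *)
Lemma path_right t : 0 <= t ->
  exists2 r, t < r & forall s, t <= s <= r -> e s = e t.
Proof.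
move=> t0.
pose Q k := `[< exists2 s, t < s & #|` e s| = k >].
have Q0 : exists k, Q k.
  by exists #|` e (t + 1)|; apply/asboolP; exists (t + 1); rewrite ?ltrDl.
case: (ex_minnP Q0) => m /asboolP[r tr rm] mmin.
have stab s : t < s <= r -> e s = e r.
  move=> /andP[ts sr]; apply/eqP; rewrite eqEfcard path_mono//= ?rm.
    by apply: mmin; apply/asboolP; exists s.
  by rewrite (le_trans t0)// ltW.
have lim : config_cvg t^'+ e (e r).
  apply: config_cvg_near; near=> s; apply: stab; apply/andP; split => //.
  by near: s; exact: nbhs_right_le.
have er : e t = e r.
  by apply: (@config_cvg_unique _ t^'+ e) => //; have [] := e_cadlag t0.
exists r => // s; rewrite le_eqVlt => /andP[/orP[/eqP<-//|ts] sr].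
by rewrite er; apply: stab; rewrite ts.
Unshelve. all: by end_near. Qed.

Let el := left_limit e.

Lemma left_limit_mono s t : 0 < s -> s <= t -> (el s `<=` el t)%fset.
Proof.
move=> s0; rewrite le_eqVlt => /orP[/eqP->//|st].
rewrite /el; have [r /andP[r0 rs] hr] := path_left s0.
rewrite -(hr r) ?lexx//.
have [r' /andP[r'0 r't] h] := path_left (lt_trans s0 st).
rewrite -(h (Num.max r' s)) ?le_max ?lexx ?gt_max ?r't//.
by apply: path_mono => //; rewrite le_max (ltW rs) orbT.
Qed.

Lemma left_limit_sub s t : 0 < s -> s <= t -> (el s `<=` e t)%fset.
Proof.
move=> s0 st.
rewrite /el; have [r /andP[r0 rs] hr] := path_left s0.
rewrite -(hr r) ?lexx//.
by apply: path_mono => //; rewrite (le_trans _ st)// ltW.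
Qed.

(** Up to time [t] the left limits run through finitely many configurations, subsets of
    [e t]; by monotonicity each of them is present during an interval of time. *)
Lemma measurable_accepted s t (B : set (measurableTypeR R)) :
  0 <= s -> measurable B -> measurable (accepted el `&` slab s t B).
Proof.
move=> s0 mB.
rewrite (_ : _ `&` _ = \big[setU/set0]_(c <- fpowerset (e t))
  (([set a : measurableTypeR R | s < a <= t /\ el a = c] `*` B `*` setT)
   `&` ([set z : point_type | 0 <= z.2] `&`
   [set z : point_type | z.2 <= truncated_rate z.1.2 c]))).
  apply: bigsetU_measurable => c _; apply: measurableI.
    apply: measurableX => //; apply: measurableX => //.
    apply: is_interval_measurable => a b /= [/andP[sa at_] ac] [/andP[sb bt] bc].
    move=> z /andP[az zb]; split.
      by rewrite (lt_le_trans sa)//= (le_trans zb).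
    apply/eqP; rewrite eqEfsubset -{1}bc -ac !left_limit_mono//.
      exact: le_lt_trans sa.
    exact: le_lt_trans (lt_le_trans sa az).
  apply: measurableI.
    rewrite (_ : [set z | _] = setT `*` `[0, +oo[%classic); first exact: measurableX.
    by apply/seteqP; split => -[x u]/=; rewrite in_itv/= andbT//; case.
  rewrite -[X in measurable X]setTI; apply: measurable_fun_ler => //.
  exact: (measurableT_comp (measurable_truncated_rate c)
    (measurableT_comp measurable_snd measurable_fst)).
rewrite -bigcup_fset.
apply/seteqP; split => -[[a x] u] /=.
  move=> [u0 [/= /andP[sa at_] Bx]]; exists (el a) => /=.
    by rewrite fpowersetE left_limit_sub// (le_lt_trans s0).
  by move/andP: u0 => /= [u0 ux]; rewrite /slab/= sa.
move=> [c _ [[[[sat ac] Bx] _] [/= u0 ux]]]; split => /=.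
  by rewrite /accepted/= u0/= ac.
by split.
Qed.

Lemma path_birth0 t (B : set (measurableTypeR R)) : 0 <= t -> measurable B ->
  (count_in (e t) B)%:R%:E =
    (n (accepted el `&` slab 0 t B) + (count_in [fset 0%R]%fset B)%:R%:E)%E.
Proof.
move=> t0 mB; rewrite e_eq//; congr (_ + _)%E.
set D := _ `*` _ `*` _.
have mD : measurable D by apply: measurableX => //; exact: measurableX.
rewrite (eq_integral (fun z => (\1_(accepted el `&` slab 0 t B) z)%:E)); last first.
  move=> -[[a x] u] /set_mem [[/=]]; rewrite in_itv/= => a0 Bx u0.
  congr (_%:E); rewrite !indicE; congr (nat_of_bool _)%:R.
  apply/idP/idP => /set_mem h; apply/mem_set.
    by split => //; rewrite /accepted/=; move: h; rewrite /= in_itv.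
  by move: h => [h _]; rewrite /= in_itv.
rewrite integral_indic//; last exact: measurable_accepted.
congr (n _); apply/setIidPl => -[[a x] u] [/andP[/= u0 _] [/= a0 Bx]].
by split => /=; [split => /=; rewrite ?in_itv|rewrite in_itv/= u0].
Qed.

Lemma path_birth s t (B : set (measurableTypeR R)) :
  0 <= s -> s <= t -> measurable B ->
  (count_in (e t) B)%:R%:E =
    (n (accepted el `&` slab s t B) + (count_in (e s) B)%:R%:E)%E.
Proof.
move=> s0 st mB; rewrite !path_birth0//; last exact: le_trans st.
rewrite addeA; congr (_ + _)%E; rewrite -measureU; first last.
- apply/seteqP; split => // -[[a x] u] [[_ [/= /andP[sa _] _]]].
  by move=> [_ [/= /andP[_ +] _]]; rewrite leNgt sa.
- exact: measurable_accepted.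
- exact: measurable_accepted.
rewrite -setIUr; congr (n (_ `&` _)).
apply/seteqP; split => -[[a x] u]; rewrite /slab/=.
  by move=> [/andP[a0 at_] Bx]; case: (ltP s a) => sa;
    [left; rewrite at_|right; rewrite a0].
move=> [] [/andP[h1 h2] Bx]; split => //.
  by rewrite h2 (le_lt_trans s0).
by rewrite h1 (le_trans h2).
Qed.

Lemma regular_path_of_equation :
  (forall B, measurable B -> n B = +oo%E \/ exists k : nat, n B = k%:R%:E) ->
  n [set z | z.2 = 0] = 0%E -> regular_path n e el.
Proof.
move=> nc n0; split => //.
- exact: path_start.
- exact: path_mono.
- exact: path_left.
- exact: path_right.
- by move=> s t B; exact: measurable_accepted.
- exact: path_birth.
Qed.

End FromEquation.

End Paths.

(** * The right front *)

Section Fronts.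
Variable R : realType.
Local Notation point_type := (space_time_mark R).
Implicit Types c : {fset R}.

(** When the origin is a particle, this says that the graph joining particles at distance
    at most 1 is connected; this form gives the neighbour on the inner side directly. *)
Definition connected_config c :=
  (forall x, x \in c -> 0 < x -> exists2 y, y \in c & x - 1 <= y < x) /\
  (forall x, x \in c -> x < 0 -> exists2 y, y \in c & x < y <= x + 1).

(** The gap of a lone particle is set to 3: a fictitious particle at [X - 3] has no influence
    within distance 1 of [X], so one formula for the birth rate covers both cases. *)
Record is_front c (X Z : R) : Prop := {
  front_in : X \in c;
  front_max : forall y, y \in c -> y <= X;
  front_gap : (Z = 3 /\ c = [fset X]%fset) \/
    [/\ 0 < Z <= 1, X - Z \in c & forall y, y \in c -> y = X \/ y <= X - Z] }.

Lemma fset_min c (P : pred R) : (exists2 x, x \in c & P x) ->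
  exists m, [/\ m \in c, P m & forall y, y \in c -> P y -> m <= y].
Proof.
move=> [x xc Px].
have : exists2 m, m \in [seq y <- c | P y] &
    forall y, y \in [seq y <- c | P y] -> m <= y.
  have : x \in [seq y <- c | P y] by rewrite mem_filter Px.
  move: [seq y <- c | P y] => s.
  elim: s x {xc Px} => // a s IH x _; have [->|s0] := eqVneq s [::].
    by exists a; rewrite ?mem_seq1// => y; rewrite mem_seq1 => /eqP->.
  have [b bs] : exists b, b \in s by case: s s0 {IH} => // b s _; exists b; rewrite mem_head.
  have [m ms mm] := IH b bs.
  have [am|ma] := leP a m.
    exists a; first by rewrite mem_head.
    by move=> y; rewrite inE => /orP[/eqP->//|/mm]; exact: le_trans.
  exists m; first by rewrite inE ms orbT.
  by move=> y; rewrite inE => /orP[/eqP->|/mm//]; exact: ltW.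
move=> [m]; rewrite mem_filter => /andP[Pm mc] mm; exists m; split => // y yc Py.
by apply: mm; rewrite mem_filter Py.
Qed.

Lemma fset_max c (P : pred R) : (exists2 x, x \in c & P x) ->
  exists m, [/\ m \in c, P m & forall y, y \in c -> P y -> y <= m].
Proof.
move=> [x xc Px].
have [|m [mc Pm mm]] := @fset_min [fset - y | y in c]%fset (fun y => P (- y)).
  by exists (- x); rewrite ?opprK//; apply/imfsetP; exists x.
move: mc => /imfsetP[/= y yc my]; exists y; rewrite my opprK in Pm.
split => // z zc Pz; rewrite -lerN2 -my; apply: mm; rewrite ?opprK//.
by apply/imfsetP; exists z.
Qed.

(** The leftmost particle beyond [X] would have a neighbour behind it at distance at most
    1, which is at most [X]; so a gap of length more than 1 to the right of [X] cannot be
    crossed. *)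
Lemma connected_right c X : connected_config c -> 0 <= X ->
  (forall x, x \in c -> X < x -> X + 1 < x) -> forall x, x \in c -> x <= X.
Proof.
move=> [cr _] X0 gapX x xc; rewrite leNgt; apply/negP => Xx.
have [|m [mc /= Xm mm]] := @fset_min c (fun y => X < y); first by exists x.
have [|y yc /andP[my ym]] := cr m mc; first exact: le_lt_trans Xm.
have [yX|Xy] := leP y X; last by have := mm _ yc Xy; lra.
by have := gapX _ mc Xm; lra.
Qed.

Lemma front_unique c X Z X' Z' :
  is_front c X Z -> is_front c X' Z' -> X = X' /\ Z = Z'.
Proof.
move=> [Xc mX gX] [X'c mX' gX'].
have XX' : X = X' by apply/le_anti; rewrite mX'//= mX.
split=> //; rewrite -{}XX' {X'} in X'c mX' gX' *.
case: gX => [[-> cX]|[Z01 Zc mZ]]; case: gX' => [[-> cX']|[Z'01 Z'c mZ']] //.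
- by move: Z'c; rewrite cX inE => /eqP; lra.
- by move: Zc; rewrite cX' inE => /eqP; lra.
- have [] := mZ _ Z'c; have [] := mZ' _ Zc; lra.
Qed.

(** Here [Z] is the gap and [y] the position relative to the front particle. *)
Definition birth_rate (Z y : R) : R := (`|y| <= 1)%R%:R + (`|y + Z| <= 1)%R%:R.

(** The effect on the front of a point at [x] with mark [u].  In the second case the new
    particle becomes the second rightmost one; for a lone particle the condition
    [S.1 - 1 <= x] is the effective one. *)
Definition front_step (S : R * R) (x u : R) : R * R :=
  if u <= birth_rate S.2 (x - S.1) then
    if S.1 < x then (x, x - S.1)
    else if (S.1 - S.2 < x) && (S.1 - 1 <= x) then (S.1, S.1 - x) else S
  else S.

Lemma truncated_rate_far c x :
  (forall y, y \in c -> 1 < `|x - y|) -> truncated_rate x c = 0.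
Proof.
move=> far; rewrite /truncated_rate big_seq big1 ?min_r//.
by move=> y /far; rewrite ltNge => /negbTE->.
Qed.

(** If [x] is within distance 1 of the second leading particle, it is within distance 1
    of the first one too, the rate has already reached its cap 2, and the particles
    behind do not count; otherwise they are all farther than 1 from [x]. *)
Lemma front_rate c X Z x : is_front c X Z -> X - 1 <= x -> X - Z < x ->
  truncated_rate x c = birth_rate Z (x - X).
Proof.
move=> [Xc mX gX] X1x XZx.
have m21 : Num.min 2 1 = 1 :> R by rewrite min_r; lra.
have m20 : Num.min 2 0 = 0 :> R by rewrite min_r; lra.
rewrite /truncated_rate /birth_rate.
case: gX => [[Z3 cX]|[/andP[Z0 Z1] Zc mZ]].
  rewrite cX big_seq_fset1 Z3 (_ : (`|x - X + 3| <= 1) = false) ?addr0; last first.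
    by apply/negbTE; rewrite -ltNge ger0_norm; lra.
  by case: (_ <= _) => /=; rewrite ?m21 ?m20.
rewrite (big_fsetD1 X Xc)/= (big_fsetD1 (X - Z))/=; last first.
  by rewrite !inE Zc andbT; apply/eqP; lra.
have -> : x - X + Z = x - (X - Z) by lra.
set s := \sum_(_ <- _) _; rewrite addrA.
have s0 : 0 <= s by apply: sumr_ge0.
have [xs|xs] := leP x (X - Z + 1).
  rewrite (_ : (`|x - X| <= 1) = true); last by rewrite ler_norml; lra.
  rewrite (_ : (`|x - (X - Z)| <= 1) = true); last by rewrite ler_norml; lra.
  by rewrite /= min_l; lra.
rewrite (_ : (`|x - (X - Z)| <= 1) = false); last first.
  by apply/negbTE; rewrite -ltNge ger0_norm; lra.
rewrite (_ : s = 0) ?addr0.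
  by case: (_ <= _) => /=; rewrite ?addr0 ?m21 ?m20.
rewrite /s big_seq big1// => y; rewrite !inE => /and3P[yZ yX yc].
have [yE|yle] := mZ _ yc; first by rewrite yE eqxx in yX.
by rewrite (_ : (_ <= _) = false)//; apply/negbTE; rewrite -ltNge ger0_norm; lra.
Qed.

End Fronts.

Section PathFronts.
Variable R : realType.
Local Notation point_type := (space_time_mark R).
Variables (n : {measure set point_type -> \bar R}) (e el : R -> {fset R}).
Hypothesis path : regular_path n e el.

Lemma measurable_mark0 : measurable [set z : point_type | z.2 = 0].
Proof.
rewrite (_ : [set z | _] = setT `*` [set 0]); first exact: measurableX.
by apply/seteqP; split => z //= [].
Qed.

Lemma rp_el s t : 0 < t -> 0 <= s < t ->
  exists2 r, s <= r < t & e r = el t.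
Proof.
move=> t0 /andP[s0 st]; have [r /andP[r0 rt] h] := rp_left path t0.
exists (Num.max r s); first by rewrite le_max lexx orbT gt_max rt st.
by apply: h; rewrite le_max lexx gt_max rt st.
Qed.

(** Let [tau] be the first time at which [B] is occupied; it is attained, by right
    continuity.  Before [tau] all particles are out of [B], hence at distance more than 1
    from its points, and the birth rate on [B] vanishes up to [tau]: only points with
    mark 0 could be accepted, and there are none. *)
Lemma no_isolated t (B : set (measurableTypeR R)) : 0 <= t -> measurable B ->
  ~ B 0 -> (forall x y, B x -> y \in e t -> ~ B y -> 1 < `|x - y|) ->
  forall x, x \in e t -> ~ B x.
Proof.
move=> t0 mB B0 far x xt Bx.
pose S := [set s | 0 <= s <= t /\ exists2 y, y \in e s & B y].
have hS : has_inf S.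
  split; first by exists t; split; [rewrite t0 lexx|exists x].
  by exists 0 => s [/andP[]].
pose tau := inf S.
have tauS s : S s -> tau <= s by exact: (inf_lbound hS.2).
have tau0 : 0 <= tau by apply: lb_le_inf hS.1 _ => s [/andP[]].
have Stau : S tau.
  have [r taur er] := rp_right path tau0.
  have d0 : 0 < r - tau by lra.
  have [s Ss sr] := inf_adherent d0 hS.
  have es : e s = e tau by apply: er; rewrite tauS//; move: sr; rewrite -/tau; lra.
  case: (Ss) => /andP[_ st] [y ys By]; split; last by exists y => //; rewrite -es.
  by rewrite tau0 (le_trans (tauS _ Ss)).
have [/andP[_ taut] [y ytau By]] := Stau.
have {}tau0 : 0 < tau.
  rewrite lt_neqAle tau0 andbT; apply/negP => /eqP tau0E.
  by move: ytau; rewrite -tau0E (rp_start path) inE => /eqP y0; apply: B0; rewrite -y0.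
have n0 : n (accepted el `&` slab 0 tau B) = 0%E.
  apply/eqP; rewrite -measure_le0 -(rp_zero path); apply: le_measure.
  - by rewrite inE; exact: (rp_measurable path).
  - by rewrite inE; exact: measurable_mark0.
  move=> [[a b] u] [/= /andP[u0 ub] [/= /andP[a0 atau] Bb]].
  apply/le_anti; rewrite u0 andbT; apply: (le_trans ub).
  have [|r /andP[r0 ra] er] := @rp_el 0 a a0; first by rewrite lexx.
  rewrite truncated_rate_far// => z; rewrite -er => zr; apply: far => //.
    by apply: fsubsetP zr; apply: (rp_mono path) => //; lra.
  move=> Bz; suff /tauS : S r by lra.
  by split; [lra|exists z].
have := rp_birth path (lexx 0) (ltW tau0) mB.
rewrite n0 add0e (rp_start path) => -[/eqP]; rewrite eqr_nat => /eqP cnt.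
have /count_in_gt0 : exists2 y, y \in e tau & B y by exists y.
rewrite cnt => /count_in_gt0[z]; rewrite inE => /eqP-> //.
Qed.

(** If no particle were in [x - 1, x[, the half-line beginning at [x] would be isolated
    in the sense of [no_isolated]. *)
Lemma path_connected t : 0 <= t -> connected_config (e t).
Proof.
move=> t0; split=> x xt x0; apply: contrapT => h.
  apply: (@no_isolated t `[x, +oo[%classic _ _ _ _ x xt) => //=.
  - by rewrite in_itv/= andbT; lra.
  - move=> a y; rewrite !in_itv/= !andbT => xa yt /negP; rewrite -ltNge => yx.
    have [yx1|xy1] := leP (x - 1) y; first by exfalso; apply: h; exists y => //; lra.
    by rewrite ger0_norm; lra.
  - by rewrite in_itv/= lexx.
apply: (@no_isolated t `]-oo, x]%classic _ _ _ _ x xt) => //=.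
- by rewrite in_itv/=; lra.
- move=> a y; rewrite !in_itv/= => xa yt /negP; rewrite -ltNge => yx.
  have [yx1|xy1] := leP y (x + 1); first by exfalso; apply: h; exists y => //; lra.
  by rewrite ler0_norm; lra.
- by rewrite in_itv/= lexx.
Qed.

Lemma origin_in t : 0 <= t -> 0 \in e t.
Proof.
move=> t0; apply: (fsubsetP (rp_mono path (lexx 0) t0)).
by rewrite (rp_start path) inE.
Qed.

Lemma is_front_ge0 t X Z : 0 <= t -> is_front (e t) X Z -> 0 <= X.
Proof. by move=> t0 [_ mX _]; apply: mX; exact: origin_in. Qed.

Lemma front_exists t : 0 <= t -> exists X Z, is_front (e t) X Z.
Proof.
move=> t0; have [cr cl] := path_connected t0.
have [|X [Xc _ mX]] := @fset_max R (e t) xpredT.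
  by exists 0 => //; exact: origin_in.
have {}mX y : y \in e t -> y <= X by move=> /mX; exact.
exists X; have [eX|eX] := eqVneq (e t) [fset X]%fset.
  by exists 3; split => //; left.
have [|Y [Yc /= YX mY]] := @fset_max R (e t) (fun y => y != X).
  have : ~~ (e t `<=` [fset X])%fset.
    by apply: contra eX => h; rewrite eqEfsubset h/= fsub1set.
  move=> /fsubsetPn[y yt]; rewrite inE => yX; by exists y.
have {}YX : Y < X by rewrite lt_neqAle YX mX.
have X0 : 0 <= X by apply: mX; exact: origin_in.
exists (X - Y); split => //; right; split.
- suff : X - 1 <= Y by lra.
  have [X0'|X0'] := ltP 0 X.
    have [y yc /andP[Xy yX]] := cr X Xc X0'.
    by rewrite (le_trans Xy)//; apply: mY => //; rewrite lt_eqF.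
  have [|y yc /andP[Yy yY]] := cl Y Yc; first lra.
  have [yX|yX] := eqVneq y X; first lra.
  by have := mY _ yc yX; lra.
- by rewrite subKr.
- by move=> y yc; rewrite subKr; have [->|yX] := eqVneq y X; [left|right; exact: mY].
Qed.

(** As rates are at most 2, only marks in [0, 2] matter. *)
Definition cell (s t : R) (B : set R) : set point_type :=
  [set z | (s < z.1.1 <= t /\ B z.1.2) /\ 0 <= z.2 <= 2].

Lemma accepted_cell s t B : accepted el `&` slab s t B `<=` cell s t B.
Proof.
move=> z [/= /andP[z0 zr] sl]; split => //; rewrite z0 (le_trans zr)//.
exact: truncated_rate_le2.
Qed.

Lemma cellS s s' t t' B B' : s' <= s -> t <= t' -> B `<=` B' ->
  cell s t B `<=` cell s' t' B'.
Proof.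
move=> ss' tt' BB' z [[/andP[sz zt] Bz] z02]; split => //; split; last exact: BB'.
by rewrite (le_lt_trans ss') ?(le_trans zt).
Qed.

Lemma measurable_cell s t (B : set (measurableTypeR R)) :
  measurable B -> measurable (cell s t B).
Proof.
move=> mB; rewrite (_ : cell s t B = slab s t B `&` (setT `*` `[0, 2]%classic)).
  by apply: measurableI; [exact: measurable_slab|exact: measurableX].
by apply/seteqP; split => -[z u]/=; rewrite /cell/slab/= in_itv/=; [case|move=> [? []]].
Qed.

Lemma quiet_same s t (W : set (measurableTypeR R)) : 0 <= s -> s <= t ->
  measurable W -> n (cell s t W) = 0%E ->
  forall x, W x -> (x \in e t) = (x \in e s).
Proof.
move=> s0 st mW nW x Wx.
have := rp_birth path s0 st (measurable_set1 x).
rewrite !count_in_set1 (_ : n _ = 0%E).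
  by rewrite add0e => -[/eqP]; rewrite eqr_nat; case: (x \in e t); case: (x \in e s).
apply/eqP; rewrite -measure_le0 -nW; apply: le_measure; rewrite ?inE.
- exact: (rp_measurable path).
- exact: measurable_cell.
- by apply: subset_trans (@accepted_cell _ _ _) _; apply: cellS => // y ->.
Qed.

(** Only particles near [X] can alter the front: a particle beyond [X + 1] needs a chain
    of particles leading to it, and a lone particle sits at the origin, so that particles
    to its left also need a chain. *)
Lemma front_stable s t X Z : 0 <= s -> s <= t -> is_front (e s) X Z ->
  (forall x, x \in e t -> X - 1 <= x <= X + 1 -> x \in e s \/
    (Z <= 1 /\ x <= X - Z)) ->
  is_front (e t) X Z.
Proof.
move=> s0 st fX same; have t0 := le_trans s0 st.
have X0 := is_front_ge0 s0 fX.
case: fX => Xc mX gX; have sub := fsubsetP (rp_mono path s0 st).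
have mX' : forall y, y \in e t -> y <= X.
  apply: connected_right (path_connected t0) X0 _ => x xt Xx.
  rewrite ltNge; apply/negP => xX1.
  have [|/mX|[Z1 xZ]] := same _ xt; [lra|lra|].
  by case: gX => [[Z3 _]|[Z01 _ _]]; lra.
split => //; first exact: sub.
case: gX => [[Z3 cX]|[Z01 Zc mZ]]; [left|right]; split => //.
- have oX : 0 = X by have := origin_in s0; rewrite cX inE => /eqP.
  have near y : y \in e t -> X - 1 <= y -> y = X.
    move=> yt Xy; have [||] := same y yt; first by have := mX' _ yt; lra.
      by rewrite cX inE => /eqP.
    by rewrite Z3; lra.
  apply/fsetP => y; rewrite inE; apply/idP/eqP => [yt|->]; last exact: sub.
  have [/near->//|yX] := leP (X - 1) y.
  have [|m [mt /= mX1 mm]] := @fset_max R (e t) (fun y => y < X - 1).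
    by exists y.
  have [_ cl] := path_connected t0; have [|z zt /andP[mz zm]] := cl m mt.
    by rewrite oX; lra.
  have [/(near _ zt)|zX] := leP (X - 1) z; first by lra.
  by have := mm _ zt zX; lra.
- exact: sub.
- move=> y yt; have := mX' _ yt => yX.
  have [Xy|yX1] := leP (X - 1) y; last by right; lra.
  have [||[_ ?]] := same y yt; [lra|exact: mZ|by right].
Qed.

Lemma quiet_front s t X Z (W : set (measurableTypeR R)) : 0 <= s -> s <= t ->
  measurable W -> (forall x, X - 1 <= x <= X + 2 -> W x) ->
  n (cell s t W) = 0%E -> is_front (e s) X Z -> is_front (e t) X Z.
Proof.
move=> s0 st mW XW nW fX; apply: (front_stable s0 st fX) => x xt xX; left.
by rewrite -(quiet_same s0 st mW nW)//; apply: XW; lra.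
Qed.

(** Before the birth the front is the one at time [s], so the point is accepted in
    [front_step] under the same condition as in the process, by [front_rate].  The cases
    are: a birth in front of [X], a birth between the two leading particles, and a birth
    behind the second one, which has no effect. *)
Lemma single_birth_front s t X Z (W : set (measurableTypeR R))
    (a x0 u : R) : 0 <= s -> s <= t -> measurable W ->
  (forall x, X - 1 <= x <= X + 2 -> W x) ->
  cell s t W (a, x0, u) ->
  (forall B, measurable B -> n (cell s t W `&` B) = (\1_B (a, x0, u))%:E) ->
  is_front (e s) X Z ->
  is_front (e t) (front_step (X, Z) x0 u).1 (front_step (X, Z) x0 u).2.
Proof.
move=> s0 st mW XW [/= [/andP[sa at_] Wx0] /andP[u0 u2]] nW fX.
have t0 := le_trans s0 st; have X0 := is_front_ge0 s0 fX.
have a0 := le_lt_trans s0 sa.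
(* A mark 0 would put the point in a set where [n] vanishes. *)
have {}u0 : 0 < u.
  rewrite lt_neqAle u0 andbT; apply/eqP => u0E.
  have := nW _ measurable_mark0; rewrite indicE mem_set//= => nu.
  suff : (1 <= n [set z : point_type | z.2 = 0%R])%E by rewrite (rp_zero path) lee_fin ler10.
  rewrite -nu; apply: le_measure; rewrite ?inE; last exact: subIsetr.
    by apply: measurableI; [exact: measurable_cell|exact: measurable_mark0].
  exact: measurable_mark0.
have quiet r : s <= r < a -> n (cell s r W) = 0%E.
  move=> /andP[sr ra]; have := nW _ (measurable_cell s r mW).
  rewrite (_ : _ `&` _ = cell s r W).
    move=> ->; rewrite indicE memNset//= => -[[/= /andP[_ ar] _] _]; lra.
  by apply/setIidPr/cellS => //; lra.
have [|r /andP[sr ra] er] := @rp_el s a a0; first by rewrite s0 sa.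
have r0 := le_trans s0 sr.
have fr : is_front (e r) X Z.
  by apply: (quiet_front s0 sr mW XW) => //; apply: quiet; rewrite sr.
have born x : W x -> x \in e t =
    (x \in e s) || ((x == x0) && (u <= truncated_rate x0 (e r))).
  move=> Wx; have := rp_birth path s0 st (measurable_set1 x).
  have macc := rp_measurable path t s0 (measurable_set1 x).
  rewrite !count_in_set1; have := nW _ macc.
  rewrite setIC (setIidl _); last first.
    by apply: subset_trans (@accepted_cell _ _ _) _; apply: cellS => // y ->.
  move=> ->; rewrite (_ : \1__ _ = ((x == x0) && (u <= truncated_rate x0 (e r)))%:R).
    rewrite -EFinD -natrD => -[/eqP]; rewrite eqr_nat.
    by case: (x \in e t); case: (x \in e s); case: (_ && _).
  rewrite indicE; congr (nat_of_bool _)%:R; apply/idP/idP.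
    by move=> /set_mem[/= /andP[_ ux] [_ /= <-]]; rewrite er eqxx.
  move=> /andP[/eqP-> ux]; apply/mem_set; split => /=.
    by rewrite /accepted/= (ltW u0) -er.
  by split => //=; rewrite sa.
(* A particle at [x0] already would be counted twice at time [t]. *)
have not_both : u <= truncated_rate x0 (e r) -> x0 \notin e s.
  move=> ux; have := rp_birth path s0 st (measurable_set1 x0).
  have macc := rp_measurable path t s0 (measurable_set1 x0).
  rewrite !count_in_set1; have := nW _ macc.
  rewrite setIC (setIidl _); last first.
    by apply: subset_trans (@accepted_cell _ _ _) _; apply: cellS => // y ->.
  move=> ->; rewrite indicE mem_set/=; last first.
    by split => /=; [rewrite /accepted/= (ltW u0) -er|split => //=; rewrite sa].
  rewrite -EFinD -natrD => -[/eqP]; rewrite eqr_nat.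
  by case: (x0 \in e t); case: (x0 \in e s).
have [acc|nacc] := boolP (u <= truncated_rate x0 (e r)); last first.
  have -> : front_step (X, Z) x0 u = (X, Z).
    rewrite /front_step/=; case: ifPn => // ub; case: ifPn => [Xx|].
      by move: nacc; rewrite (front_rate fr) ?ub//; case: fr => _ _ []; move=> []; lra.
    move=> _; case: ifPn => // /andP[Zx X1x].
    by move: nacc; rewrite (front_rate fr) ?ub.
  apply: (front_stable s0 st fX) => x xt xX; left.
  by move: xt; rewrite born ?(negbTE nacc) ?andbF ?orbF//; apply: XW; lra.
have x0s := not_both acc.
have rate0 : 0 < truncated_rate x0 (e r) by exact: lt_le_trans acc.
have x0t : x0 \in e t by rewrite born// acc eqxx orbT.
have near : exists2 y, y \in e r & `|x0 - y| <= 1.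
  apply: contrapT => h; move: rate0; rewrite truncated_rate_far ?ltxx// => y yr.
  by rewrite ltNge; apply/negP => h'; apply: h; exists y.
have x0X1 : x0 <= X + 1.
  by case: near => y /(front_max fr); rewrite ler_norml; lra.
have x0X : x0 != X by apply: contraNneq x0s => ->; exact: front_in fX.
have old x : x \in e t -> X - 1 <= x <= X + 2 -> x \in e s \/ x = x0.
  move=> xt xX; move: xt; rewrite born; last exact: XW.
  by move=> /orP[->|/andP[/eqP-> _]]; [left|right].
have Xt : X \in e t by apply: (fsubsetP (rp_mono path s0 st)); exact: front_in fX.
rewrite /front_step/=; have [Xx0|x0leX] := ltP X x0.
  (* No other particle has been born, so [X] becomes the second rightmost one. *)
  rewrite -(front_rate fr) ?acc//=; [|lra|]; last first.
    by case: (fX) => _ _ []; [move=> [-> _]|move=> [/andP[? ?] _ _]]; lra.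
  have mt : forall x, x \in e t -> x <= x0.
    apply: connected_right (path_connected t0) _ _; first lra.
    move=> x xt x0x; rewrite ltNge; apply/negP => xx0.
    have [|/(front_max fX)|xE] := old _ xt; lra.
  split => //; right; split; first lra.
    by rewrite subKr.
  move=> y yt; rewrite subKr; have [yX|Xy] := leP y X; first by right.
  have y0 := mt _ yt.
  by have [|/(front_max fX)|] := old _ yt; [lra|lra|left].
have {x0leX x0X} x0X : x0 < X by rewrite lt_neqAle x0X.
have mt : forall x, x \in e t -> x <= X.
  apply: connected_right (path_connected t0) X0 _ => x xt Xx.
  rewrite ltNge; apply/negP => xX1.
  by have [|/(front_max fX)|xE] := old _ xt; lra.
have [/andP[Zx X1x]|out] := boolP ((X - Z < x0) && (X - 1 <= x0)).
  rewrite -(front_rate fr) ?acc//=.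
  split => //; right; split; first lra.
    by rewrite subKr.
  move=> y yt; rewrite subKr; have yX := mt _ yt.
  have [Xy|yX1] := leP (X - 1) y; last by right; lra.
  have [|ys|->] := old _ yt; [lra| |by right].
  case: (fX) => _ _ [[_ cX]|[_ _ mZ]].
    by left; move: ys; rewrite cX inE => /eqP.
  by have [->|] := mZ _ ys; [left|right; lra].
rewrite if_same; apply: (front_stable s0 st fX) => x xt xX.
have [|xs|->] := old _ xt; [lra|by left|right].
case: (fX) (fr) => _ _ [[Z3 _]|[/andP[Z0 Z1] _ _]].
  move: out; rewrite Z3; case: near => y yr; rewrite ler_norml => h1 h2 fr'.
  have yX : y = X.
    by case: fr' => _ _ [[_ cX]|[]]; [move: yr; rewrite cX inE => /eqP|lra].
  by move: h2; rewrite negb_and -!leNgt -ltNge yX in h1 *; move=> /orP[]; lra.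
by move=> _; split => //; move: out; rewrite negb_and -leNgt -ltNge => /orP[]; lra.
Qed.

End PathFronts.

(** * Counting measures of mass one *)

Section UnitMass.
Variable R : realType.

(** The distribution function of [f] takes only the values 0 and 1; the point where it
    jumps is the almost sure value of [f]. *)
Lemma dichotomy_atom d (T : measurableType d) (m : {measure set T -> \bar R})
    (f : T -> R) : measurable_fun [set: T] (f : T -> measurableTypeR R) ->
  m setT = 1%E -> (forall B, measurable B -> m B = 0%E \/ m B = 1%E) ->
  exists c, m.-negligible [set z | f z != c].
Proof.
move=> mf mT dich.
have mle a : measurable [set z | f z <= a].
  rewrite -[X in measurable X]setTI (_ : [set z | f z <= a] = f @^-1` `]-oo, a]%classic).
    exact: mf.
  by apply/seteqP; split => z/=; rewrite in_itv.
have mC B : measurable B -> m B = 1%E -> m.-negligible (~` B).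
  move=> mB mB1; apply/negligibleP; first exact: measurableC.
  have : m (B `|` ~` B) = (m B + m (~` B))%E.
    by apply: measureU; [|exact: measurableC|rewrite setICr].
  rewrite setUCr mT mB1; have [//|->] := dich _ (measurableC mB).
  by move=> /eqP; rewrite -EFinD eqe lt_eqF ?ltrDl.
have notT : ~ m.-negligible [set: T].
  move=> h; have : m setT = 0%E by exact/negligibleP.
  by rewrite mT => /eqP; rewrite onee_eq0.
(* The constant value is the infimum of [S], where the distribution function jumps. *)
pose S := [set a | m [set z | f z <= a] = 1%E].
have S0 : S !=set0.
  apply: contrapT => hS; apply: notT.
  rewrite (_ : setT = \bigcup_(k : nat) [set z | f z <= k%:R]).
    apply: negligible_bigcup => k; apply/negligibleP => //.
    have [//|h] := dich _ (mle k%:R).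
    by exfalso; apply: hS; exists k%:R.
  apply/esym/seteqP; split => // z _; exists (Num.bound `|f z|) => //=.
  by rewrite (le_trans (ler_norm _))// ltW// archi_boundP.
have lS : has_lbound S.
  apply: contrapT => hS; apply: notT.
  rewrite (_ : setT = \bigcup_(k : nat) ~` [set z | f z <= - k%:R]).
    apply: negligible_bigcup => k; apply: mC => //.
    have [h|//] := dich _ (mle (- k%:R)); exfalso; apply: hS.
    exists (- k%:R) => a Sa; rewrite leNgt; apply/negP => ak.
    have : (m [set z | (f z <= a)%R] <= m [set z | (f z <= - k%:R)%R])%E.
      by apply: le_measure; rewrite ?inE// => z /= /le_trans; apply; exact: ltW.
    by rewrite h Sa lee_fin ler10.
  apply/esym/seteqP; split => // z _; exists (Num.bound `|f z|) => //=.
  apply/negP; rewrite -ltNge ltrNl (le_lt_trans _ (archi_boundP _))//.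
  by rewrite -normrN ler_norm.
exists (inf S).
rewrite (_ : [set z | _] = (\bigcup_(k : nat) ~` [set z | f z <= inf S + k.+1%:R^-1]) `|`
   (\bigcup_(k : nat) [set z | f z <= inf S - k.+1%:R^-1])).
  apply: negligibleU; apply: negligible_bigcup => k.
    apply: mC => //; have [h|//] := dich _ (mle (inf S + k.+1%:R^-1)).
    have k0 : 0 < k.+1%:R^-1 :> R by [].
    have [a Sa ak] := inf_adherent k0 (conj S0 lS).
    have : (m [set z | (f z <= a)%R] <= m [set z | (f z <= inf S + k.+1%:R^-1)%R])%E.
      by apply: le_measure; rewrite ?inE// => z /= /le_trans; apply; exact: ltW.
    by rewrite h Sa lee_fin ler10.
  apply/negligibleP => //; have [//|h] := dich _ (mle (inf S - k.+1%:R^-1)).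
  have k0 : 0 < k.+1%:R^-1 :> R by [].
  have : inf S <= inf S - k.+1%:R^-1 by exact: inf_lbound.
  by rewrite lerBrDr gerDl leNgt k0.
move: (inf S) => c; clear; apply/seteqP; split => z /=.
  rewrite neq_lt => /orP[fz|fz]; [right|left].
    have d0 : 0 < c - f z by lra.
    have [k _ hk] := near_infty_natSinv_lt (PosNum d0).
    by exists k => //=; move: (hk k (leqnn k)) => /=; move: (_^-1) => q; lra.
  have d0 : 0 < f z - c by lra.
  have [k _ hk] := near_infty_natSinv_lt (PosNum d0).
  by exists k => //=; apply/negP; rewrite -ltNge; move: (hk k (leqnn k)) => /=; move: (_^-1) => q; lra.
have k0 k : 0 < k.+1%:R^-1 :> R by [].
move=> [] [k _] /=; move: (k0 k); move: (_^-1) => q q0.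
  by move=> /negP; rewrite -ltNge neq_lt; lra.
by rewrite neq_lt; lra.
Qed.

(** Restricted to [C], an integer-valued measure of mass 1 takes only the values 0 and 1;
    the three coordinates are then almost everywhere constant, and the measure is a Dirac
    mass. *)
Lemma unit_mass_dirac (n : {measure set (space_time_mark R) -> \bar R})
    (C : set (space_time_mark R)) :
  (forall B, measurable B -> n B = +oo%E \/ exists k : nat, n B = k%:R%:E) ->
  measurable C -> n C = 1%E ->
  exists2 z, C z & forall B, measurable B -> n (C `&` B) = (\1_B z)%:E.
Proof.
move=> nc mC nC1; pose m : {measure set _ -> \bar R} := mrestr n mC.
have dich B : measurable B -> m B = 0%E \/ m B = 1%E.
  move=> mB; have : (m B <= 1)%E.
    rewrite /m /= /mrestr -nC1; apply: le_measure; rewrite ?inE//; exact: measurableI.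
  rewrite /m /= /mrestr; have [->|[k ->]] := nc _ (measurableI _ _ mB mC).
    by rewrite leye_eq.
  by rewrite lee_fin (ler_nat _ k 1); case: k => [|[|]]//; [left|right].
have mT : m setT = 1%E by rewrite /m /= /mrestr setTI.
have [s hs] := @dichotomy_atom _ _ m (fun z => z.1.1)
  (measurableT_comp measurable_fst measurable_fst) mT dich.
have [x hx] := @dichotomy_atom _ _ m (fun z => z.1.2)
  (measurableT_comp measurable_snd measurable_fst) mT dich.
have [u hu] := @dichotomy_atom _ _ m (fun z => z.2) measurable_snd mT dich.
pose z : space_time_mark R := (s, x, u).
have mz : measurable [set z].
  rewrite (_ : [set z] = [set s] `*` [set x] `*` [set u]).
    by do 2 apply: measurableX => //.
  by apply/seteqP; split => -[[a b] c] //= => [[-> -> ->]|[[-> ->] ->]].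
have nz : m (~` [set z]) = 0%E.
  apply/negligibleP; first exact: measurableC.
  apply: negligibleS (negligibleU (negligibleU hs hx) hu) => -[[a b] c] /= abc.
  have [sa|] := eqVneq a s; last by left; left.
  have [bx|] := eqVneq b x; last by left; right.
  by right; apply/eqP => cu; apply: abc; rewrite sa bx cu.
have null B : measurable B -> ~ B z -> m B = 0%E.
  move=> mB Bz; apply/eqP; rewrite -measure_le0 -nz.
  apply: le_measure; rewrite ?inE//; first exact: measurableC.
  by move=> y By yz; apply: Bz; rewrite -yz.
exists z.
  apply: contrapT => Cz; have := null _ mC Cz.
  by rewrite /m /= /mrestr setIid nC1 => /eqP; rewrite onee_eq0.
move=> B mB; rewrite setIC; have [/set_mem Bz|/negP Bz] := boolP (z \in B).
  rewrite indicE mem_set//; have [h|//] := dich _ mB.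
  have : m setT = 0%E.
    rewrite -(setUCr B) measureU0//; first exact: measurableC.
    by apply: null; [exact: measurableC|move=> /(_ Bz)].
  by rewrite mT => /eqP; rewrite onee_eq0.
rewrite indicE (negbTE (introN idP Bz)); apply: null => // Bz'.
by apply: Bz; exact/mem_set.
Qed.

End UnitMass.

(** * Independence of the past and the future *)

Section PoissonIndependence.
Context d (T : measurableType d) (R : realType) (P : probability T R).
Variable N : R.-ker T ~> space_time_mark R.
Hypothesis HN : poisson_point_process P N.
Local Notation point_type := (space_time_mark R).

Lemma measurable_count (B : set point_type) (A : set (\bar R)) :
  measurable B -> measurable A -> measurable [set w | A (N w B)].
Proof.
move=> mB mA; rewrite -[X in measurable X]setTI.
exact: (measurable_kernel N B mB measurableT A mA).
Qed.

Lemma measurable_count_eq (B : set point_type) (x : \bar R) :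
  measurable B -> measurable [set w | N w B = x].
Proof.
by move=> mB; apply: (@measurable_count B [set x]) => //; exact: emeasurable_set1.
Qed.

Lemma poisson_count0 (B : set point_type) (l : R) : measurable B ->
  mean_measure B = l%:E -> P [set w | N w B = 0%E] = (expR (- l))%:E.
Proof.
move=> mB ml; have := ppp_poisson HN 0 mB; rewrite ml => -> //; last exact: ltry.
have l0 : 0 <= l by rewrite -lee_fin -ml /mean_measure measure_ge0.
rewrite /= /poisson_prob; case: ifPn => l1.
  by rewrite esum_set1 ?lee_fin ?poisson_pmf_ge0// /poisson_pmf l1 expr0 fact0 invr1 !mul1r.
have -> : l = 0 by lra.
by rewrite diracE mem_set// oppr0 expR0.
Qed.

Lemma poisson_count1 (B : set point_type) (l : R) : measurable B ->
  mean_measure B = l%:E -> P [set w | N w B = 1%E] = (l * expR (- l))%:E.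
Proof.
move=> mB ml; have := ppp_poisson HN 1 mB; rewrite ml => -> //; last exact: ltry.
have l0 : 0 <= l by rewrite -lee_fin -ml /mean_measure measure_ge0.
rewrite /= /poisson_prob; case: ifPn => l1.
  rewrite esum_set1 ?lee_fin ?poisson_pmf_ge0// /poisson_pmf l1 expr1.
  by rewrite invr1 mulr1.
have -> : l = 0 by lra.
by rewrite diracE memNset//= mul0r.
Qed.

(** The definition has families indexed by ordinals; the atoms used below are indexed by
    finite functions. *)
Lemma count_independent (I : finType) (B : I -> set point_type)
    (A : I -> set (\bar R)) : (forall i, measurable (B i)) ->
  (forall i j, i != j -> B i `&` B j = set0) -> (forall i, measurable (A i)) ->
  P [set w | forall i, A i (N w (B i))] =
    (\prod_i P [set w | A i (N w (B i))])%E.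
Proof.
move=> mB dB mA.
pose B' (j : 'I_#|I|) := B (enum_val j); pose A' (j : 'I_#|I|) := A (enum_val j).
have tB : trivIset setT B'.
  move=> i j _ _ [z [Bi Bj]]; apply: enum_val_inj; apply: contrapT => /eqP ij.
  by have := dB _ _ ij; rewrite -subset0 => /(_ z); apply.
have := @ppp_independent _ _ _ _ _ HN #|I| B' A' (fun=> mB _) tB (fun=> mA _).
rewrite (_ : [set w | _] = [set w | forall i, A i (N w (B i))]).
  move=> ->; rewrite (reindex (@enum_val I predT))//=.
  by exists enum_rank => x _; [exact: enum_valK|exact: enum_rankK].
apply/seteqP; split => w h i; last exact: h.
by have := h (enum_rank i); rewrite /A' /B' enum_rankK.
Qed.

Definition events_in (Q : set point_type) : set (set T) :=
  [set E | exists (B : set point_type) (A : set (\bar R)),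
     [/\ measurable B, B `<=` Q, measurable A & E = [set w | A (N w B)]]].

(** Finite conjunctions of events of [events_in]: the pi-system generating the same
    sigma-algebra. *)
Definition cylinders (Q : set point_type) : set (set T) :=
  [set E | exists (n : nat) (B : nat -> set point_type) (A : nat -> set (\bar R)),
     [/\ forall i, measurable (B i) /\ B i `<=` Q, forall i, measurable (A i) &
         E = [set w | forall i, (i < n)%N -> A i (N w (B i))]]].

Lemma measurable_cylinder Q : cylinders Q `<=` measurable.
Proof.
move=> _ [n [B [A [mB mA ->]]]].
rewrite (_ : [set w | _] = \bigcap_(i in [set i | (i < n)%N]) [set w | A i (N w (B i))]).
  apply: fin_bigcap_measurable => [|i _]; first exact: finite_II.
  by apply: (@measurable_count (B i) (A i)) => //; case: (mB i).
by apply/seteqP; split => w h i; exact: h.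
Qed.

Lemma cylinders_setI Q : setI_closed (cylinders Q).
Proof.
move=> _ _ [n [B [A [mB mA ->]]]] [n' [B' [A' [mB' mA' ->]]]].
exists (n + n')%N, (fun i => if (i < n)%N then B i else B' (i - n)%N),
  (fun i => if (i < n)%N then A i else A' (i - n)%N); split.
- by move=> i; case: ifPn.
- by move=> i; case: ifPn.
apply/seteqP; split => w /=.
  move=> [h h'] i; case: (ltnP i n) => [/h//|ni ii]; apply: h'.
  by rewrite ltn_subLR.
move=> h; split => i ii.
  by have := h i; rewrite ii; apply; rewrite (leq_trans ii)// ?leq_addr.
have := h (n + i)%N; rewrite ltn_add2l (ltnNge (n + i)) leq_addr/= addKn; exact.
Qed.

Section Atoms.
Variables (Q : set point_type) (n : nat) (B : nat -> set point_type).
Hypothesis mQ : measurable Q.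
Hypothesis BQ : forall i, measurable (B i) /\ B i `<=` Q.

Let K : finType := {ffun 'I_n -> bool}.

(** The sets of a cylinder may overlap, while independence concerns disjoint sets.  The
    atoms of the finite Boolean algebra that they generate are disjoint. *)
Definition atom (s : K) : set point_type :=
  [set z | Q z /\ forall i : 'I_n, `[< B i z >] = s i].

Lemma measurable_atom s : measurable (atom s).
Proof.
rewrite (_ : atom s = Q `&` \bigcap_(i in [set: 'I_n]) (if s i then B i else ~` B i)).
  apply: measurableI => //; apply: fin_bigcap_measurable => // i _.
  by case: ifPn => _; [|apply: measurableC]; case: (BQ i).
apply/seteqP; split => z [Qz h]; split => // i.
  by move=> _; have := h i; case: (s i) => [/asboolP|/negbT/asboolPn].
by have := h i I; case: (s i) => Bz; [exact/asboolP|exact/negbTE/asboolPn].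
Qed.

Lemma atom_disjoint s s' : s != s' -> atom s `&` atom s' = set0.
Proof.
move=> ss'; rewrite -subset0 => z [[_ h] [_ h']].
by move/eqP: ss'; apply; apply/ffunP => i; rewrite -h -h'.
Qed.

Lemma bigcup_atom (i : 'I_n) : B i = \bigcup_(s in [set s : K | s i]) atom s.
Proof.
apply/seteqP; split => z.
  move=> Biz; exists [ffun j : 'I_n => `[< B j z >]].
    by rewrite /= ffunE; exact/asboolP.
  by split; [case: (BQ i) => _; exact|move=> j; rewrite ffunE].
by move=> [s /= si [_ /(_ i)]]; rewrite si => /asboolP.
Qed.

Lemma count_atoms w w' : (forall s, N w (atom s) = N w' (atom s)) ->
  forall i, (i < n)%N -> N w (B i) = N w' (B i).
Proof.
move=> ww' i ii; rewrite (bigcup_atom (Ordinal ii)).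
have tr : trivIset [set s : K | s (Ordinal ii)] atom.
  move=> s s' _ _ [z zs]; apply: contrapT => /eqP/atom_disjoint.
  by rewrite -subset0 => /(_ z); apply.
have fin : finite_set [set s : K | s (Ordinal ii)] by exact: finite_finset.
have mat s : [set s : K | s (Ordinal ii)] s -> measurable (atom s).
  by move=> _; exact: measurable_atom.
by rewrite !measure_fin_bigcup//; apply: eq_fsbigr => s _; exact: ww'.
Qed.

End Atoms.

(** The possible values of a count, as a countable type. *)
Definition ecard (k : option nat) : \bar R := if k is Some m then m%:R%:E else +oo%E.

(** The counts of the atoms determine whether a cylinder event occurs and take countably
    many values, so the event is a countable disjoint union of events that prescribe the
    counts of all atoms; to these the independence of counts of disjoint sets applies. *)
Lemma cylinder_independent (Q C D : set point_type) (A1 A2 : set (\bar R)) :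
  measurable Q -> measurable C -> measurable D -> measurable A1 -> measurable A2 ->
  Q `&` C = set0 -> Q `&` D = set0 -> C `&` D = set0 ->
  forall E, cylinders Q E ->
    P (E `&` ([set w | A1 (N w C)] `&` [set w | A2 (N w D)])) =
      (P E * (P [set w | A1 (N w C)] * P [set w | A2 (N w D)]))%E.
Proof.
move=> mQ mC mD mA1 mA2 QC QD CD E cE; have mE := measurable_cylinder cE.
case: cE => n [B [A [mB mA EE]]].
set F1 := [set w | A1 _]; set F2 := [set w | A2 _].
have mF1 : measurable F1 by exact: measurable_count.
have mF2 : measurable F2 by exact: measurable_count.
pose K : finType := {ffun 'I_n -> bool}.
pose Ek (k : {ffun K -> option nat}) : set T :=
  [set w | forall s, [set ecard (k s)] (N w (atom Q B s))].
have matom (s : K) : measurable (atom Q B s) := measurable_atom mQ mB s.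
have mek x : measurable [set ecard x] by exact: emeasurable_set1.
have mEk k : measurable (Ek k).
  rewrite (_ : Ek k = \bigcap_(s in [set: K]) [set w | [set ecard (k s)] (N w (atom Q B s))]).
    by apply: fin_bigcap_measurable => // s _; exact: measurable_count.
  by apply/seteqP; split => w h s; [move=> _; exact: h|exact: h].
have PEk k : P (Ek k) = (\prod_s P [set w | [set ecard (k s)] (N w (atom Q B s))])%E.
  apply: (@count_independent K (fun s => atom Q B s) (fun s => [set ecard (k s)])) => //.
  exact: atom_disjoint.
have PEkF k : P (Ek k `&` (F1 `&` F2)) = (P (Ek k) * (P F1 * P F2))%E.
  pose BB (i : K + bool) := match i with inl s => atom Q B s
    | inr b => if b then C else D end.
  pose AA (i : K + bool) := match i with inl s => [set ecard (k s)]
    | inr b => if b then A1 else A2 end.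
  have := @count_independent _ BB AA; rewrite big_sumType/= -PEk.
  rewrite big_bool/= => <-.
  - congr (P _); apply/seteqP; split => w /=.
      by move=> [h [h1 h2]] [s|[]]//; exact: h.
    by move=> h; split; [move=> s; exact: (h (inl s))|split;
      [exact: (h (inr true))|exact: (h (inr false))]].
  - by move=> [s|[]] /=.
  - have dis X Y : X `&` Y = set0 -> Y `&` X = set0 :> set point_type by rewrite setIC.
    have datom s X : Q `&` X = set0 -> atom Q B s `&` X = set0.
      by rewrite -!subset0 => h z [[Qz _] Xz]; apply: (h z).
    move=> [s|[]] [s'|[]] //= ss'; rewrite /BB.
    + by apply: atom_disjoint; apply: contraNneq ss' => ->.
    + by apply: datom.
    + by apply: datom.
    + by apply: dis; apply: datom.
    + by apply: dis; apply: datom.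
    + by apply: dis.
  - by move=> [s|[]] /=.
pose G m : set T := if pickle_inv m is Some k then
  (if `[< Ek k `<=` E >] then Ek k else set0) else set0.
have mG m : measurable (G m) by rewrite /G; case: pickle_inv => [k|]//; case: ifPn.
have tG : trivIset setT G.
  move=> m m' _ _ [w []]; rewrite /G.
  case: (pickle_inv m) (@pickle_invK {ffun K -> option nat} m) => [k /= <-|_ []//].
  case: (pickle_inv m') (@pickle_invK {ffun K -> option nat} m') => [k' /= <-|_ _ []//].
  case: ifPn => _ // kw; case: ifPn => _ // k'w; congr (choice.pickle _).
  apply/ffunP => s; have := kw s; rewrite /= (k'w s).
  by case: (k s) (k' s) => [a|] [b|] //= => -[/eqP]; rewrite eqr_nat => /eqP->.
have EG : E = \bigcup_m G m.
  apply/seteqP; split => w; last first.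
    move=> [m _]; rewrite /G; case: pickle_inv => // k.
    by case: ifPn => // /asboolP; exact.
  move=> Ew.
  have val (s : K) : exists x, N w (atom Q B s) = ecard x.
    by have [->|[m ->]] := ppp_counting HN w (matom s); [exists None|exists (Some m)].
  have [g hg] := choice val; pose k := [ffun s => g s].
  have Ekw : Ek k w by move=> s /=; rewrite ffunE.
  exists (choice.pickle k) => //; rewrite /G pickleK_inv ifT//; apply/asboolP => w' Ekw'.
  move: Ew; rewrite EE /= => h i ii; rewrite (@count_atoms Q n B mQ mB w' w)//; first exact: h.
  by move=> s; rewrite (Ekw s) (Ekw' s).
rewrite {1}EG setI_bigcupl measure_semi_bigcup//; first last.
- by apply: bigcupT_measurable => m; apply: measurableI => //; exact: measurableI.
- by apply: trivIset_setIr.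
- by move=> m; apply: measurableI => //; exact: measurableI.
rewrite EG measure_semi_bigcup//; last exact: bigcupT_measurable.
have pE : (P F1 * P F2 = (fine (P F1 * P F2))%:E)%E.
  by rewrite fineK// fin_numM// fin_num_measure.
rewrite muleC pE -nneseriesZl// -pE.
apply: eq_eseriesr => m _; rewrite muleC /G; case: pickle_inv => [k|].
  by case: ifPn => _; [exact: PEkF|rewrite set0I measure0 mul0e].
by rewrite set0I measure0 mul0e.
Qed.

End PoissonIndependence.

Section PastIndependence.
Context d (T : measurableType d) (R : realType) (P : probability T R).
Variable N : R.-ker T ~> space_time_mark R.
Hypothesis HN : poisson_point_process P N.
Local Notation point_type := (space_time_mark R).

Lemma events_in_measurable Q : <<s events_in N Q >> `<=` measurable.
Proof.
apply: smallest_sub; first exact: sigma_algebra_measurable.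
by move=> _ [B [A [mB _ mA ->]]]; exact: measurable_count.
Qed.

(** For fixed [C], [D], both sides are finite measures in [E], equal on the pi-system of
    cylinders.  Two sets [C] and [D] are needed to follow a single point: it lies in [B]
    when the count of [C `&` B] is 1 and the count of [C `\` B] is 0. *)
Lemma past_independent (Q C D : set point_type) (A1 A2 : set (\bar R)) :
  measurable Q -> measurable C -> measurable D -> measurable A1 -> measurable A2 ->
  Q `&` C = set0 -> Q `&` D = set0 -> C `&` D = set0 ->
  forall E, <<s events_in N Q >> E ->
    P (E `&` ([set w | A1 (N w C)] `&` [set w | A2 (N w D)])) =
      (P E * (P [set w | A1 (N w C)] * P [set w | A2 (N w D)]))%E.
Proof.
move=> mQ mC mD mA1 mA2 QC QD CD E sE.
set F1 := [set w | A1 _]; set F2 := [set w | A2 _].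
have mF1 : measurable F1 by exact: measurable_count.
have mF2 : measurable F2 by exact: measurable_count.
have mF : measurable (F1 `&` F2) by exact: measurableI.
have pE : (P F1 * P F2 = (fine (P F1 * P F2))%:E)%E.
  by rewrite fineK// fin_numM// fin_num_measure.
have p0 : 0 <= fine (P F1 * P F2) by rewrite fine_ge0// mule_ge0.
pose p : {nonneg R} := NngNum p0.
have cT : cylinders N Q setT.
  exists 0%N, (fun=> set0), (fun=> setT); split => //.
  - by move=> i; split => //; exact: sub0set.
  - by apply/seteqP; split.
have := @g_sigma_algebra_measure_unique _ _ _ (cylinders N Q)
  (@measurable_cylinder _ _ _ N Q) (fun=> setT) (fun=> cT) (bigcup_const _ _)
  (mrestr P mF) (mscale p P) (@cylinders_setI _ _ _ N Q).
rewrite /mrestr/= /mscale/= -pE => unique; rewrite muleC; apply: unique.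
- by exists 0%N.
- by move=> A cA; rewrite muleC; exact: (cylinder_independent HN mQ).
- by move=> _; rewrite /mrestr setTI (le_lt_trans (probability_le1 _ _)) ?ltry.
apply: smallest_sub sE; first exact: smallest_sigma_algebra.
move=> _ [B [A [mB BQ mA ->]]]; apply: sub_sigma_algebra.
exists 1%N, (fun=> B), (fun=> A); split => //.
by apply/seteqP; split => w /=; [move=> h i _|move=> h; exact: (h 0%N isT)].
Qed.

Definition completed (G : set (set T)) : set (set T) := <<s G `|` P.-negligible >>.

(** The sets that differ by a null set from a member of [<<s G >>] form a sigma-algebra. *)
Lemma completed_ae (G : set (set T)) E : completed G E ->
  exists2 E', <<s G >> E' & P.-negligible ((E `\` E') `|` (E' `\` E)).
Proof.
move=> cE; pose H := [set E | exists2 E', <<s G >> E' &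
  P.-negligible ((E `\` E') `|` (E' `\` E))].
suff : H E by [].
have [s0 sC sU] := @smallest_sigma_algebra _ setT G.
apply: smallest_sub cE; [split|].
- by exists set0 => //; rewrite setDv setU0; exact: negligible_set0.
- move=> A [A' sA' nA']; exists (setT `\` A'); first exact: sC.
  apply: negligibleS nA' => w; rewrite !setTD => -[[/= h /contrapT h']|[/= h /contrapT h']].
    by right.
  by left.
- move=> A /(_ _)/cid2-/all_sig2[A' sA' nA']; exists (\bigcup_k A' k).
    by exact: sU.
  apply: negligibleS (negligible_bigcup nA') => w.
  move=> [[[k _ Ak] nA]|[[k _ Ak] nA]]; exists k => //; [left|right]; split => //.
    by move=> A'k; apply: nA; exists k.
  by move=> A'k; apply: nA; exists k.
move=> A [GA|nA].
  exists A; first exact: sub_sigma_algebra.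
  by rewrite setDv setU0; exact: negligible_set0.
by exists set0 => //; rewrite setD0 set0D setU0.
Qed.

(** Replace each set [[w | q < f w]] with [q] rational by a member of [<<s G >>], and
    let [g w] be the supremum of the [q] whose new set contains [w]. *)
Lemma completed_modification (G : set (set T)) (f : T -> R) :
  (forall a, completed G [set w | a < f w]) ->
  exists2 g : g_sigma_algebraType G -> R,
    measurable_fun [set: g_sigma_algebraType G] (g : _ -> measurableTypeR R) &
    {ae P, forall w, g w = f w}.
Proof.
move=> cf; have /all_sig2[E sE nE] (q : rat) := cid2 (completed_ae (cf (ratr q))).
pose u (k : nat) (w : g_sigma_algebraType G) : \bar R :=
  if choice.unpickle k is Some q then (if w \in E q then (ratr q)%:E else -oo%E) else -oo%E.
exists (fun w => fine (esups (u ^~ w) 0)).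
  apply: measurableT_comp => //.
  apply: measurable_fun_esups => k; rewrite /u; case: choice.unpickle => [q|//].
  apply: measurable_fun_if => //.
  apply: (@measurable_fun_bool _ _ _ _ true).
  rewrite setTI (_ : _ @^-1` _ = E q); first exact: sE.
  by apply/seteqP; split => w /=; [move/set_mem|move/mem_set].
pose Z := \bigcup_(k : nat) (if choice.unpickle k is Some q then
  ([set w | ratr q < f w] `\` E q) `|` (E q `\` [set w | ratr q < f w]) else set0).
have nZ : P.-negligible Z.
  apply: negligible_bigcup => k; case: choice.unpickle => [q|]; last exact: negligible_set0.
  exact: nE.
apply: negligibleS nZ => w /= nw; apply: contrapT => Zw; apply: nw.
have Eq q : (w \in E q) = (ratr q < f w).
  have nq : ~ (([set w | ratr q < f w] `\` E q) `|` (E q `\` [set w | ratr q < f w])) w.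
    by move=> h; apply: Zw; exists (choice.pickle q); rewrite ?choice.pickleK.
  apply/idP/idP => [/set_mem Ew|fw]; first by apply: contrapT => h; apply: nq; right.
  by apply/mem_set; apply: contrapT => h; apply: nq; left.
suff -> : esups (u ^~ w) 0 = (f w)%:E by [].
rewrite /esups; apply/eqP; rewrite eq_le; apply/andP; split.
  apply: ge_ereal_sup => _ [k _ <-]; rewrite /u; case: choice.unpickle => [q|]; last exact: leNye.
  by case: ifPn => // ; rewrite ?leNye// Eq lee_fin => /ltW.
rewrite leNgt; apply/negP => /= lt.
have sup q : ratr q < f w -> ((ratr q)%:E <= ereal_sup (sdrop (u ^~ w) 0))%E.
  move=> qf; apply: ereal_sup_ubound; exists (choice.pickle q) => //.
  by rewrite /u choice.pickleK Eq qf.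
case: (ereal_sup _) lt sup => [r| |] //.
- rewrite lte_fin => /rat_in_itvoo[q]; rewrite in_itv/= => /andP[rq qf] /(_ q qf).
  by rewrite lee_fin leNgt rq.
- have /rat_in_itvoo[q] : f w - 1 < f w by lra.
  by rewrite in_itv/= => /andP[_ qf] _ /(_ q qf).
Qed.

End PastIndependence.

(** * The potential of the gap *)

Section Derivatives.
Variable R : realType.
Implicit Types (f g : R -> R) (x a b : R).

Lemma is_derive1D f g x a b : is_derive x 1 f a -> is_derive x 1 g b ->
  is_derive x 1 (fun z => f z + g z) (a + b).
Proof. exact: is_deriveD. Qed.

Lemma is_derive1N f x a : is_derive x 1 f a -> is_derive x 1 (fun z => - f z) (- a).
Proof. exact: is_deriveN. Qed.

Lemma is_derive1M f g x a b : is_derive x 1 f a -> is_derive x 1 g b ->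
  is_derive x 1 (fun z => f z * g z) (f x * b + g x * a).
Proof. exact: is_deriveM. Qed.

Lemma is_derive1X f n x a : is_derive x 1 f a ->
  is_derive x 1 (fun z => f z ^+ n) (n%:R * f x ^+ n.-1 * a).
Proof.
move=> h; rewrite (_ : (fun z => _) = f ^+ n); first exact: is_deriveX.
by apply/funext => z; elim: n => [|n IH]; rewrite ?expr0// !exprS {}IH.
Qed.

Lemma is_derive1_cst x a : is_derive x 1 (fun=> a) 0.
Proof. exact: is_derive_cst. Qed.

Lemma is_derive1_id x : is_derive x 1 (fun z => z) 1.
Proof. exact: is_derive_id. Qed.

Lemma is_derive1_shift c x : is_derive x 1 (fun z => c + z) 1.
Proof.
rewrite -[X in is_derive _ _ _ X]add0r.
exact: (is_derive1D (is_derive1_cst x c) (is_derive1_id x)).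
Qed.

Lemma is_derive1_scale c x : is_derive x 1 (fun z => c * z) c.
Proof.
have := is_derive1M (is_derive1_cst x c) (is_derive1_id x).
by rewrite mulr1 mulr0 addr0.
Qed.

Lemma is_derive1_opp x : is_derive x 1 (fun z => - z) (- 1).
Proof. exact: (is_derive1N (is_derive1_id x)). Qed.

Lemma is_derive1_ln f x a : 0 < f x -> is_derive x 1 f a ->
  is_derive x 1 (fun z => ln (f z)) ((f x)^-1 * a).
Proof. by move=> fx h; exact: (is_derive1_comp (is_derive1_ln fx) h). Qed.

Lemma is_derive1_pow_ln f n x a : 0 < f x -> is_derive x 1 f a ->
  is_derive x 1 (fun z => f z ^+ n.+1 * ln (f z))
    (a * (n.+1%:R * f x ^+ n * ln (f x) + f x ^+ n)).
Proof.
move=> fx df; apply: is_derive_eq.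
  by apply: is_derive1M; [exact: is_derive1X|exact: is_derive1_ln].
rewrite /= [f x ^+ n.+1]exprSr -mulrA mulVKf ?gt_eqF//.
by move: (f x ^+ n) (ln (f x)) (n.+1%:R) => p l q; ring.
Qed.

End Derivatives.

Ltac derive1 := repeat lazymatch goal with
  | |- is_derive _ _ (fun z => z) _ => notypeclasses refine (is_derive1_id _)
  | |- is_derive _ _ (GRing.add _) _ => notypeclasses refine (is_derive1_shift _ _)
  | |- is_derive _ _ (GRing.mul _) _ => notypeclasses refine (is_derive1_scale _ _)
  | |- is_derive _ _ GRing.opp _ => notypeclasses refine (is_derive1_opp _)
  | |- is_derive _ _ (fun z => (@?f z) ^+ _ * ln (@?g z)) _ =>
      notypeclasses refine (is_derive1_pow_ln _ _ _)
  | |- is_derive _ _ (fun z => ln (@?f z)) _ => notypeclasses refine (is_derive1_ln _ _)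
  | |- is_derive _ _ (fun z => @?f z + @?g z) _ => notypeclasses refine (is_derive1D _ _)
  | |- is_derive _ _ (fun z => - @?f z) _ => notypeclasses refine (is_derive1N _)
  | |- is_derive _ _ (fun z => (@?f z) ^+ _) _ => notypeclasses refine (is_derive1X _ _)
  | |- is_derive _ _ (fun z => @?f z * @?g z) _ => notypeclasses refine (is_derive1M _ _)
  | |- is_derive _ _ (fun z => ?a) _ => notypeclasses refine (is_derive1_cst _ _)
  end.

Section Potential.
Variable R : realType.
Implicit Types x z : R.

(** The function [h] of the gap that makes the drift constant.  Differentiating the drift
    equation gives [(2 + z) h'(z) = h(z) - h(1 - z) - (1 - z)], a linear differential
    system for [h] and [z |-> h(1 - z)], of which this is a solution. *)
Definition gap_potential z : R :=
  2 / 25 * ((2 + z) * (8 - z) * ln (2 + z) + (3 - z) ^+ 2 * ln (3 - z)) - 3 / 5 * z.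

Definition gap_potential_primitive z : R :=
  2 / 25 * (5 * ((2 + z) ^+ 2 * ln (2 + z)) - 5 / 2 * (2 + z) ^+ 2
    - 1 / 3 * ((2 + z) ^+ 3 * ln (2 + z)) + 1 / 9 * (2 + z) ^+ 3
    - 1 / 3 * ((3 - z) ^+ 3 * ln (3 - z)) + 1 / 9 * (3 - z) ^+ 3) - 3 / 10 * z ^+ 2.

Lemma is_derive1_val (f : R -> R) z a : (exists b, is_derive z 1 f b /\ b = a) ->
  is_derive z 1 f a.
Proof. by move=> [b [h <-]]. Qed.

Lemma is_derive_primitive z : -2 < z -> z < 3 ->
  is_derive z 1 gap_potential_primitive (gap_potential z).
Proof.
move=> z2 z3; apply: is_derive1_val.
eexists; split; first (rewrite /gap_potential_primitive; derive1; lra).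
rewrite /gap_potential /=; move: (ln (2 + z)) (ln (3 - z)) => a b.
by field.
Qed.

Lemma gap_potential_derivable z : -2 < z -> z < 3 ->
  exists a, is_derive z 1 gap_potential a.
Proof. by move=> z2 z3; eexists; rewrite /gap_potential; derive1; lra. Qed.

Definition speed : R := (144 * ln 3 - 144 * ln 2 - 40) / 25.

(** The left-hand side is the drift of [X + gap_potential Z] at gap [z]: the integrals
    come from the new gaps, [- (2 + z) * gap_potential z] from the lost one, and the
    remaining terms from the displacement of [X]. *)
Lemma gap_potential_eq z :
  2 * (gap_potential_primitive z - gap_potential_primitive 0)
  + (gap_potential_primitive 1 - gap_potential_primitive 0)
  + (gap_potential_primitive (1 - z) - gap_potential_primitive 0)
  - (2 + z) * gap_potential z + 1 / 2 + (1 - z) ^+ 2 / 2 = speed.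
Proof.
rewrite /gap_potential_primitive /gap_potential /speed.
have -> : 2 + (1 - z) = 3 - z by lra.
have -> : 3 - (1 - z) = 2 + z by lra.
have -> : 2 + 0 = 2 :> R by lra.
have -> : 3 - 0 = 3 :> R by lra.
have -> : 2 + 1 = 3 :> R by lra.
have -> : 3 - 1 = 2 :> R by lra.
by field.
Qed.

(** The value at the fictitious gap 3 for which the drift at a lone particle,
    [2 \int_0^1 gap_potential - 2 lone_potential + 1/2], equals [speed] too. *)
Definition lone_potential : R :=
  gap_potential_primitive 1 - gap_potential_primitive 0 + 1 / 4 - speed / 2.

Definition potential z : R := if z <= 1 then gap_potential z else lone_potential.

Lemma potentialE z : z <= 1 -> potential z = gap_potential z.
Proof. by rewrite /potential => ->. Qed.

Lemma potential3 : potential 3 = lone_potential.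
Proof. by rewrite /potential ifF//; apply/negbTE; rewrite -ltNge; lra. Qed.

Lemma gap_potential_bound z : 0 <= z <= 1 -> `|gap_potential z| <= 6.
Proof.
move=> /andP[z0 z1].
have ln02 x : 1 <= x -> x <= 3 -> 0 <= ln x <= 2.
  move=> x1 x3; rewrite ln_ge0//=.
  have := @le_ln1Dx R (x - 1); rewrite (_ : 1 + (x - 1) = x); last by lra.
  by move=> h; have := h ltac:(lra); lra.
have [/andP[a0 a2] /andP[b0 b2]] : 0 <= ln (2 + z) <= 2 /\ 0 <= ln (3 - z) <= 2.
  by split; apply: ln02; lra.
rewrite /gap_potential; move: (ln (2 + z)) (ln (3 - z)) a0 a2 b0 b2 => a b a0 a2 b0 b2.
have c0 : 0 <= (2 + z) * (8 - z) <= 21 by nra.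
have d0 : 0 <= (3 - z) ^+ 2 <= 9 by rewrite expr2; nra.
move: ((2 + z) * (8 - z)) ((3 - z) ^+ 2) c0 d0 => c e /andP[c0 c1] /andP[e0 e1].
have ca : 0 <= c * a <= 42 by nra.
have eb : 0 <= e * b <= 18 by nra.
move: (c * a) (e * b) ca eb => x y /andP[x0 x1] /andP[y0 y1].
by rewrite ler_norml; apply/andP; split; lra.
Qed.

(** Apart from its value at a lone particle, the potential is at most 6 in absolute value,
    and a jump moves [X] by at most 1. *)
Definition jump_bound : R := 13 + `|lone_potential|.

Lemma measurable_potential :
  measurable_fun [set: measurableTypeR R] (potential : measurableTypeR R -> measurableTypeR R).
Proof.
apply: measurable_fun_if => //.
- exact: measurable_fun_ler.
- apply: measurable_funTS; rewrite /gap_potential.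
  have mln f : measurable_fun [set: measurableTypeR R] f ->
     measurable_fun [set: measurableTypeR R] (fun z : measurableTypeR R => ln (f z)).
    by move=> mf; apply: measurableT_comp mf; exact: measurable_ln.
  by repeat first [exact: measurable_cst | exact: measurable_id | apply: mln
    | apply: measurable_funB | apply: measurable_funD | apply: measurable_funX
    | apply: measurable_funM ].
Qed.

End Potential.

Section Pieces.
Variable R : realType.
Local Notation mu := (@lebesgue_measure R).
Implicit Types (a b c : R) (f : measurableTypeR R -> \bar R).

(** Bounding by an antiderivative replaces the computation of the integral; the values at
    the end points of the piece, where the rate jumps, do not matter. *)
Lemma integral_piece_le a b f (p F : R -> R) : a <= b ->
  measurable_fun [set: measurableTypeR R] f ->
  (forall x, a < x < b -> (0 <= f x <= (p x)%:E)%E) ->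
  (forall x, a <= x <= b -> is_derive x 1 F (p x)) ->
  (forall x, a <= x <= b -> exists p', is_derive x 1 p p') ->
  (\int[mu]_(x in `]a, b]) f x <= (F b - F a)%:E)%E.
Proof.
rewrite le_eqVlt => /orP[/eqP->|ab] mf fp dF dp.
  by rewrite set_itvoc0 integral_set0 subrr.
have cp x : a <= x <= b -> {for x, continuous p}.
  move=> /dp[p' dp']; apply: differentiable_continuous.
  by apply/derivable1_diffP; exact: ex_derive.
have cF x : a <= x <= b -> {for x, continuous F}.
  move=> /dF dF'; apply: differentiable_continuous.
  by apply/derivable1_diffP; exact: ex_derive.
have cpw : {within `[a, b], continuous p}.
  apply: continuous_in_subspaceT => x; rewrite inE/= in_itv/=; exact: cp.
have mp : measurable_fun `[a, b] (p : measurableTypeR R -> measurableTypeR R).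
  by apply: subspace_continuous_measurable_fun.
have sub : `]a, b[ `<=` (`[a, b]%classic : set R).
  by move=> x /=; rewrite !in_itv/= => /andP[/ltW-> /ltW->].
have <- : (\int[mu]_(x in `[a, b]) (p x)%:E = (F b - F a)%:E)%E.
  rewrite (continuous_FTC2 ab cpw (F := F))//.
    split.
    - by move=> x; rewrite in_itv/= => /andP[ax xb]; apply: ex_derive; apply: dF; rewrite !ltW.
    - by apply: cvg_at_right_filter; apply: cF; rewrite lexx ltW.
    - by apply: cvg_at_left_filter; apply: cF; rewrite lexx ltW.
  move=> x; rewrite in_itv/= => /andP[ax xb]; rewrite derive1E.
  have h : is_derive x 1 F (p x) by apply: dF; rewrite !ltW.
  by rewrite derive_val.
rewrite integral_itv_bndoo; last exact: measurable_funTS.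
rewrite [leRHS]integral_itv_bndoo; last first.
  by apply/measurable_EFinP; apply: measurable_funS mp.
apply: ge0_le_integral => //.
- by move=> x /=; rewrite in_itv/= => /fp/andP[].
- exact: measurable_funTS.
- by apply/measurable_EFinP; apply: measurable_funS mp.
- by move=> x /=; rewrite in_itv/= => /fp/andP[].
Qed.

Lemma integral_split a c b f : a <= c -> c <= b ->
  measurable_fun [set: measurableTypeR R] f -> (forall x, 0 <= f x)%E ->
  (\int[mu]_(x in `]a, b]) f x =
    \int[mu]_(x in `]a, c]) f x + \int[mu]_(x in `]c, b]) f x)%E.
Proof.
move=> ac cb mf f0; rewrite -ge0_integral_setU//.
- by rewrite -itv_bndbnd_setU// bnd_simp.
- exact: measurable_funTS.
- apply/disj_setPS => x [/=]; rewrite !in_itv/= => /andP[_ xc] /andP[cx _].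
  by have := lt_le_trans cx xc; rewrite ltxx.
Qed.

End Pieces.

(** * The drift of the potential *)

Section OneStep.
Variable R : realType.
Local Notation mu := (@lebesgue_measure R).
Local Notation Hp := (@gap_potential_primitive R).
Local Notation gp := (@gap_potential R).
Implicit Types (S : R * R) (K x u : R).

(** Its drift is [speed] whenever the gap is 3 or lies in [0, 1]; see [generator_bound]. *)
Definition front_value S : R := S.1 + potential S.2.

Definition jump S x : R :=
  if S.1 < x then (x - S.1) + potential (x - S.1) - potential S.2
  else if (S.1 - S.2 < x) && (S.1 - 1 <= x) then potential (S.1 - x) - potential S.2
  else 0.

Lemma front_value_step S x u : front_value (front_step S x u) =
  front_value S + (if u <= birth_rate S.2 (x - S.1) then jump S x else 0).
Proof.
rewrite /front_value /front_step /jump; case: ifPn => _; last by rewrite addr0.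
case: ifPn => _ /=; first by lra.
by case: ifPn => _ /=; lra.
Qed.

Section Measurability.
Context d (T : measurableType d).
Implicit Types f g : T -> measurableTypeR R.
Local Notation mfun f := (measurable_fun [set: T] f).

Lemma measurable_potential_comp f : mfun f ->
  mfun (fun w => potential (f w) : measurableTypeR R).
Proof. by move=> mf; apply: measurableT_comp mf; exact: measurable_potential. Qed.

Lemma measurable_near1 f : mfun f ->
  mfun (fun w => (`|f w| <= 1)%R%:R : measurableTypeR R).
Proof.
move=> mf; rewrite (_ : (fun w => _) = (fun w => if `|f w| <= 1 then 1 else 0)).
  apply: measurable_fun_if => //; apply: measurable_fun_ler => //.
  exact: measurableT_comp.
by apply/funext => w; case: (_ <= _).
Qed.

Lemma measurable_birth_rate f g : mfun f -> mfun g ->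
  mfun (fun w => birth_rate (f w) (g w) : measurableTypeR R).
Proof.
move=> mf mg; apply: measurable_funD; apply: measurable_near1 => //.
exact: measurable_funD.
Qed.

Lemma measurable_jump (X Z x : T -> measurableTypeR R) : mfun X -> mfun Z -> mfun x ->
  mfun (fun w => jump (X w, Z w) (x w) : measurableTypeR R).
Proof.
move=> mX mZ mx; have mxX := measurable_funB mx mX; have mXx := measurable_funB mX mx.
have mpZ := measurable_potential_comp mZ.
apply: measurable_fun_if => //; first exact: measurable_fun_ltr.
  apply: measurable_funTS; apply: measurable_funB => //.
  by apply: measurable_funD => //; exact: measurable_potential_comp.
apply: measurable_funTS; apply: measurable_fun_if => //.
  by apply: measurable_and; [apply: measurable_fun_ltr|apply: measurable_fun_ler] => //;
    exact: measurable_funB.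
by apply: measurable_funTS; apply: measurable_funB => //; exact: measurable_potential_comp.
Qed.

Lemma measurable_front_value (X Z : T -> measurableTypeR R) : mfun X -> mfun Z ->
  mfun (fun w => front_value (X w, Z w) : measurableTypeR R).
Proof. by move=> mX mZ; apply: measurable_funD => //; exact: measurable_potential_comp. Qed.

End Measurability.

Lemma birth_rate_itv (Z y : R) : 0 <= birth_rate Z y <= 2.
Proof. by rewrite /birth_rate; case: (`|y| <= 1); case: (`|y + Z| <= 1) => /=; lra. Qed.

Lemma integral_two_level (b A B : R) : 0 <= b <= 2 -> 0 <= A -> 0 <= B ->
  (\int[mu]_(u in `[0%R, 2%R]) (if u <= b then A else B)%:E =
    (b * A + (2 - b) * B)%:E)%E.
Proof.
move=> /andP[b0 b2] A0 B0.
have mf : measurable_fun [set: measurableTypeR R]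
    (fun u : measurableTypeR R => (if u <= b then A else B)%:E).
  by apply/measurable_EFinP; apply: measurable_fun_if => //; exact: measurable_fun_ler.
rewrite (_ : `[0, 2]%classic = `[0, b]%classic `|` `]b, 2]%classic); last first.
  by rewrite -itv_bndbnd_setU// bnd_simp.
rewrite ge0_integral_setU//=; first last.
- apply/disj_setPS => u [/=]; rewrite !in_itv/= => /andP[_ ub] /andP[bu _].
  by have := lt_le_trans bu ub; rewrite ltxx.
- by move=> u _; case: ifPn; rewrite lee_fin.
- exact: measurable_funTS.
rewrite (eq_integral (cst A%:E)); last first.
  by move=> u /set_mem/=; rewrite in_itv/= => /andP[_ ->].
rewrite [X in (_ + X)%E](eq_integral (cst B%:E)); last first.
  by move=> u /set_mem/=; rewrite in_itv/= => /andP[bu _]; rewrite leNgt bu.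
rewrite !integral_cst//= !lebesgue_measure_itv/= !lte_fin.
have -> : (if (b < 2)%R then (2 - b)%:E else 0%E) = (2 - b)%:E.
  by case: ltP => // h; congr (_%:E); lra.
have -> : (if (0 < b)%R then (b - 0)%:E else 0%E) = b%:E.
  by case: ltP => [|h]; rewrite ?subr0//; congr (_%:E); lra.
by rewrite -!EFinM -EFinD; congr (_%:E); ring.
Qed.

(** The integral over the mark [u] in [0, 2] of the squared value of [K] after a possible
    jump at [x]. *)
Definition mark_average K S x : R :=
  birth_rate S.2 (x - S.1) * (K + jump S x) ^+ 2
  + (2 - birth_rate S.2 (x - S.1)) * K ^+ 2.

Lemma mark_averageE K S x :
  (\int[mu]_(u in `[0%R, 2%R])
     ((K + (if u <= birth_rate S.2 (x - S.1) then jump S x else 0)) ^+ 2)%:E =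
   (mark_average K S x)%:E)%E.
Proof.
rewrite -integral_two_level ?birth_rate_itv ?sqr_ge0//.
by apply: eq_integral => u _; case: ifPn; rewrite ?addr0.
Qed.

Lemma mark_average_ge0 K S x : 0 <= mark_average K S x.
Proof.
have /andP[b0 b2] := birth_rate_itv S.2 (x - S.1).
by rewrite addr_ge0// mulr_ge0 ?sqr_ge0//; lra.
Qed.

Lemma measurable_mark_average K S :
  measurable_fun [set: measurableTypeR R]
    (mark_average K S : measurableTypeR R -> measurableTypeR R).
Proof.
have mc a : measurable_fun [set: measurableTypeR R] (fun=> a : measurableTypeR R).
  exact: measurable_cst.
have mrate : measurable_fun [set: measurableTypeR R]
    (fun x : measurableTypeR R => birth_rate S.2 (x - S.1) : measurableTypeR R).
  by apply: measurable_birth_rate => //; apply: measurable_funB.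
have mjump : measurable_fun [set: measurableTypeR R]
    (jump S : measurableTypeR R -> measurableTypeR R).
  rewrite (surjective_pairing S).
  exact: (measurable_jump (mc S.1) (mc S.2) (@measurable_id _ _ _)).
apply: measurable_funD; apply: measurable_funM => //.
  by apply: measurable_funX; exact: measurable_funD.
exact: measurable_funB.
Qed.

Local Notation D := (jump_bound R).

Lemma mark_average_le K S x J : `|J| <= D ->
  jump S x = J ->
  mark_average K S x <=
    2 * K ^+ 2 + birth_rate S.2 (x - S.1) * (2 * K * J + D ^+ 2).
Proof.
move=> JD jE; rewrite /mark_average jE; set b := birth_rate _ _.
have /andP[b0 b2] : 0 <= b <= 2 := birth_rate_itv _ _.
have : J ^+ 2 <= D ^+ 2 by rewrite -(real_normK (num_real J)) lerXn2r ?nnegrE//; exact: le_trans JD.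
rewrite !expr2 => h; have : b * (J * J) <= b * (D * D) by rewrite ler_wpM2l.
nra.
Qed.

End OneStep.

Section Generator.
Variable R : realType.
Local Notation mu := (@lebesgue_measure R).
Local Notation Hp := (@gap_potential_primitive R).
Local Notation gp := (@gap_potential R).
Local Notation D := (jump_bound R).
Local Notation c := (lone_potential R).
Implicit Types (S : R * R) (K x u : R).

Lemma is_derive1_translate (X x : R) : is_derive x 1 (fun x => x - X) 1.
Proof.
rewrite -[X in is_derive _ _ _ X]addr0.
exact: is_derive1D (is_derive1_id _) (is_derive1_cst _ _).
Qed.

Lemma is_derive1_reflect (X x : R) : is_derive x 1 (fun x => X - x) (- 1).
Proof.
rewrite -[X in is_derive _ _ _ X]add0r.
exact: is_derive1D (is_derive1_cst _ _) (is_derive1_opp _).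
Qed.

Lemma is_derive_right (p q X x : R) : -2 < x - X -> x - X < 3 ->
  is_derive x 1 (fun x => p * x + q * ((x - X) ^+ 2 / 2 + Hp (x - X)))
    (p + q * (x - X + gp (x - X))).
Proof.
move=> h1 h2; have dH := is_derive_primitive h1 h2.
have dx := is_derive1_translate X x.
have dH' : is_derive x 1 (fun x => Hp (x - X)) (gp (x - X)).
  by have := @is_derive1_comp _ Hp (fun x => x - X) x _ _ dH dx; rewrite mulr1.
apply: is_derive1_val; eexists; split.
  notypeclasses refine (is_derive1D (is_derive1_scale _ _) _).
  notypeclasses refine (is_derive1M (is_derive1_cst _ _) _).
  notypeclasses refine (is_derive1D _ dH').
  exact: (is_derive1M (is_derive1X 2 dx) (is_derive1_cst _ _)).
by rewrite /=; field.
Qed.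

Lemma is_derive_left (p q X x : R) : -2 < X - x -> X - x < 3 ->
  is_derive x 1 (fun x => p * x - q * Hp (X - x)) (p + q * gp (X - x)).
Proof.
move=> h1 h2; have dH := is_derive_primitive h1 h2.
have dx := is_derive1_reflect X x.
have dH' := @is_derive1_comp _ Hp (fun x => X - x) x _ _ dH dx.
apply: is_derive1_val; eexists; split.
  notypeclasses refine (is_derive1D (is_derive1_scale _ _) (is_derive1N _)).
  exact: (is_derive1M (is_derive1_cst _ _) dH').
by rewrite /=; ring.
Qed.

Lemma derivable_right (p q X x : R) : -2 < x - X -> x - X < 3 ->
  exists a, is_derive x 1 (fun x => p + q * (x - X + gp (x - X))) a.
Proof.
move=> h1 h2; have [a da] := gap_potential_derivable h1 h2.
have dx := is_derive1_translate X x.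
have da' := @is_derive1_comp _ gp (fun x => x - X) x _ _ da dx.
eexists; notypeclasses refine (is_derive1D (is_derive1_cst _ _) _).
exact: (is_derive1M (is_derive1_cst _ _) (is_derive1D dx da')).
Qed.

Lemma derivable_left (p q X x : R) : -2 < X - x -> X - x < 3 ->
  exists a, is_derive x 1 (fun x => p + q * gp (X - x)) a.
Proof.
move=> h1 h2; have [a da] := gap_potential_derivable h1 h2.
have dx := is_derive1_reflect X x.
have da' := @is_derive1_comp _ gp (fun x => X - x) x _ _ da dx.
eexists; notypeclasses refine (is_derive1D (is_derive1_cst _ _) _).
exact: (is_derive1M (is_derive1_cst _ _) da').
Qed.

Let f K S : measurableTypeR R -> \bar R := fun x => (mark_average K S x)%:E.

Let mf K S : measurable_fun [set: measurableTypeR R] (f K S).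
Proof. by apply/measurable_EFinP; exact: measurable_mark_average. Qed.

Let f0 K S x : (0 <= f K S x)%E.
Proof. by rewrite lee_fin mark_average_ge0. Qed.

Lemma piece_idle K S (a b : R) : a <= b ->
  (forall x, a < x < b -> jump S x = 0 \/ birth_rate S.2 (x - S.1) = 0) ->
  (\int[mu]_(x in `]a, b]) (mark_average K S x)%:E <= (2 * K ^+ 2 * (b - a))%:E)%E.
Proof.
move=> ab h; have -> : 2 * K ^+ 2 * (b - a) = 2 * K ^+ 2 * b - 2 * K ^+ 2 * a by ring.
refine (@integral_piece_le _ a b (f K S) (fun=> 2 * K ^+ 2)
  (fun x => 2 * K ^+ 2 * x) ab (mf K S) _ _ _).
- move=> x /h h'; rewrite f0 /f lee_fin /mark_average.
  by case: h' => ->; rewrite le_eqVlt; apply/orP; left; apply/eqP; ring.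
- by move=> x _; exact: is_derive1_scale.
- by move=> x _; exists 0; exact: is_derive1_cst.
Qed.

Lemma piece_left K S (a b r : R) : a <= b -> S.1 - 1 <= a -> b <= S.1 ->
  (forall x, a < x < b -> birth_rate S.2 (x - S.1) = r) ->
  (S.1 - S.2 <= a) -> `|potential S.2| <= 6 + `|c| ->
  (\int[mu]_(x in `]a, b]) (mark_average K S x)%:E <=
    ((2 * K ^+ 2 + r * (D ^+ 2 - 2 * K * potential S.2)) * (b - a)
     + 2 * K * r * (Hp (S.1 - a) - Hp (S.1 - b)))%:E)%E.
Proof.
move=> ab Xa bX hr Za hS; set p := (2 * K ^+ 2 + _).
have -> : p * (b - a) + 2 * K * r * (Hp (S.1 - a) - Hp (S.1 - b)) =
  (p * b - (2 * K * r) * Hp (S.1 - b)) - (p * a - (2 * K * r) * Hp (S.1 - a)) by ring.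
refine (@integral_piece_le _ a b (f K S)
  (fun x => p + 2 * K * r * gp (S.1 - x))
  (fun x => p * x - (2 * K * r) * Hp (S.1 - x)) ab (mf K S) _ _ _).
- move=> x axb; rewrite f0 /f lee_fin/=; have /andP[ax xb] := axb.
  have jx : jump S x = gp (S.1 - x) - potential S.2.
    rewrite /jump ifF; last by apply/negbTE; rewrite -leNgt; lra.
    by rewrite ifT; [rewrite potentialE//; lra|apply/andP; split; lra].
  have gb : `|gp (S.1 - x)| <= 6 by apply: gap_potential_bound; lra.
  apply: le_trans (mark_average_le K _ jx) _.
    by rewrite (le_trans (ler_normB _ _))// /jump_bound; lra.
  by rewrite (hr _ axb) /p le_eqVlt; apply/orP; left; apply/eqP; ring.
- by move=> x xab; apply: is_derive_left; lra.
- by move=> x xab; apply: derivable_left; lra.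
Qed.

Lemma piece_right K S (a b r : R) : a <= b -> S.1 <= a -> b <= S.1 + 1 ->
  (forall x, a < x < b -> birth_rate S.2 (x - S.1) = r) ->
  `|potential S.2| <= 6 + `|c| ->
  (\int[mu]_(x in `]a, b]) (mark_average K S x)%:E <=
    ((2 * K ^+ 2 + r * (D ^+ 2 - 2 * K * potential S.2)) * (b - a)
     + 2 * K * r * ((b - S.1) ^+ 2 / 2 + Hp (b - S.1)
       - (a - S.1) ^+ 2 / 2 - Hp (a - S.1)))%:E)%E.
Proof.
move=> ab Xa bX hr hS; set p := (2 * K ^+ 2 + _).
rewrite [X in (X%:E)%E](_ : _ =
  (p * b + (2 * K * r) * ((b - S.1) ^+ 2 / 2 + Hp (b - S.1))) -
  (p * a + (2 * K * r) * ((a - S.1) ^+ 2 / 2 + Hp (a - S.1)))); last by ring.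
refine (@integral_piece_le _ a b (f K S)
  (fun x => p + 2 * K * r * (x - S.1 + gp (x - S.1)))
  (fun x => p * x + (2 * K * r) * ((x - S.1) ^+ 2 / 2 + Hp (x - S.1)))
  ab (mf K S) _ _ _).
- move=> x axb; rewrite f0 /f lee_fin/=; have /andP[ax xb] := axb.
  have jx : jump S x = x - S.1 + gp (x - S.1) - potential S.2.
    by rewrite /jump ifT; [rewrite potentialE//; lra|lra].
  have gb : `|gp (x - S.1)| <= 6 by apply: gap_potential_bound; lra.
  apply: le_trans (mark_average_le K _ jx) _.
    have x1 : `|x - S.1| <= 1 by rewrite ler_norml; lra.
    by rewrite (le_trans (ler_normB _ _))// (le_trans (lerD (ler_normD _ _) (lexx _)))// /jump_bound; lra.
  by rewrite (hr _ axb) /p le_eqVlt; apply/orP; left; apply/eqP; ring.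
- by move=> x xab; apply: is_derive_right; lra.
- by move=> x xab; apply: derivable_right; lra.
Qed.

Lemma birth_rateE (Z y r1 r2 : R) : (`|y| <= 1)%R%:R = r1 -> (`|y + Z| <= 1)%R%:R = r2 ->
  birth_rate Z y = r1 + r2.
Proof. by rewrite /birth_rate => -> ->. Qed.

Lemma near1 (y : R) : -1 <= y <= 1 -> (`|y| <= 1)%R%:R = 1 :> R.
Proof. by move=> h; rewrite ler_norml h. Qed.

Lemma far1 (y : R) : 1 < y \/ y < -1 -> (`|y| <= 1)%R%:R = 0 :> R.
Proof. by move=> h; rewrite (_ : (_ <= _) = false)// ler_norml; apply/negbTE/negP; lra. Qed.

(** The window splits at the points [X - Z], [X], [X + 1 - Z] and [X + 1], where the rate
    changes, or at [X - 1], [X] and [X + 1] for a lone particle.  The cross terms add up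
    to [2 * K] times the drift, that is [speed], by [gap_potential_eq]; the constant 3
    bounds the total rate of births that move the front, and 10 is the length of the
    window times that of the range of marks. *)
Lemma generator_bound K S (j : R) : 0 <= S.2 <= 1 \/ S.2 = 3 ->
  j <= S.1 < j + 1 ->
  (\int[mu]_(x in `](j - 2)%R, (j + 3)%R]) (mark_average K S x)%:E <=
    (10 * K ^+ 2 + 2 * K * speed R + 3 * D ^+ 2)%:E)%E.
Proof.
move=> gap /andP[jX Xj]; have c0 : 0 <= `|c| by [].
case: gap => [/andP[Z0 Z1]|Z3].
  have hS : `|potential S.2| <= 6 + `|c|.
    by rewrite potentialE// (le_trans (gap_potential_bound _)); lra.
  have hA : S.1 - S.2 <= S.1 by lra.
  rewrite (@integral_split _ _ (S.1 - S.2) _ (f K S))//; [|lra|lra].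
  rewrite (@integral_split _ (S.1 - S.2) S.1 _ (f K S))//; [|lra].
  rewrite (@integral_split _ S.1 (S.1 + 1 - S.2) _ (f K S))//; [|lra|lra].
  rewrite (@integral_split _ (S.1 + 1 - S.2) (S.1 + 1) _ (f K S))//; [|lra|lra].
  have h1 := @piece_idle K S (j - 2) (S.1 - S.2) ltac:(lra).
  have h2 := @piece_left K S (S.1 - S.2) S.1 2 ltac:(lra) ltac:(lra) ltac:(lra).
  have h3 := @piece_right K S S.1 (S.1 + 1 - S.2) 2 ltac:(lra) ltac:(lra) ltac:(lra).
  have h4 := @piece_right K S (S.1 + 1 - S.2) (S.1 + 1) 1 ltac:(lra) ltac:(lra) ltac:(lra).
  have h5 := @piece_idle K S (S.1 + 1) (j + 3) ltac:(lra).
  apply: le_trans (leeD (h1 _) (leeD (h2 _ _ hS) (leeD (h3 _ hS) (leeD (h4 _ hS) (h5 _))))) _.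
  - move=> x xs; clear -xs Z0 Z1; left; rewrite /jump ifF; last by apply/negbTE; rewrite -leNgt; lra.
    by rewrite ifF//; apply/negbTE; rewrite negb_and -!leNgt; apply/orP; left; lra.
  - by move=> x xs; clear -xs Z0 Z1; rewrite (birth_rateE (near1 _) (near1 _)); lra.
  - lra.
  - by move=> x xs; clear -xs Z0 Z1; rewrite (birth_rateE (near1 _) (near1 _)); lra.
  - by move=> x xs; clear -xs Z0 Z1; rewrite (birth_rateE (near1 _) (far1 _)); lra.
  - by move=> x xs; clear -xs Z0 Z1; right; rewrite (birth_rateE (far1 _) (far1 _)); lra.
  rewrite -!EFinD lee_fin potentialE//.
  rewrite subrr (_ : S.1 - (S.1 - S.2) = S.2); last by ring.
  rewrite (_ : S.1 + 1 - S.2 - S.1 = 1 - S.2); last by ring.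
  rewrite (_ : S.1 + 1 - S.1 = 1); last by ring.
  have := gap_potential_eq S.2.
  have : 0 <= (1 - S.2) * D ^+ 2 by rewrite mulr_ge0 ?sqr_ge0//; lra.
  move: (Hp _) (Hp _) (Hp _) (Hp _) (gp _) (speed R) (D ^+ 2) => H1 H2 H3 H4 g v D2 hD <-.
  rewrite -subr_ge0 [X in 0 <= X](_ : _ = (1 - S.2) * D2)//.
  by field.
have hS : `|potential S.2| <= 6 + `|c| by rewrite Z3 potential3; lra.
rewrite (@integral_split _ _ (S.1 - 1) _ (f K S))//; [|lra|lra].
rewrite (@integral_split _ (S.1 - 1) S.1 _ (f K S))//; [|lra|lra].
rewrite (@integral_split _ S.1 (S.1 + 1) _ (f K S))//; [|lra|lra].
have h1 := @piece_idle K S (j - 2) (S.1 - 1) ltac:(lra).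
have h2 := @piece_left K S (S.1 - 1) S.1 1 ltac:(lra) ltac:(lra) ltac:(lra).
have h3 := @piece_right K S S.1 (S.1 + 1) 1 ltac:(lra) ltac:(lra) ltac:(lra).
have h4 := @piece_idle K S (S.1 + 1) (j + 3) ltac:(lra).
apply: le_trans (leeD (h1 _) (leeD (h2 _ _ hS) (leeD (h3 _ hS) (h4 _)))) _.
- move=> x xs; clear -xs Z3; left; rewrite /jump ifF; last by apply/negbTE; rewrite -leNgt; lra.
  by rewrite ifF//; apply/negbTE; rewrite negb_and -!leNgt -ltNge; apply/orP; right; lra.
- by move=> x xs; clear -xs Z3; rewrite (birth_rateE (near1 _) (far1 _)); lra.
- lra.
- by move=> x xs; clear -xs Z3; rewrite (birth_rateE (near1 _) (far1 _)); lra.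
- by move=> x xs; clear -xs Z3; right; rewrite (birth_rateE (far1 _) (far1 _)); lra.
rewrite -!EFinD lee_fin Z3 potential3.
rewrite subrr (_ : S.1 - (S.1 - 1) = 1); last by ring.
rewrite (_ : S.1 + 1 - S.1 = 1); last by ring.
rewrite /lone_potential.
have : 0 <= D ^+ 2 by rewrite sqr_ge0.
move: (Hp _) (Hp _) (speed R) (D ^+ 2) => H1 H2 v D2 hD.
rewrite -subr_ge0 [X in 0 <= X](_ : _ = D2)//.
by field.
Qed.

End Generator.

(** * The location of a single Poisson point *)

Section FiniteCopy.
Context d (T : measurableType d) (R : realType) (m : {measure set T -> \bar R}).
Hypothesis mT : (m setT < +oo)%E.

(** A name that can carry the finiteness of a measure as a canonical structure. *)
Definition finite_copy of (m setT < +oo)%E : set T -> \bar R := m.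

HB.instance Definition _ := Measure.on (finite_copy mT).

Let finite_copy_fin : fin_num_fun (finite_copy mT).
Proof.
move=> A mA; rewrite ge0_fin_numE ?measure_ge0//.
by apply: le_lt_trans mT; apply: le_measure; rewrite ?inE.
Qed.

HB.instance Definition _ := Measure_isFinite.Build d T R (finite_copy mT) finite_copy_fin.

End FiniteCopy.

Definition image_measure d d' (T1 : measurableType d) (T2 : measurableType d')
    (R : realType) (m : {measure set T1 -> \bar R}) (f : T1 -> T2)
    (mf : measurable_fun [set: T1] f) : {measure set T2 -> \bar R} :=
  measure_function_pushforward__canonical__measure_function_Measure m mf.

Section RestrictedIntegral.
Context d (T : measurableType d) (R : realType) (m : {measure set T -> \bar R}).

Lemma integral_mrestr (D : set T) (mD : measurable D) (f : T -> \bar R) :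
  measurable_fun setT f -> (forall x, 0 <= f x)%E ->
  (\int[mrestr m mD]_x f x = \int[m]_(x in D) f x)%E.
Proof.
move=> mf f0; have mC := measurableC mD.
pose g := f \_ D; have g0 x : (0 <= g x)%E by rewrite /g /patch; case: ifPn.
have mg : measurable_fun setT g.
  by apply/measurable_restrict => //; rewrite setTI; exact: measurable_funTS.
rewrite integral_mkcond -/g.
have -> : (\int[m]_x g x = \int[measure_add (mrestr m mD) (mrestr m mC)]_x g x)%E.
  apply: eq_measure_integral => A mA _.
  transitivity (mrestr m mD A + mrestr m mC A)%E; last by rewrite -measure_addE.
  rewrite /mrestr.
  rewrite -measureU; [|exact: measurableI|exact: measurableI|].
    by rewrite -setIUr setUCr setIT.
  by rewrite setIACA setICr setI0.
rewrite ge0_integral_measure_add//.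
have -> : (\int[mrestr m mC]_x g x = 0)%E.
  rewrite (@ge0_ae_eq_integral _ _ _ _ _ g (cst 0%E))// ?integral0//.
  exists D; split => //; first by rewrite /= /mrestr setICr measure0.
  move=> x /= h; apply: contrapT => Dx; apply: h => _.
  by rewrite /g /patch memNset.
rewrite adde0; apply: ge0_ae_eq_integral => //.
exists (~` D); split => //; first by rewrite /= /mrestr setICl measure0.
by move=> x /= h Dx; apply: h => _; rewrite /g /patch mem_set.
Qed.

End RestrictedIntegral.

Section Freeze.
Context d (T : measurableType d) (R : realType) (P : probability T R).
Variable N : R.-ker T ~> space_time_mark R.
Hypothesis HN : poisson_point_process P N.
Local Notation point_type := (space_time_mark R).
Local Notation mu := (@lebesgue_measure R).
Variable mu3 : {measure set point_type -> \bar R}.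
Hypothesis mean_mu3 : forall B, @mean_measure R B = mu3 (B `&` @state_space R).

Definition single_point (C : set point_type) (w : T) : point_type :=
  xget ((0, 0, 0) : point_type) [set z | C z /\ forall B, measurable B ->
    N w (C `&` B) = (\1_B z)%:E].

Lemma single_pointP (C : set point_type) w : measurable C -> N w C = 1%E ->
  C (single_point C w) /\ forall B, measurable B ->
    N w (C `&` B) = (\1_B (single_point C w))%:E.
Proof.
move=> mC NC; have [z Cz hz] := unit_mass_dirac (fun B => ppp_counting HN w (B := B)) mC NC.
exact: (@xgetPex _ (0, 0, 0) [set z | C z /\ forall B, measurable B ->
    N w (C `&` B) = (\1_B z)%:E] (ex_intro _ z (conj Cz hz))).
Qed.

(** Setting the point to 0 when it is not unique makes it a measurable function. *)
Definition located_point (C : set point_type) (w : T) : point_type :=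
  if N w C == 1%E then single_point C w else (0, 0, 0).

Lemma measurable_located_point (C : set point_type) : measurable C ->
  measurable_fun [set: T] (located_point C).
Proof.
move=> mC _ B mB; rewrite setTI.
have m1 : measurable [set w | [set 1%E] (N w C)].
  exact: measurable_count_eq.
rewrite (_ : _ @^-1` _ =
  ([set w | [set 1%E] (N w C)] `&` [set w | [set 1%E] (N w (C `&` B))])
  `|` (~` [set w | [set 1%E] (N w C)] `&` (if (0, 0, 0) \in B then setT else set0))).
  apply: measurableU; apply: measurableI => //.
  - by apply: measurable_count; [exact: measurableI|exact: emeasurable_set1].
  - exact: measurableC.
  - by case: ifPn.
apply/seteqP; split => w /=; rewrite /located_point.
  case: eqP => NC hB.
    left; split => //; have [_ ->//] := single_pointP mC NC.
    by rewrite indicE mem_set.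
  by right; split => //; rewrite mem_set.
case: eqP => NC [[h1 h2]|[h1 h2]] //.
  have [_ hz] := single_pointP mC NC; move: h2; rewrite hz// indicE.
  have [/set_mem//|_] := boolP (single_point C w \in B).
  by move=> /eqP; rewrite eqe eq_sym oner_eq0.
by move: h2; case: ifPn => // /set_mem.
Qed.

Lemma finite_mrestr (C : set point_type) (mC : measurable C) (l : R) : mu3 C = l%:E ->
  (mrestr mu3 mC setT < +oo)%E.
Proof. by move=> h; rewrite /mrestr setTI h ltry. Qed.

(** On the event that [C] contains exactly one point, the event that this point lies in
    [B] says that the count of [C `&` B] is 1 and the count of [C `\` B] is 0.  It is
    independent of the past, with probability [expR (- l)] times the measure of [C `&` B].
    So the joint law of the past state and of the point is a product measure, and Fubini's
    theorem applies.  The mean measure is kept abstract, as only its values matter. *)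
Lemma freeze_point d' (U : measurableType d') (Q C E : set _) (S : T -> U) (l : R)
    (G : U * point_type -> \bar R) :
  measurable Q -> measurable C -> Q `&` C = set0 -> C `<=` @state_space R ->
  mu3 C = l%:E -> <<s events_in N Q >> E ->
  (forall A, measurable A -> <<s events_in N Q >> (S @^-1` A)) ->
  measurable_fun setT G -> (forall x, 0 <= G x)%E ->
  (\int[P]_(w in E `&` [set w | N w C = 1%E]) G (S w, located_point C w) =
   (expR (- l))%:E * \int[P]_(w in E) \int[mu3]_(z in C) G (S w, z))%E.
Proof.
move=> mQ mC QC Cs lC sE sS mG G0.
have mE := events_in_measurable sE.
have mS : measurable_fun setT S.
  by move=> _ A mA; rewrite setTI; apply: events_in_measurable; exact: sS.
have m1 : measurable [set w | N w C = 1%E].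
  exact: measurable_count_eq.
have mE1 := measurableI _ _ mE m1.
pose pair w := (S w, located_point C w).
have mpair : measurable_fun setT pair.
  by apply: measurable_fun_pair => //; exact: measurable_located_point.
pose k : {nonneg R} := NngNum (expR_ge0 (- l)).
pose m1' : {measure set U -> \bar R} := mscale k (image_measure (mrestr P mE) mS).
have m1fin : (m1' setT < +oo)%E.
  rewrite /m1' /= /mscale /= /pushforward /mrestr preimage_setT setTI.
  by rewrite -(fineK (fin_num_measure P E mE)) -EFinM ltry.
have m2fin := finite_mrestr mC lC.
pose m1f : {finite_measure set U -> \bar R} := finite_copy m1fin.
pose m2f : {finite_measure set point_type -> \bar R} := finite_copy m2fin.
have prodE X : measurable X -> (m1f \x m2f)%E X = image_measure (mrestr P mE1) mpair X.
  apply: product_measure_unique => A B mA mB.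
  have mCB := measurableI _ _ mC mB.
  have mCB' := measurableI _ _ mC (measurableC mB).
  have CBs X' : C `&` X' `<=` @state_space R by apply: subset_trans Cs; exact: subIsetl.
  have meanE X' : mean_measure (C `&` X') = mu3 (C `&` X').
    by rewrite mean_mu3 (setIidl (CBs X')).
  have fin X' : measurable X' -> mu3 (C `&` X') \is a fin_num.
    move=> mX'; rewrite ge0_fin_numE//; apply: (@le_lt_trans _ _ l%:E); last exact: ltry.
    by rewrite -lC; apply: le_measure; rewrite ?inE//; exact: measurableI.
  have l1E : mean_measure (C `&` B) = (fine (mu3 (C `&` B)))%:E by rewrite meanE fineK ?fin.
  have l2E : mean_measure (C `&` ~` B) = (fine (mu3 (C `&` ~` B)))%:E.
    by rewrite meanE fineK// fin//; exact: measurableC.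
  have lE : fine (mu3 (C `&` B)) + fine (mu3 (C `&` ~` B)) = l.
    apply: EFin_inj; rewrite EFinD !fineK ?fin//; last exact: measurableC.
    by rewrite -lC -measureU//; [rewrite -setIUr setUCr setIT|rewrite setIACA setICr setI0].
  rewrite /image_measure /= /pushforward /mrestr /=.
  rewrite (_ : _ `&` (E `&` _) = (E `&` S @^-1` A) `&`
    ([set w | [set 1%E] (N w (C `&` B))] `&` [set w | [set 0%E] (N w (C `&` ~` B))])).
    have sEA : <<s events_in N Q >> (E `&` S @^-1` A).
      by apply: (@measurableI _ (g_sigma_algebraType (events_in N Q))) => //; exact: sS.
    rewrite (past_independent HN mQ mCB mCB' _ _ _ _ _ sEA)//.
    - rewrite (poisson_count1 HN mCB l1E) (poisson_count0 HN mCB' l2E).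
      rewrite /m1f /m2f /finite_copy /m1' /= /mscale /= /pushforward /mrestr /=.
      rewrite [B `&` C]setIC [S @^-1` A `&` E]setIC.
      rewrite -[mu3 (C `&` B)]fineK ?fin// -lE opprD expRD.
      rewrite -(fineK (fin_num_measure P _ (events_in_measurable sEA))) -!EFinM.
      by congr (_%:E); ring.
    - by rewrite setIA QC set0I.
    - by rewrite setIA QC set0I.
    - by rewrite setIACA setICr setI0.
  have Nsplit w : N w C = (N w (C `&` B) + N w (C `&` ~` B))%E.
    by rewrite -measureU//; [rewrite -setIUr setUCr setIT|rewrite setIACA setICr setI0].
  apply/seteqP; split => w /=.
    move=> [[SA LB] [Ew NC]]; split => //.
    have [_ hz] := single_pointP mC NC.
    rewrite /located_point NC eqxx in LB.
    rewrite !hz//; last exact: measurableC.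
    by split; rewrite indicE; [rewrite mem_set|rewrite memNset].
  move=> [[Ew SA] [h1 h2]].
  have NC : N w C = 1%E by rewrite Nsplit h1 h2 adde0.
  split => //; split => //; have [_ hz] := single_pointP mC NC.
  rewrite /located_point NC eqxx; move: h1; rewrite hz// indicE.
  have [/set_mem//|_] := boolP (single_point C w \in B).
  by move=> /eqP; rewrite eqe eq_sym oner_eq0.
have e1 : (\int[P]_(w in E `&` [set w | N w C = 1%E]) G (S w, located_point C w) =
    \int[image_measure (mrestr P mE1) mpair]_x G x)%E.
  rewrite ge0_integral_pushforward// preimage_setT integral_mrestr//.
    exact: measurableT_comp.
  by move=> x; exact: G0.
have e2 : (\int[image_measure (mrestr P mE1) mpair]_x G x = \int[m1f \x m2f]_x G x)%E.
  by apply: eq_measure_integral => X mX _; exact: esym (prodE X mX).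
rewrite (etrans e1 e2) fubini_tonelli1//.
have mF : measurable_fun setT (fubini_F m2f G) by exact: measurable_fun_fubini_tonelli_F.
have F0 a : (0 <= fubini_F m2f G a)%E by apply: integral_ge0.
rewrite (_ : (\int[m1f]_x fubini_F m2f G x = \int[m1']_x fubini_F m2f G x)%E)//.
rewrite /m1' ge0_integral_mscale//; congr (_ * _)%E.
rewrite ge0_integral_pushforward// preimage_setT integral_mrestr//; first last.
- by move=> x; exact: F0.
- exact: measurableT_comp.
apply: eq_integral => w _; rewrite /fubini_F /= /m2f /finite_copy integral_mrestr//.
exact: measurableT_comp (measurable_pair1 _).
Qed.

End Freeze.

(** * Integrals over space-time cells *)

Section ProductSigmaFinite.
Context d1 d2 (T1 : measurableType d1) (T2 : measurableType d2) (R : realType).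
Variables (m1 : {sigma_finite_measure set T1 -> \bar R})
  (m2 : {sigma_finite_measure set T2 -> \bar R}).

(** A name that can carry the sigma-finiteness of a product as a canonical structure, so
    that products can be iterated. *)
Definition product_copy : set (T1 * T2) -> \bar R := (m1 \x m2)%E.

HB.instance Definition _ := Measure.on product_copy.

Let product_sigma_finite : sigma_finite setT product_copy.
Proof.
have [F1 cF1 hF1] := sigma_finiteT m1; have [F2 cF2 hF2] := sigma_finiteT m2.
exists (fun k => if @choice.unpickle (nat * nat)%type k is Some ij
  then F1 ij.1 `*` F2 ij.2 else set0).
  apply/esym/seteqP; split => // -[x y] _.
  have : [set: T1] x by []. have : [set: T2] y by [].
  rewrite cF1 cF2 => -[j _ yj] [i _ xi].
  by exists (choice.pickle (i, j)) => //; rewrite choice.pickleK.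
move=> k; case: choice.unpickle => [[i j]|]; last by rewrite measure0; split.
have [mi fi] := hF1 i; have [mj fj] := hF2 j.
split; first exact: measurableX.
by rewrite /product_copy product_measure1E// lte_mul_pinfty// ge0_fin_numE.
Qed.

HB.instance Definition _ :=
  Measure_isSigmaFinite.Build _ _ _ product_copy product_sigma_finite.

End ProductSigmaFinite.

Section BoxIntegral.
Context d1 d2 d3 (T1 : measurableType d1) (T2 : measurableType d2)
  (T3 : measurableType d3) (R : realType).
Variables (m1 : {sigma_finite_measure set T1 -> \bar R})
  (m2 : {sigma_finite_measure set T2 -> \bar R})
  (m3 : {sigma_finite_measure set T3 -> \bar R}).

Lemma integral_box (A : set T1) (B : set T2) (C : set T3) (g : T2 * T3 -> \bar R) :
  measurable A -> measurable B -> measurable C ->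
  measurable_fun setT g -> (forall x, 0 <= g x)%E ->
  (\int[m1 \x m2 \x m3]_(z in (A `*` B) `*` C) g (z.1.2, z.2) =
   m1 A * \int[m2]_(x in B) \int[m3]_(u in C) g (x, u))%E.
Proof.
move=> mA mB mC mg g0; rewrite integral_mkcond; set h := _ \_ _.
have h0 z : (0 <= h z)%E by rewrite /h /patch; case: ifPn.
have mABC : measurable ((A `*` B) `*` C) by apply: measurableX => //; exact: measurableX.
have mh : measurable_fun setT h.
  apply/measurable_restrict => //; rewrite setTI; apply: measurable_funTS.
  apply: (measurableT_comp mg); apply: measurable_fun_pair => //.
  exact: measurableT_comp measurable_snd measurable_fst.
pose m12 : {sigma_finite_measure set (T1 * T2)%type -> \bar R} := product_copy m1 m2.
have e1 := @fubini_tonelli1 _ _ _ _ R m12 m3 h mh h0.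
apply: etrans e1 _.
pose I x := (\int[m3]_(u in C) g (x, u))%E.
have I0 x : (0 <= I x)%E by apply: integral_ge0.
have mI : measurable_fun setT I.
  rewrite /I (_ : (fun x => _) = fubini_F m3 (fun z => (g z * (\1_C z.2)%:E)%E)).
    apply: measurable_fun_fubini_tonelli_F; last first.
      by move=> z; apply: mule_ge0 => //; rewrite lee_fin.
    apply: emeasurable_funM => //; apply/measurable_EFinP.
    by apply: measurableT_comp measurable_snd; exact: measurable_indic.
  apply/funext => x; rewrite /fubini_F /= integral_mkcond; apply: eq_integral => u _.
  by rewrite /patch indicE; case: ifPn; rewrite ?mule1 ?mule0.
have inner p : fubini_F m3 h p = ((I \_ B) p.2 * (\1_A p.1)%:E)%E.
  rewrite /fubini_F /h /patch indicE /=.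
  case: (boolP (p.2 \in B)) => [/set_mem|/negP] Bp; last first.
    rewrite mul0e integral0_eq// => u _; rewrite memNset// => -[[_ /mem_set]//].
  case: (boolP (p.1 \in A)) => [/set_mem|/negP] Ap; rewrite ?mule1 ?mule0.
    rewrite /I [RHS]integral_mkcond; apply: eq_integral => u _.
    rewrite /patch; case: ifPn => [/set_mem[_ Cu]|]; first by rewrite mem_set.
    by move=> /negP Nu; rewrite memNset// => Cu; apply: Nu; exact/mem_set.
  by rewrite integral0_eq// => u _; rewrite memNset// => -[[/mem_set]//].
rewrite (eq_integral (fun p => ((I \_ B) p.2 * (\1_A p.1)%:E)%E)); last by move=> p _.
pose h2 (p : T1 * T2) := ((I \_ B) p.2 * (\1_A p.1)%:E)%E.
have h20 p : (0 <= h2 p)%E.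
  by rewrite /h2 mule_ge0 ?lee_fin// /patch; case: ifPn.
have mh2 : measurable_fun setT h2.
  apply: emeasurable_funM.
    apply: measurableT_comp measurable_snd.
    by apply/measurable_restrict => //; rewrite setTI; exact: measurable_funTS.
  apply/measurable_EFinP; apply: measurableT_comp measurable_fst.
  exact: measurable_indic.
have e2 := @fubini_tonelli1 _ _ _ _ R m1 m2 h2 mh2 h20.
apply: etrans e2 _; rewrite /fubini_F /h2 /=.
under eq_integral => x _.
  rewrite ge0_integralZr//; last first.
  - by move=> y _; rewrite /patch; case: ifPn.
  - by apply/measurable_restrict => //; rewrite setTI; exact: measurable_funTS.
  over.
rewrite -integral_mkcond ge0_integralZl//; last first.
- by apply: integral_ge0 => x _; exact: I0.
- by apply/measurable_EFinP; exact: measurable_indic.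
by rewrite integral_indic// setIT muleC.
Qed.

End BoxIntegral.

Section CellIntegral.
Variable R : realType.
Local Notation mu := (@lebesgue_measure R).
Local Notation point_type := (space_time_mark R).
Local Notation state_type := (measurableTypeR R * measurableTypeR R)%type.

Lemma cellE (s t : R) (W : set R) : cell s t W = (`]s, t]%classic `*` W) `*` `[0, 2]%classic.
Proof.
apply/seteqP; split => -[[a x] u]; rewrite /cell /=.
  by move=> [[sa Wx] u02]; rewrite !in_itv.
by move=> [[]]; rewrite !in_itv.
Qed.

Lemma cell_state (s t : R) (W : set R) : 0 <= s -> cell s t W `<=` @state_space R.
Proof.
move=> s0 [[a x] u] [[/= /andP[sa _] _] /andP[u0 _]]; split => /=.
  by split => //=; rewrite in_itv/= andbT (le_trans s0)// ltW.
by rewrite in_itv/= u0.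
Qed.

Lemma lebesgue_itvoc (a b : R) : a <= b -> mu `]a, b]%classic = (b - a)%:E.
Proof.
move=> ab; rewrite lebesgue_measure_itv/= lte_fin; case: ltP => // ba.
by rewrite (le_anti (introT andP (conj ab ba))) subrr.
Qed.

Lemma lebesgue_itvcc (a b : R) : a <= b -> mu `[a, b]%classic = (b - a)%:E.
Proof.
move=> ab; rewrite lebesgue_measure_itv/= lte_fin; case: ltP => // ba.
by rewrite (le_anti (introT andP (conj ab ba))) subrr.
Qed.

Lemma volume_cell (s t a b : R) : s <= t -> a <= b ->
  (mu \x mu \x mu)%E (cell s t `]a, b]%classic) = ((t - s) * (b - a) * 2)%:E.
Proof.
move=> st ab; rewrite cellE.
have m1 : measurable (`]s, t]%classic `*` `]a, b]%classic : set state_type).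
  exact: measurableX.
have e1 := @product_measure1E _ _ _ _ R (mu \x mu)%E mu _ `[0, 2]%classic m1 (measurable_itv _).
have e2 := @product_measure1E _ _ _ _ R mu mu `]s, t]%classic `]a, b]%classic
  (measurable_itv _) (measurable_itv _).
apply: etrans e1 _; apply: etrans (congr1 (fun y => y * _)%E e2) _.
have h02 : 0 <= 2 :> R by [].
rewrite [X in (X * _ * _)%E](lebesgue_itvoc st) [X in (_ * X * _)%E](lebesgue_itvoc ab).
by rewrite [X in (_ * X)%E](lebesgue_itvcc h02) subr0 -!EFinM.
Qed.

Lemma integral_cell (s t : R) (W : set (measurableTypeR R)) (g : state_type -> \bar R) :
  s <= t -> measurable W -> measurable_fun setT g -> (forall x, 0 <= g x)%E ->
  (\int[mu \x mu \x mu]_(z in cell s t W) g (z.1.2, z.2) =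
   (t - s)%:E * \int[mu]_(x in W) \int[mu]_(u in `[0%R, 2%R]) g (x, u))%E.
Proof.
move=> st mW mg g0; rewrite cellE.
rewrite (@integral_box _ _ _ _ _ _ R mu mu mu `]s, t]%classic W `[0, 2]%classic)//.
by rewrite [X in (X * _)%E](lebesgue_itvoc st).
Qed.

End CellIntegral.

Section StepCost.
Variable R : realType.
Local Notation mu := (@lebesgue_measure R).
Local Notation point_type := (space_time_mark R).
Local Notation state_type := (measurableTypeR R * measurableTypeR R)%type.
Local Notation D := (jump_bound R).

(** The squared deviation after a step that sees the single point [p.2] from the state
    [p.1]. *)
Definition step_cost (a : R) (p : state_type * point_type) : \bar R :=
  ((front_value p.1 - a +
    (if p.2.2 <= birth_rate p.1.2 (p.2.1.2 - p.1.1) then jump p.1 p.2.1.2 else 0)) ^+ 2)%:E.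

Lemma step_costE a S z :
  step_cost a (S, z) = ((front_value (front_step S z.1.2 z.2) - a) ^+ 2)%:E.
Proof. by rewrite /step_cost front_value_step /= addrAC. Qed.

Lemma step_cost_ge0 a p : (0 <= step_cost a p)%E.
Proof. by rewrite lee_fin sqr_ge0. Qed.

Lemma measurable_step_cost a : measurable_fun setT (step_cost a).
Proof.
have m1 : measurable_fun setT (fun p : state_type * point_type => p.1.1).
  exact: measurableT_comp measurable_fst measurable_fst.
have m2 : measurable_fun setT (fun p : state_type * point_type => p.1.2).
  exact: measurableT_comp measurable_snd measurable_fst.
have m3 : measurable_fun setT (fun p : state_type * point_type => p.2.1.2).
  exact: measurableT_comp (measurableT_comp measurable_snd measurable_fst) measurable_snd.
have m4 : measurable_fun setT (fun p : state_type * point_type => p.2.2).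
  exact: measurableT_comp measurable_snd measurable_snd.
apply/measurable_EFinP; apply: measurable_funX; apply: measurable_funD.
  by apply: measurable_funB => //; exact: (measurable_front_value m1 m2).
apply: measurable_fun_if => //.
  apply: measurable_fun_ler => //; apply: measurable_birth_rate => //.
  exact: measurable_funB.
by apply: measurable_funTS; exact: (measurable_jump m1 m2 m3).
Qed.

Lemma integral_step_cost a S (t t' j : R) : 0 <= S.2 <= 1 \/ S.2 = 3 ->
  j <= S.1 < j + 1 -> t <= t' ->
  (\int[mu \x mu \x mu]_(z in cell t t' `](j - 2)%R, (j + 3)%R]) step_cost a (S, z) <=
   ((t' - t) * (10 * (front_value S - a) ^+ 2 + 2 * (front_value S - a) * speed R
      + 3 * D ^+ 2))%:E)%E.
Proof.
move=> gap jS tt'.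
pose g (y : state_type) := step_cost a (S, (0, y.1, y.2)).
have mg : measurable_fun setT g.
  apply: measurableT_comp (measurable_step_cost a) _.
  by apply: measurable_fun_pair => //; apply: measurable_fun_pair => //; apply: measurable_fun_pair.
have g0 x : (0 <= g x)%E by exact: step_cost_ge0.
have e := @integral_cell R t t' `](j - 2), (j + 3)]%classic g tt' (measurable_itv _) mg g0.
set K := front_value S - a.
have e' : (\int[mu \x mu \x mu]_(z in cell t t' `](j - 2)%R, (j + 3)%R]) step_cost a (S, z) =
    (t' - t)%:E * \int[mu]_(x in `](j - 2)%R, (j + 3)%R]) (mark_average K S x)%:E)%E.
  apply: etrans (etrans e _).
    by apply: eq_integral => z _.
  congr (_ * _)%E; apply: eq_integral => x _.
  apply: etrans (mark_averageE K S x); apply: eq_integral => u _.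
  by rewrite /g /step_cost.
rewrite e'.
rewrite EFinM; apply: lee_wpmul2l; first by rewrite lee_fin subr_ge0.
exact: generator_bound.
Qed.

End StepCost.

(** * The front as a function of the past *)

Section FrontState.
Context d (T : measurableType d) (R : realType) (P : probability T R).
Variable N : R.-ker T ~> space_time_mark R.
Local Notation point_type := (space_time_mark R).
Local Notation state_type := (measurableTypeR R * measurableTypeR R)%type.
Variable eta : T -> R -> {fset R}.

Definition past (t : R) : set point_type := `[0, t] `*` [set: R] `*` `[0, +oo[.

Lemma measurable_past t : measurable (past t).
Proof. by apply: measurableX => //; exact: measurableX. Qed.

Lemma past_sub s t : s <= t -> past s `<=` past t.
Proof.
move=> st [[a x] u] [[/=]]; rewrite in_itv/= => /andP[a0 as_] _ u0.
by split => //=; split => //=; rewrite in_itv/= a0 (le_trans as_).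
Qed.

Lemma events_in_sub (Q Q' : set point_type) : Q `<=` Q' ->
  <<s events_in N Q >> `<=` <<s events_in N Q' >>.
Proof.
move=> QQ'; apply: smallest_sub; first exact: smallest_sigma_algebra.
move=> _ [B [A [mB BQ mA ->]]]; apply: sub_sigma_algebra.
by exists B, A; split => //; exact: subset_trans QQ'.
Qed.

Hypothesis adapted : forall (t : R) (B : set (measurableTypeR R)) (k : nat),
  0 <= t -> measurable B ->
  completed_filtration P N t [set w | count_in (eta w t) B = k].
Hypothesis paths : {ae P, forall w, exists el, regular_path (N w) (eta w) el}.

(** Completion makes membership insensitive to null sets. *)
Lemma completed_ae_eq (G : set (set T)) (E E' : set T) : completed P G E ->
  {ae P, forall w, E w <-> E' w} -> completed P G E'.
Proof.
move=> cE EE'; pose GT := g_sigma_algebraType (G `|` P.-negligible).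
have cneg A : P.-negligible A -> completed P G A.
  by move=> nA; apply: sub_sigma_algebra; right.
have sub1 : E `\` E' `<=` ~` [set w | E w <-> E' w].
  by move=> w [Ew nE'w] /= [/(_ Ew)].
have sub2 : E' `\` E `<=` ~` [set w | E w <-> E' w].
  by move=> w [E'w nEw] /= [_ /(_ E'w)].
have -> : E' = (E `\` (E `\` E')) `|` (E' `\` E).
  apply/seteqP; split => w.
    by move=> E'w; have [Ew|nEw] := pselect (E w); [left; split => // -[]|right].
  move=> [[Ew h]|[]//]; apply: contrapT => nE'w; exact: h.
apply: (@measurableU _ GT); last by apply: cneg; exact: negligibleS EE'.
by apply: (@measurableD _ GT) => //; apply: cneg; exact: negligibleS EE'.
Qed.

Lemma front_count_gt0 c (X Z a : R) : is_front c X Z ->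
  a < X <-> ~ count_in c `]a, +oo[%classic = 0%N.
Proof.
move=> [Xc mX _]; split => [aX /count_in_eq0/(_ _ Xc)|].
  by rewrite /= in_itv/= aX.
move=> h; rewrite ltNge; apply/negP => Xa; apply: h; apply/count_in_eq0 => y yc.
by rewrite /= in_itv/= andbT => ay; have := mX _ yc; lra.
Qed.

Lemma count_in_ge2 c (B : set R) (x y : R) : x \in c -> y \in c -> x != y ->
  B x -> B y -> (1 < count_in c B)%N.
Proof.
move=> xc yc xy Bx By; rewrite /count_in.
have sub : ([fset x; y] `<=` [fset z in c | z \in B])%fset.
  by apply/fsubsetP => z; rewrite !inE => /orP[]/eqP->; rewrite ?xc ?yc mem_set.
by apply: leq_trans (fsubset_leq_card sub); rewrite cardfs2 xy.
Qed.

(** [X - Z] lies beyond [a] when at least two particles do; a lone particle has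
    [X - Z = X - 3]. *)
Lemma front_count_ge2 c (X Z a : R) : is_front c X Z ->
  a < X - Z <-> (~ (count_in c `]a, +oo[%classic = 0%N \/
      count_in c `]a, +oo[%classic = 1%N)) \/
    (count_in c setT = 1%N /\ ~ count_in c `](a + 3), +oo[%classic = 0%N).
Proof.
move=> fX; case: (fX) => Xc mX [[Z3 cX]|[/andP[Z0 Z1] Zc mZ]].
  have c1 : count_in c setT = 1%N by rewrite count_in_setT cX cardfs1.
  have := @front_count_gt0 _ _ _ (a + 3) fX; rewrite Z3 => h.
  split => [aX|[h1|[_]]].
  - by right; split => //; apply/h; lra.
  - exfalso; apply: h1.
    have : (count_in c `]a, +oo[%classic <= 1)%N.
      rewrite -c1 /count_in; apply: fsubset_leq_card; apply/fsubsetP => y.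
      by rewrite !inE => /andP[->]; rewrite in_setT.
    by case: (count_in _ _) => [|[|]]//; [left|right].
  - by move=> /h; lra.
have XZ : X != X - Z by rewrite neq_lt; apply/orP; right; lra.
split => [aX|[h1|[c1 _]]].
- left; have : (1 < count_in c `]a, +oo[%classic)%N.
    by apply: (count_in_ge2 Xc Zc) => //=; rewrite in_itv/=; lra.
  by case: (count_in _ _) => [|[|]]// k _ [].
- rewrite ltNge; apply/negP => Za; apply: h1.
  have : (count_in c `]a, +oo[%classic <= 1)%N.
    rewrite -(cardfs1 X) /count_in; apply: fsubset_leq_card; apply/fsubsetP => y.
    rewrite !inE => /andP[yc]; rewrite mem_setE in_itv/= andbT => ay.
    by have [->|] := mZ _ yc; rewrite ?eqxx//; lra.
  by case: (count_in _ _) => [|[|]]//; [left|right].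
- by have := count_in_ge2 Xc Zc XZ I I; rewrite c1.
Qed.

(** The events [a < X] and [a < X - Z] are expressed by counts of particles in half-lines,
    so [X] and [X - Z] are measurable for the completed filtration and have modifications
    that depend on the points up to time [t] only.  The modification is altered on a
    null set to satisfy the range constraints everywhere. *)
Lemma front_state t : 0 <= t -> exists S : T -> state_type,
  [/\ forall A, measurable A -> <<s events_in N (past t) >> (S @^-1` A),
      {ae P, forall w, is_front (eta w t) (S w).1 (S w).2} &
      forall w, 0 <= (S w).1 /\ (0 <= (S w).2 <= 1 \/ (S w).2 = 3)].
Proof.
move=> t0; pose G := events_in N (past t).
pose GT := g_sigma_algebraType (G `|` P.-negligible).
have cnt (B : set (measurableTypeR R)) k : measurable B ->
    completed P G [set w | count_in (eta w t) B = k] by move=> mB; exact: adapted.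
have fronts : {ae P, forall w, exists XZ : R * R, is_front (eta w t) XZ.1 XZ.2}.
  apply: filterS paths => w [el path].
  by have [X [Z fXZ]] := front_exists path t0; exists (X, Z).
pose F w : R * R := xget (0, 0) [set XZ | is_front (eta w t) XZ.1 XZ.2].
have FP : {ae P, forall w, is_front (eta w t) (F w).1 (F w).2}.
  apply: filterS fronts => w h.
  exact: (@xgetPex _ (0, 0) [set XZ : R * R | is_front (eta w t) XZ.1 XZ.2] h).
have cX a : completed P G [set w | a < (F w).1].
  apply: (@completed_ae_eq _ (~` [set w | count_in (eta w t) `]a, +oo[%classic = 0%N])).
    by apply: (@measurableC _ GT); exact: cnt.
  by apply: filterS FP => w /(front_count_gt0 a) [h1 h2]; split.
have cY a : completed P G [set w | a < (F w).1 - (F w).2].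
  apply: (@completed_ae_eq _ (~` ([set w | count_in (eta w t) `]a, +oo[%classic = 0%N]
      `|` [set w | count_in (eta w t) `]a, +oo[%classic = 1%N])
    `|` ([set w | count_in (eta w t) setT = 1%N] `&`
      ~` [set w | count_in (eta w t) `](a + 3), +oo[%classic = 0%N]))).
    apply: (@measurableU _ GT).
      by apply: (@measurableC _ GT); apply: (@measurableU _ GT); exact: cnt.
    apply: (@measurableI _ GT); first exact: cnt.
    by apply: (@measurableC _ GT); exact: cnt.
  by apply: filterS FP => w /(front_count_ge2 a) [h1 h2]; split.
have [X mX XE] := completed_modification cX.
have [Y mY YE] := completed_modification cY.
(* Almost surely neither correction has an effect, since [0 <= X], and [Y = X - Z] with
   [0 < Z <= 1] or [Z = 3]. *)
pose S (w : g_sigma_algebraType G) : state_type :=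
  (Num.max 0 (X w), if (0 <= X w - Y w) && (X w - Y w <= 1) then X w - Y w else 3).
have mS : measurable_fun setT S.
  apply: measurable_fun_pair; first exact: measurable_maxr.
  have mXY := measurable_funB mX mY.
  apply: measurable_fun_if => //; last exact: measurable_funTS.
  by apply: measurable_and; apply: measurable_fun_ler.
exists S; split.
- by move=> A mA; have := mS measurableT A mA; rewrite setTI.
- near=> w; have [el path] : exists el, regular_path (N w) (eta w) el by near: w.
  have fw : is_front (eta w t) (F w).1 (F w).2 by near: w.
  have Xw : X w = (F w).1 by near: w.
  have Yw : Y w = (F w).1 - (F w).2 by near: w.
  have X0 := is_front_ge0 path t0 fw.
  rewrite /S Xw Yw /= subKr max_r//.
  case: (fw) => _ _ [[Z3 _]|[/andP[Z0 Z1] _ _]].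
    by rewrite Z3 ifF//; [rewrite -Z3|apply/negbTE/negP; lra].
  by rewrite Z1 (ltW Z0).
- move=> w; split; first by rewrite le_max lexx.
  by rewrite /S/=; case: ifPn => h; [left|right].
Unshelve. all: by end_near. Qed.

End FrontState.

(** * One time step *)

Section OneStepEstimate.
Context d (T : measurableType d) (R : realType) (P : probability T R).
Variable N : R.-ker T ~> space_time_mark R.
Hypothesis HN : poisson_point_process P N.
Local Notation mu := (@lebesgue_measure R).
Local Notation point_type := (space_time_mark R).
Local Notation state_type := (measurableTypeR R * measurableTypeR R)%type.
Local Notation D := (jump_bound R).
Local Notation v := (speed R).

Lemma past_independent1 (Q C : set point_type) (A : set (\bar R)) (E : set T) :
  measurable Q -> measurable C -> measurable A -> Q `&` C = set0 ->
  <<s events_in N Q >> E ->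
  P (E `&` [set w | A (N w C)]) = (P E * P [set w | A (N w C)])%E.
Proof.
move=> mQ mC mA QC sE.
have := past_independent HN mQ mC measurable0 mA (emeasurable_set1 0%E) QC (setI0 Q) (setI0 C) sE.
rewrite (_ : [set w | [set 0%E] (N w set0)] = setT); last first.
  by apply/seteqP; split => // w _ /=; rewrite measure0.
by rewrite setIT probability_setT mule1.
Qed.

(** The companion of [freeze_point] for a region without points. *)
Lemma freeze_none d' (U : measurableType d') (Q C : set point_type) (E : set T)
    (S : T -> U) (l : R) (g : U -> \bar R) :
  measurable Q -> measurable C -> Q `&` C = set0 -> mean_measure C = l%:E ->
  <<s events_in N Q >> E ->
  (forall A, measurable A -> <<s events_in N Q >> (S @^-1` A)) ->
  measurable_fun setT g -> (forall x, 0 <= g x)%E ->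
  (\int[P]_(w in E `&` [set w | N w C = 0%E]) g (S w) =
   (expR (- l))%:E * \int[P]_(w in E) g (S w))%E.
Proof.
move=> mQ mC QC lC sE sS mg g0.
have mE := events_in_measurable sE.
have mS : measurable_fun setT S.
  by move=> _ A mA; rewrite setTI; apply: events_in_measurable; exact: sS.
have m0 : measurable [set w | N w C = 0%E].
  exact: measurable_count_eq.
have mE0 := measurableI _ _ mE m0.
pose k : {nonneg R} := NngNum (expR_ge0 (- l)).
have e1 (E' : set T) (mE' : measurable E') : (\int[P]_(w in E') g (S w) =
    \int[image_measure (mrestr P mE') mS]_x g x)%E.
  rewrite ge0_integral_pushforward// preimage_setT integral_mrestr//.
    exact: measurableT_comp.
  by move=> x; exact: g0.
rewrite (e1 _ mE0) (e1 _ mE) -[RHS](ge0_integral_mscale _ measurableT k)//.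
apply: eq_measure_integral => A mA _.
rewrite /image_measure /mscale /= /pushforward /mrestr /=.
have sEA : <<s events_in N Q >> (E `&` S @^-1` A).
  by apply: (@measurableI _ (g_sigma_algebraType (events_in N Q))) => //; exact: sS.
rewrite setIA [S @^-1` A `&` E]setIC.
rewrite (@past_independent1 Q C [set 0%E])//.
by rewrite (poisson_count0 HN mC lC) muleC setIC.
Qed.

Variable eta : T -> R -> {fset R}.
Hypothesis paths : {ae P, forall w, exists el, regular_path (N w) (eta w) el}.

(** When [j] is the integer part of [X], the window contains [[X - 1, X + 2]], where
    everything that concerns the front in one step takes place.  It depends on [X] only
    through [j], so that the step is conditioned on countably many regions. *)
Definition window (t t' j : R) : set point_type := cell t t' `](j - 2), (j + 3)]%classic.

Lemma measurable_window t t' j : measurable (window t t' j).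
Proof. exact: measurable_cell. Qed.

Lemma past_window t t' j : past t `&` window t t' j = set0.
Proof.
rewrite -subset0 => -[[a x] u] [[[/=]]]; rewrite in_itv/= => /andP[_ at_] _ _.
by move=> [[/= /andP[ta _] _] _]; have := lt_le_trans ta at_; rewrite ltxx.
Qed.

Lemma mean_window t t' j : 0 <= t -> t <= t' ->
  mean_measure (window t t' j) = (10 * (t' - t))%:E.
Proof.
move=> t0 tt'; rewrite /mean_measure (setIidl (@cell_state R t t' _ t0)).
rewrite (_ : 10 * (t' - t) = (t' - t) * (j + 3 - (j - 2)) * 2); last by ring.
by apply: volume_cell => //; lra.
Qed.

Definition deviation (t : R) (S : state_type) : \bar R :=
  ((front_value S - v * t) ^+ 2)%:E.

Lemma deviation_ge0 t S : (0 <= deviation t S)%E.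
Proof. by rewrite lee_fin sqr_ge0. Qed.

Lemma measurable_deviation t : measurable_fun setT (deviation t).
Proof.
apply/measurable_EFinP; apply: measurable_funX; apply: measurable_funB => //.
exact: (measurable_front_value measurable_fst measurable_snd).
Qed.

Definition drift_const : R := 10 * `|v|.
Definition noise_const : R := 10 * `|v| + v ^+ 2 + 3 * D ^+ 2.

(** Here [M] is the deviation of [front_value] at the beginning of the step and [K] the
    one computed with the time at its end.  The drift term [2 * K * v * dt] compensates
    the difference between the squares of [K] and [M] up to [O(dt^2)], and the factor
    [expR (- (10 * dt)) * (1 + 10 * dt) <= 1] takes care of the term in [10 * K ^+ 2]. *)
Lemma one_step_bound (K M dt : R) : 0 <= dt <= 1 -> K = M - v * dt ->
  expR (- (10 * dt)) * (K ^+ 2 + dt * (10 * K ^+ 2 + 2 * K * v + 3 * D ^+ 2)) <=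
  (1 + drift_const * dt ^+ 2) * M ^+ 2 + noise_const * dt.
Proof.
move=> /andP[d0 d1] KE.
set a := expR _; have a0 : 0 < a by exact: expR_gt0.
have a1 : a * (1 + 10 * dt) <= 1.
  by rewrite /a expRN mulrC ler_pdivrMr ?expR_gt0// mul1r expR_ge1Dx.
have a2 : 1 - 10 * dt <= a by rewrite /a expR_ge1Dx.
have a3 : a <= 1 by rewrite /a -[leRHS]expR0 ler_expR; lra.
move: a a0 a1 a2 a3 => a a0 a1 a2 a3.
have hK : a * ((1 + 10 * dt) * K ^+ 2) <= K ^+ 2.
  by rewrite mulrA -[leRHS]mul1r ler_wpM2r ?sqr_ge0.
have hD : a * (dt * (3 * D ^+ 2)) <= 3 * D ^+ 2 * dt.
  rewrite mulrC [leRHS]mulrC ler_piMr//; first by rewrite mulr_ge0// mulr_ge0 ?sqr_ge0.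
have dt2 : dt ^+ 2 <= dt by rewrite expr2 ler_piMr.
have hv : v ^+ 2 * dt ^+ 2 <= v ^+ 2 * dt by rewrite ler_wpM2l ?sqr_ge0.
have hv' : 0 <= a * (v ^+ 2 * dt ^+ 2) by rewrite mulr_ge0 ?(ltW a0)// mulr_ge0 ?sqr_ge0.
have hM : - (M * v) * (2 * dt * (1 - a)) <= 10 * `|v| * dt ^+ 2 * M ^+ 2 + 10 * `|v| * dt.
  have h1 : - (M * v) <= `|M| * `|v| by rewrite -normrM -normrN ler_norm.
  have h2 : 0 <= 2 * dt * (1 - a) by rewrite !mulr_ge0//; lra.
  apply: le_trans (ler_wpM2r h2 h1) _.
  have h3 : 2 * `|M| <= M ^+ 2 + 1.
    by rewrite -(real_normK (num_real M)); have := sqr_ge0 (`|M| - 1); rewrite sqrrB1; lra.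
  have h4 : dt * (1 - a) <= 10 * dt ^+ 2.
    by rewrite expr2 [10 * _]mulrCA ler_wpM2l//; lra.
  have h5 : 0 <= dt * (1 - a) by rewrite mulr_ge0//; lra.
  rewrite (_ : `|M| * `|v| * (2 * dt * (1 - a)) = `|v| * ((2 * `|M|) * (dt * (1 - a)))); last by ring.
  rewrite (_ : 10 * `|v| * dt ^+ 2 * M ^+ 2 + 10 * `|v| * dt =
     `|v| * (10 * dt ^+ 2 * M ^+ 2 + 10 * dt)); last by ring.
  rewrite ler_wpM2l//; apply: le_trans (ler_pM _ h5 h3 h4) _; first by rewrite mulr_ge0.
  by rewrite mulrDl mul1r [M ^+ 2 * _]mulrC; lra.
rewrite /drift_const /noise_const.
rewrite (_ : a * _ = a * ((1 + 10 * dt) * K ^+ 2) + a * (dt * (3 * D ^+ 2)) +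
  2 * a * dt * v * K); last by ring.
have KK : K ^+ 2 + 2 * a * dt * v * K = M ^+ 2 + (- (M * v)) * (2 * dt * (1 - a))
   + v ^+ 2 * dt ^+ 2 - 2 * (a * (v ^+ 2 * dt ^+ 2)) by rewrite KE; ring.
lra.
Qed.

(** The count in the window is independent of the past and Poisson with mean
    [10 * (t' - t)]. *)
Lemma one_step_mass (t t' j : R) (E : set T) : 0 <= t -> t <= t' ->
  <<s events_in N (past t) >> E ->
  P (E `&` ([set w | N w (window t t' j) = 0%E] `|` [set w | N w (window t t' j) = 1%E])) =
    (P E * (expR (- (10 * (t' - t))) * (1 + 10 * (t' - t)))%:E)%E.
Proof.
move=> t0 tt' sE; have mE := events_in_measurable sE.
have mw := measurable_window t t' j; have mp := measurable_past t.
have pw := past_window t t' j; have ml := mean_window j t0 tt'.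
have m0 : measurable [set w | N w (window t t' j) = 0%E].
  exact: measurable_count_eq.
have m1 : measurable [set w | N w (window t t' j) = 1%E].
  exact: measurable_count_eq.
rewrite setIUr measureU; [|exact: measurableI|exact: measurableI|]; last first.
  rewrite -subset0 => w [[_ /= h0] [_ /= h1]]; move: h1; rewrite h0 => /eqP.
  by rewrite eqe eq_sym oner_eq0.
have e0 := @past_independent1 (past t) _ _ _ mp mw (emeasurable_set1 0%E) pw sE.
have e1 := @past_independent1 (past t) _ _ _ mp mw (emeasurable_set1 1%E) pw sE.
rewrite [X in (X + _)%E]e0 [X in (_ + X)%E]e1.
rewrite (poisson_count0 HN mw ml) (poisson_count1 HN mw ml).
rewrite -(fineK (fin_num_measure P E mE)) -!EFinM -EFinD; congr (_%:E); ring.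
Qed.

Variables (S S' : T -> state_type) (t t' : R).
Hypothesis t0 : 0 <= t.
Hypothesis tt' : t <= t' <= t + 1.
Hypothesis S_past : forall A, measurable A -> <<s events_in N (past t) >> (S @^-1` A).
Hypothesis S_front : {ae P, forall w, is_front (eta w t) (S w).1 (S w).2}.
Hypothesis S_range : forall w, 0 <= (S w).1 /\ (0 <= (S w).2 <= 1 \/ (S w).2 = 3).
Hypothesis S'_past : forall A, measurable A -> <<s events_in N (past t') >> (S' @^-1` A).
Hypothesis S'_front : {ae P, forall w, is_front (eta w t') (S' w).1 (S' w).2}.

Let le_tt' : t <= t'. Proof. by case/andP: tt'. Qed.

Lemma window_near (j X : R) : j <= X < j + 1 ->
  forall x, X - 1 <= x <= X + 2 -> `](j - 2), (j + 3)]%classic x.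
Proof. by move=> jX x xX; rewrite /= in_itv/=; lra. Qed.

Lemma quiet_state (j : R) : {ae P, forall w, j <= (S w).1 < j + 1 ->
  N w (window t t' j) = 0%E -> S' w = S w}.
Proof.
near=> w => jw Nw.
have [el path] : exists el, regular_path (N w) (eta w) el by near: w.
have fw : is_front (eta w t) (S w).1 (S w).2 by near: w.
have fw' : is_front (eta w t') (S' w).1 (S' w).2 by near: w.
have := quiet_front path t0 le_tt' (measurable_itv _) (window_near jw) Nw fw.
move=> /(front_unique fw')[]; case: (S' w) (S w) => [a b] [a' b'] /= -> ->//.
Unshelve. all: by end_near. Qed.

Lemma single_birth_state (j : R) : {ae P, forall w, j <= (S w).1 < j + 1 ->
  N w (window t t' j) = 1%E ->
  S' w = front_step (S w) (located_point N (window t t' j) w).1.2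
    (located_point N (window t t' j) w).2}.
Proof.
near=> w => jw Nw.
have [el path] : exists el, regular_path (N w) (eta w) el by near: w.
have fw : is_front (eta w t) (S w).1 (S w).2 by near: w.
have fw' : is_front (eta w t') (S' w).1 (S' w).2 by near: w.
rewrite /located_point Nw eqxx.
have [cz hz] := single_pointP HN (measurable_window t t' j) Nw.
move: (single_point N (window t t' j) w) cz hz => [[a x] u] cz hz /=.
have := single_birth_front path t0 le_tt' (measurable_itv _) (window_near jw) cz hz fw.
move=> /(front_unique fw')[]; case: (S' w) (S w) => [p q] [p' q'] /= -> ->.
by case: front_step.
Unshelve. all: by end_near. Qed.

(** Without point the state is unchanged, with one point it makes the step located by
    [freeze_point]; the two contributions are averaged by [integral_step_cost] and added
    up in [one_step_bound]. *)
Lemma one_step_deviation (j : R) (E : set T) :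
  <<s events_in N (past t) >> E -> (forall w, E w -> j <= (S w).1 < j + 1) ->
  (\int[P]_(w in E `&` ([set w | N w (window t t' j) = 0%E] `|`
       [set w | N w (window t t' j) = 1%E])) deviation t' (S' w) <=
   \int[P]_(w in E) ((1 + drift_const * (t' - t) ^+ 2)%:E * deviation t (S w)
      + (noise_const * (t' - t))%:E))%E.
Proof.
move=> sE Ej; have mE := events_in_measurable sE.
have mw := measurable_window t t' j; have mp := measurable_past t.
have pw := past_window t t' j; have ml := mean_window j t0 le_tt'.
have m0 : measurable [set w | N w (window t t' j) = 0%E].
  exact: measurable_count_eq.
have m1 : measurable [set w | N w (window t t' j) = 1%E].
  exact: measurable_count_eq.
have mS : measurable_fun setT S.
  by move=> _ A mA; rewrite setTI; apply: events_in_measurable; exact: S_past.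
have mS' : measurable_fun setT S'.
  by move=> _ A mA; rewrite setTI; apply: events_in_measurable; exact: S'_past.
have mE0 := measurableI _ _ mE m0; have mE1 := measurableI _ _ mE m1.
have mdev r : measurable_fun setT (deviation r \o S).
  exact: measurableT_comp (measurable_deviation r) mS.
have mdev' : measurable_fun setT (deviation t' \o S').
  exact: measurableT_comp (measurable_deviation t') mS'.
have disj : [disjoint (E `&` [set w | N w (window t t' j) = 0%E]) &
    (E `&` [set w | N w (window t t' j) = 1%E])].
  apply/disj_setPS => w [[_ /= h0] [_ /= h1]]; move: h1; rewrite h0 => /eqP.
  by rewrite eqe eq_sym oner_eq0.
have split := ge0_integral_setU P mE0 mE1 (measurable_funTS mdev')
  (fun w _ => deviation_ge0 t' (S' w)) disj.
rewrite setIUr split.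
set l := 10 * (t' - t).
pose K w := front_value (S w) - v * t'.
pose rate w := (t' - t) * (10 * K w ^+ 2 + 2 * K w * v + 3 * D ^+ 2).
have part0 : (\int[P]_(w in E `&` [set w | N w (window t t' j) = 0%E]) deviation t' (S' w) =
    (expR (- l))%:E * \int[P]_(w in E) deviation t' (S w))%E.
  rewrite -(freeze_none mp mw pw ml sE S_past (measurable_deviation t') (deviation_ge0 t')).
  apply: ge0_ae_eq_integral => //.
  - exact: measurable_funTS mdev'.
  - exact: measurable_funTS (mdev t').
  - by move=> w _; exact: deviation_ge0.
  - by move=> w _; exact: deviation_ge0.
  by apply: filterS (quiet_state j) => w h [Ew Nw]; rewrite h//; exact: Ej.
pose mu3 : {measure set point_type -> \bar R} := (mu \x mu \x mu)%E.
have mean3 B : mean_measure B = mu3 (B `&` @state_space R) by [].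
have vol : mu3 (window t t' j) = l%:E.
  by have := ml; rewrite mean3 (setIidl (@cell_state R t t' _ t0)).
pose G := @step_cost R (v * t').
have mG : measurable_fun setT G := measurable_step_cost (v * t').
have G0 : forall p, (0 <= G p)%E := step_cost_ge0 (v * t').
have part1 : (\int[P]_(w in E `&` [set w | N w (window t t' j) = 1%E]) deviation t' (S' w) =
    (expR (- l))%:E * \int[P]_(w in E) \int[mu3]_(z in window t t' j) G (S w, z))%E.
  rewrite -(freeze_point HN mean3 mp mw pw (@cell_state R t t' _ t0) vol sE S_past mG G0).
  apply: ge0_ae_eq_integral => //.
  - exact: measurable_funTS mdev'.
  - apply: measurable_funTS; apply: (measurableT_comp mG); apply: measurable_fun_pair => //.
    exact: (measurable_located_point HN).
  - by move=> w _; exact: deviation_ge0.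
  apply: filterS (single_birth_state j) => w h [Ew Nw].
  by rewrite h//; [rewrite /deviation -step_costE|exact: Ej].
have inner w : E w ->
    (\int[mu3]_(z in window t t' j) G (S w, z) <= (rate w)%:E)%E.
  by move=> Ew; apply: integral_step_cost => //; [case: (S_range w)|exact: Ej].
have inner0 w : (0 <= \int[mu3]_(z in window t t' j) G (S w, z))%E.
  by apply: integral_ge0 => z _; exact: G0.
have rate0 w : E w -> (0 <= (rate w)%:E)%E.
  by move=> Ew; exact: le_trans (inner0 w) (inner w Ew).
have part1' : (\int[P]_(w in E) \int[mu3]_(z in window t t' j) G (S w, z) <=
    \int[P]_(w in E) (rate w)%:E)%E.
  by apply: ge0_le_integral_nonmeas.
have mK : measurable_fun setT (K : T -> measurableTypeR R).
  apply: measurable_funB => //; apply: (measurableT_comp _ mS).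
  exact: (measurable_front_value measurable_fst measurable_snd).
have mrate : measurable_fun setT (rate : T -> measurableTypeR R).
  apply: measurable_funM => //; apply: measurable_funD => //; apply: measurable_funD.
    by apply: measurable_funM => //; exact: measurable_funX.
  by apply: measurable_funM => //; exact: measurable_funM.
have el0 : (0 <= (expR (- l))%:E :> \bar R)%E by rewrite lee_fin expR_ge0.
have Emrate : measurable_fun E (fun w => (rate w)%:E).
  by apply: measurable_funTS; exact/measurable_EFinP.
have Emdev : measurable_fun E (fun w => deviation t' (S w)) := measurable_funTS (mdev t').
have dev0 w : E w -> (0 <= deviation t' (S w))%E by move=> _; exact: deviation_ge0.
rewrite part0 part1.
apply: (@le_trans _ _ ((expR (- l))%:E * (\int[P]_(w in E) deviation t' (S w) +
    \int[P]_(w in E) (rate w)%:E))%E).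
  have h1 : (0 <= \int[P]_(w in E) deviation t' (S w))%E by apply: integral_ge0.
  have h2 : (0 <= \int[P]_(w in E) (rate w)%:E)%E by apply: integral_ge0.
  rewrite (ge0_muleDr _ h1 h2).
  by apply: leeD => //; exact: lee_wpmul2l.
rewrite -ge0_integralD// -ge0_integralZl//; last first.
- by move=> w Ew; rewrite adde_ge0//; [exact: dev0|exact: rate0].
- exact: emeasurable_funD.
apply: ge0_le_integral => //.
- by move=> w Ew; rewrite mule_ge0// adde_ge0//; [exact: dev0|exact: rate0].
- by apply: emeasurable_funM => //; exact: emeasurable_funD.
- apply: emeasurable_funD => //; apply: emeasurable_funM => //.
  exact: measurable_funTS (mdev t).
move=> w Ew; rewrite /deviation /= -EFinD -!EFinM -EFinD lee_fin.
have dt01 : 0 <= t' - t <= 1 by case/andP: tt' => h1 h2; apply/andP; split; lra.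
apply: (@one_step_bound (K w) (front_value (S w) - v * t) (t' - t) dt01).
by rewrite /K; ring.
Qed.

End OneStepEstimate.

(** * The second moment of the front *)

Section Recursion.
Context d (T : measurableType d) (R : realType) (P : probability T R).
Variable N : R.-ker T ~> space_time_mark R.
Hypothesis HN : poisson_point_process P N.
Local Notation point_type := (space_time_mark R).
Local Notation state_type := (measurableTypeR R * measurableTypeR R)%type.
Local Notation v := (speed R).
Variable eta : T -> R -> {fset R}.
Hypothesis paths : {ae P, forall w, exists el, regular_path (N w) (eta w) el}.
Variable dt : R.
Hypothesis dt01 : 0 <= dt <= 1.
Variable S : nat -> T -> state_type.
Let time (k : nat) : R := k%:R * dt.
Hypothesis S_past : forall k A, measurable A ->
  <<s events_in N (past (time k)) >> (S k @^-1` A).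
Hypothesis S_front : forall k,
  {ae P, forall w, is_front (eta w (time k)) (S k w).1 (S k w).2}.
Hypothesis S_range : forall k w,
  0 <= (S k w).1 /\ (0 <= (S k w).2 <= 1 \/ (S k w).2 = 3).

Definition bracket k (j : nat) : set T := [set w | j%:R <= (S k w).1 < j%:R + 1].

Definition few_points k (j : nat) : set T :=
  [set w | N w (window (time k) (time k.+1) j%:R) = 0%E] `|`
  [set w | N w (window (time k) (time k.+1) j%:R) = 1%E].

Fixpoint good (k : nat) : set T :=
  if k is k.+1 then \bigcup_j ((good k `&` bracket k j) `&` few_points k j) else setT.

Let time0 k : 0 <= time k.
Proof. by case/andP: dt01 => h _; rewrite mulr_ge0. Qed.

Let timeS k : time k.+1 - time k = dt.
Proof. by rewrite /time -mulrBl -natrB// subSnn mul1r. Qed.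

Let le_time k : time k <= time k.+1 <= time k + 1.
Proof. by case/andP: dt01 => h1 h2; have := timeS k; lra. Qed.

Let le_timeS k : time k <= time k.+1. Proof. by case/andP: (le_time k). Qed.

Lemma bracket_past k j : <<s events_in N (past (time k)) >> (bracket k j).
Proof.
have -> : bracket k j = S k @^-1` (`[j%:R, j%:R + 1[%classic `*` setT).
  by apply/seteqP; split => w; rewrite /bracket/= in_itv/=; [split|move=> []].
by apply: S_past; apply: measurableX.
Qed.

Lemma few_points_past k j : <<s events_in N (past (time k.+1)) >> (few_points k j).
Proof.
have sub : window (time k) (time k.+1) j%:R `<=` past (time k.+1).
  move=> [[a x] u] [[/= /andP[ka ak] _] /andP[u0 _]]; split => //=.
    by split => //=; rewrite in_itv/= ak (le_trans (time0 k))// ltW.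
  by rewrite in_itv/= u0.
apply: (@measurableU _ (g_sigma_algebraType (events_in N (past (time k.+1)))));
  apply: sub_sigma_algebra.
- exists (window (time k) (time k.+1) j%:R), [set 0%E].
  by split => //; exact: measurable_window.
- exists (window (time k) (time k.+1) j%:R), [set 1%E].
  by split => //; exact: measurable_window.
Qed.

Lemma good_past k : <<s events_in N (past (time k)) >> (good k).
Proof.
elim: k => [|k IH] /=.
  exact: (@measurableT _ (g_sigma_algebraType (events_in N (past (time 0))))).
apply: (@bigcupT_measurable _ (g_sigma_algebraType (events_in N (past (time k.+1))))) => j.
apply: (@measurableI _ (g_sigma_algebraType (events_in N (past (time k.+1))))).
  have sub := @events_in_sub _ _ _ N _ _ (past_sub (le_timeS k)).
  apply: (@measurableI _ (g_sigma_algebraType (events_in N (past (time k.+1))))).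
    exact: (sub _ IH).
  by apply: sub; exact: bracket_past.
exact: few_points_past.
Qed.

Lemma measurable_good k : measurable (good k).
Proof. exact: (events_in_measurable (@good_past k)). Qed.

Let piece k j := good k `&` bracket k j.

Lemma piece_past k j : <<s events_in N (past (time k)) >> (piece k j).
Proof.
apply: (@measurableI _ (g_sigma_algebraType (events_in N (past (time k))))).
  exact: good_past.
exact: bracket_past.
Qed.

Let mpiece k j : measurable (piece k j).
Proof. exact: (events_in_measurable (@piece_past k j)). Qed.

Let mfew k j : measurable (few_points k j).
Proof. exact: (events_in_measurable (@few_points_past k j)). Qed.

Lemma good_pieces k : good k = \bigcup_j piece k j.
Proof.
apply/seteqP; split => [w gw|w [j _ []//]].
have [X0 _] := S_range k w.
by exists (Num.truncn (S k w).1) => //; split => //; rewrite /bracket/= natr1 truncn_itv.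
Qed.

Lemma piece_trivIset k (F : nat -> set T) : trivIset setT (fun j => piece k j `&` F j).
Proof.
move=> i j _ _ [w [[[_ /andP[iw wi]] _] [[_ /andP[jw wj]] _]]].
apply/eqP; rewrite eqn_leq; apply/andP; split; rewrite -ltnS -(ltr_nat R) -natr1.
  exact: le_lt_trans iw wj.
exact: le_lt_trans jw wi.
Qed.

Let lambda : R := 10 * dt.

Lemma good_massS k : P (good k.+1) = (P (good k) * (expR (- lambda) * (1 + lambda))%:E)%E.
Proof.
rewrite /= measure_semi_bigcup//; first last.
- by apply: bigcupT_measurable => j; apply: measurableI => //; exact: mpiece.
- exact: piece_trivIset.
- by move=> j; apply: measurableI => //; exact: mpiece.
rewrite [in RHS]good_pieces measure_semi_bigcup//; first last.
- exact: bigcupT_measurable.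
- rewrite (_ : piece k = fun j => piece k j `&` setT); first exact: piece_trivIset.
  by apply/funext => j; rewrite setIT.
rewrite muleC -nneseriesZl//; apply: eq_eseriesr => j _.
apply: etrans (one_step_mass HN j%:R (time0 k) (le_timeS k) (@piece_past k j)) _.
by rewrite timeS muleC.
Qed.

(** Each step multiplies the probability by
    [expR (- lambda) * (1 + lambda) >= 1 - lambda ^+ 2]. *)
Lemma good_mass k : ((1 - k%:R * lambda ^+ 2)%:E <= P (good k))%E.
Proof.
elim: k => [|k IH]; first by rewrite mul0r subr0 probability_setT.
rewrite good_massS; move: IH.
have le1 : (P (good k) <= 1)%E by apply: probability_le1; exact: measurable_good.
have ge0 : (0 <= P (good k))%E by [].
rewrite -(fineK (fin_num_measure P _ (measurable_good k))) in le1 ge0 *.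
rewrite -EFinM !lee_fin; move: (fine _) le1 ge0 => p; rewrite !lee_fin => p1 p0 IH.
have l0 : 0 <= lambda by case/andP: dt01 => h _; rewrite mulr_ge0.
have q : 1 - lambda ^+ 2 <= expR (- lambda) * (1 + lambda).
  rewrite (_ : 1 - lambda ^+ 2 = (1 - lambda) * (1 + lambda)); last by ring.
  by rewrite ler_wpM2r ?expR_ge1Dx//; lra.
apply: le_trans (ler_wpM2l p0 q).
have : p * lambda ^+ 2 <= lambda ^+ 2 by rewrite ler_piMl ?sqr_ge0.
rewrite -natr1 mulrBr mulr1 mulrDl mul1r; lra.
Qed.

Let mS k : measurable_fun setT (S k).
Proof. by move=> _ A mA; rewrite setTI; apply: events_in_measurable; exact: S_past. Qed.

Lemma measurable_deviation_S k t : measurable_fun setT (fun w => deviation t (S k w)).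
Proof. exact: measurableT_comp (measurable_deviation t) (mS k). Qed.

Let c1 : R := 1 + drift_const R * dt ^+ 2.
Let c2 : R := noise_const R * dt.
Let a0 : R := lone_potential R ^+ 2.

Let c1_ge1 : 1 <= c1.
Proof. by rewrite lerDl mulr_ge0 ?sqr_ge0// mulr_ge0. Qed.

Let c2_ge0 : 0 <= c2.
Proof.
case/andP: dt01 => h _; rewrite mulr_ge0// /noise_const.
by rewrite !addr_ge0 ?sqr_ge0// mulr_ge0 ?sqr_ge0.
Qed.

Lemma good_deviationS k :
  (\int[P]_(w in good k.+1) deviation (time k.+1) (S k.+1 w) <=
   c1%:E * \int[P]_(w in good k) deviation (time k) (S k w) + c2%:E)%E.
Proof.
pose g w := (c1%:E * deviation (time k) (S k w) + c2%:E)%E.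
have g0 w : (0 <= g w)%E.
  apply: adde_ge0; last by rewrite lee_fin.
  by apply: mule_ge0; [rewrite lee_fin; exact: le_trans c1_ge1|exact: deviation_ge0].
have mg : measurable_fun setT g.
  apply: emeasurable_funD => //; apply: emeasurable_funM => //.
  exact: measurable_deviation_S.
apply: (@le_trans _ _ (\int[P]_(w in good k) g w)%E).
  rewrite [X in (\int[P]_(w in X) _ <= _)%E](_ : good k.+1 =
    \bigcup_j (piece k j `&` few_points k j))//.
  rewrite ge0_integral_bigcup//; first last.
  - exact: piece_trivIset.
  - by move=> w _; exact: deviation_ge0.
  - by apply: measurable_funTS; exact: measurable_deviation_S.
  - by move=> j; apply: measurableI.
  rewrite good_pieces ge0_integral_bigcup//; first last.
  - rewrite (_ : piece k = fun j => piece k j `&` setT); first exact: piece_trivIset.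
    by apply/funext => j; rewrite setIT.
  - exact: measurable_funTS.
  apply: lee_nneseries => [j _ _|j _]; first by apply: integral_ge0 => w _; exact: deviation_ge0.
  have Ej w : piece k j w -> j%:R <= (S k w).1 < j%:R + 1 by case.
  have := one_step_deviation HN paths (time0 k) (le_time k) (@S_past k) (S_front k)
    (S_range k) (@S_past k.+1) (S_front k.+1) (@piece_past k j) Ej.
  by rewrite timeS.
have mgood := measurable_good k.
have mdev : measurable_fun (good k) (fun w => deviation (time k) (S k w)).
  by apply: measurable_funTS; exact: measurable_deviation_S.
have dev0 w : good k w -> (0 <= deviation (time k) (S k w))%E.
  by move=> _; exact: deviation_ge0.
have c10 : (0 <= c1%:E)%E by rewrite lee_fin; exact: le_trans c1_ge1.
rewrite /g ge0_integralD//; first last.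
- by apply: emeasurable_funM.
- by move=> w gw; apply: mule_ge0; [|exact: dev0].
rewrite ge0_integralZl//; apply: leeD => //.
rewrite integral_cst//= -[leRHS]mule1; apply: lee_wpmul2l; first by rewrite lee_fin.
exact: probability_le1.
Qed.

Hypothesis start : {ae P, forall w, S 0 w = (0, 3)}.

Lemma good_deviation k :
  (\int[P]_(w in good k) deviation (time k) (S k w) <= (c1 ^+ k * (a0 + k%:R * c2))%:E)%E.
Proof.
elim: k => [|k IH].
  rewrite expr0 mul1r mul0r addr0 [good 0]/=.
  rewrite (@ge0_ae_eq_integral _ _ _ _ _ _ (cst a0%:E))//.
  - by rewrite integral_cst//= probability_setT mule1.
  - exact: measurable_deviation_S.
  - by move=> w _; exact: deviation_ge0.
  - by move=> w _; rewrite lee_fin sqr_ge0.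
  apply: filterS start => w Sw _; rewrite Sw /deviation /front_value /= potential3.
  by rewrite add0r /time mul0r mulr0 subr0.
apply: (le_trans (good_deviationS k)).
apply: (@le_trans _ _ (c1%:E * (c1 ^+ k * (a0 + k%:R * c2))%:E + c2%:E)%E).
  by apply: leeD => //; apply: lee_wpmul2l => //; rewrite lee_fin; exact: le_trans c1_ge1.
rewrite -EFinM -EFinD lee_fin exprS -mulrA -natr1.
have : 1 <= c1 * c1 ^+ k by rewrite -exprS exprn_ege1.
move: (c1 ^+ k) => q q1; have h : c2 <= c1 * q * c2 by rewrite ler_peMl.
rewrite (_ : c1 * (q * (a0 + (k%:R + 1) * c2)) =
  c1 * (q * (a0 + k%:R * c2)) + c1 * q * c2); last by ring.
by rewrite lerD2l.
Qed.

(** Chebyshev's inequality on the good event; the number of steps enters through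
    [(1 + drift_const R * dt ^+ 2) ^+ k], which is bounded when [k * dt ^+ 2 <= 1]. *)
Lemma deviation_estimate k (a : R) : 0 < a -> k%:R * dt ^+ 2 <= 1 ->
  exists A, [/\ measurable A,
    (P A <= (100 * (k%:R * dt ^+ 2)
       + expR (drift_const R) * (a0 + noise_const R * time k) / a ^+ 2)%:E)%E &
    forall w, ~ A w -> `|front_value (S k w) - v * time k| < a].
Proof.
move=> apos kdt.
have mdev := measurable_deviation_S k (time k).
pose B := good k `&` [set w | ((a ^+ 2)%:E <= deviation (time k) (S k w))%E].
have mB : measurable B.
  apply: measurableI; first exact: measurable_good.
  by rewrite -[X in measurable X]setTI; exact: emeasurable_fun_le.
exists (~` good k `|` B); split.
- by apply: measurableU => //; apply: measurableC; exact: measurable_good.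
- apply: le_trans (measureU2 _ _ mB) _.
    by apply: measurableC; exact: measurable_good.
  rewrite EFinD; apply: leeD.
    have mg := measurable_good k.
    suff : (P (~` good k) <= (100 * (k%:R * dt ^+ 2))%:E)%E by [].
    rewrite probability_setC//.
    have := good_mass k; rewrite -(fineK (fin_num_measure P _ (measurable_good k))).
    by rewrite -EFinB !lee_fin /lambda exprMn mulrCA; lra.
  have a2 : 0 < a ^+ 2 by rewrite exprn_gt0.
  have h1 : ((a ^+ 2)%:E * P B <= \int[P]_(w in good k) deviation (time k) (S k w))%E.
    rewrite -integral_cst//; apply: ge0_le_integral_nonmeas => //.
    - by move=> w _; rewrite lee_fin ltW.
    - by move=> w _; exact: deviation_ge0.
    - by move=> w [].
    - by move=> w [].
  have h2 := le_trans h1 (good_deviation k).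
  suff : (P B <= (expR (drift_const R) * (a0 + noise_const R * time k) / a ^+ 2)%:E)%E by [].
  rewrite -(fineK (fin_num_measure P _ mB)) in h2 *.
  rewrite -EFinM !lee_fin in h2 *.
  rewrite ler_pdivlMr// mulrC; apply: le_trans h2 _.
  rewrite (_ : k%:R * c2 = noise_const R * time k); last by rewrite /c2 /time; ring.
  apply: ler_wpM2r.
    rewrite addr_ge0 ?sqr_ge0// /time mulrCA mulr_ge0//.
  apply: (@le_trans _ _ (expR (drift_const R * dt ^+ 2) ^+ k)).
    rewrite lerXn2r ?nnegrE ?expR_ge0//; first exact: le_trans c1_ge1.
    exact: expR_ge1Dx.
  rewrite -expRM_natl ler_expR mulrCA ler_piMr// mulr_ge0//.
- move=> w h; have gw : good k w by apply: contrapT => h'; apply: h; left.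
  rewrite ltNge; apply/negP => ha; apply: h; right; split => //=.
  by rewrite lee_fin -(real_normK (num_real (_ - _))) lerXn2r ?nnegrE// ltW.
Qed.

End Recursion.

(** * The speed of the right front *)

Section LongTime.
Context d (T : measurableType d) (R : realType).
Local Notation v := (speed R).

Lemma speed_gt0 : 0 < v.
Proof.
have : ln (1 + (- (1 / 3)) : R) <= - (1 / 3) by apply: le_ln1Dx; lra.
rewrite (_ : 1 + - (1 / 3) = 2 / 3 :> R); last by field.
rewrite ln_div ?posrE// => h; rewrite /speed; apply: divr_gt0 => //; lra.
Qed.

Lemma front_potential_bound c X Z : is_front c X Z ->
  `|front_value (X, Z) - X| <= jump_bound R.
Proof.
move=> [_ _ gX]; rewrite /front_value /= addrC addKr /jump_bound.
case: gX => [[-> _]|[/andP[Z0 Z1] _ _]]; first by rewrite potential3; lra.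
rewrite potentialE//; have := @gap_potential_bound _ Z; rewrite (ltW Z0) Z1 => /(_ isT).
by have := normr_ge0 (lone_potential R); lra.
Qed.

(** Telescoping, [1 / x ^+ 2 <= 2 * (1 / x - 1 / (x + 1))] for [1 <= x]. *)
Lemma borel_cantelli_square (P : probability T R) (A : nat -> set T) (C : R) :
  (forall n, measurable (A n)) ->
  (forall n, P (A n) <= (C / n.+1%:R ^+ 2)%:E)%E ->
  {ae P, forall w, exists m, forall n, (m <= n)%N -> ~ A n w}.
Proof.
move=> mA PA.
have C0 : 0 <= C.
  by have := le_trans (measure_ge0 P (A 0%N)) (PA 0%N); rewrite lee_fin expr1n divr1.
have sum n : \sum_(0 <= i < n) C / i.+1%:R ^+ 2 <= C * (2 * (1 - n.+1%:R^-1)).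
  elim: n => [|n IH]; first by rewrite big_nil invr1 subrr !mulr0.
  rewrite big_nat_recr//=; apply: le_trans (lerD IH (lexx _)) _.
  rewrite -mulrDr ler_wpM2l// -[n.+2%:R]natr1.
  have : 1 <= n.+1%:R :> R by rewrite ler1n.
  move: (n.+1%:R) => x x1.
  rewrite -subr_ge0 (_ : _ - _ = (x - 1) / (x ^+ 2 * (x + 1))).
    by rewrite divr_ge0 ?mulr_ge0 ?sqr_ge0//; lra.
  by field; rewrite !gt_eqF//; lra.
have limsup0 : P (lim_sup_set A) = 0%E.
  apply: lim_sup_set_cvg0 => //; apply: (@le_lt_trans _ _ (C * 2)%:E); last exact: ltry.
  apply: lime_le; first by apply: is_cvg_nneseries => n _ _.
  apply: nearW => n; apply: (@le_trans _ _ (\sum_(0 <= i < n) (C / i.+1%:R ^+ 2)%:E)%E).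
    by apply: lee_sum => i _; exact: PA.
  rewrite sumEFin lee_fin; apply: le_trans (sum n) _; rewrite ler_wpM2l//.
  by have : 0 <= n.+1%:R^-1 :> R by []; move: (n.+1%:R^-1) => x; lra.
exists (lim_sup_set A); split => //.
  by apply: bigcapT_measurable => n; apply: bigcup_measurable => k _.
move=> w h n _; apply: contrapT => h'; apply: h; exists n => k /= nk Akw.
by apply: h'; exists k.
Qed.

Variables (P : probability T R) (N : R.-ker T ~> space_time_mark R).
Hypothesis HN : poisson_point_process P N.
Variable eta : T -> R -> {fset R}.
Hypothesis adapted : forall (t : R) (B : set (measurableTypeR R)) (k : nat),
  0 <= t -> measurable B ->
  completed_filtration P N t [set w | count_in (eta w t) B = k].
Hypothesis paths : {ae P, forall w, exists el, regular_path (N w) (eta w) el}.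

Let C : R := expR (drift_const R) * (lone_potential R ^+ 2 + noise_const R).

(** The time is [n.+1 ^ 2], cut into [n.+1 ^ 6] steps of length [n.+1 ^ (- 4)].  Bad steps
    then have total probability of order [n.+1 ^ (- 2)], and so has a deviation of order
    [n.+1 ^ 2] by Chebyshev's inequality, as the variance is of the order of the time. *)
Lemma square_time_estimate (n : nat) (e : R) : 0 < e ->
  exists A, [/\ measurable A,
    (P A <= ((100 + C / e ^+ 2) / n.+1%:R ^+ 2)%:E)%E &
    {ae P, forall w, ~ A w -> forall X Z, is_front (eta w (n.+1%:R ^+ 2)) X Z ->
      `|X - v * n.+1%:R ^+ 2| <= e * n.+1%:R ^+ 2 + jump_bound R}].
Proof.
move=> e0; have : 1 <= n.+1%:R :> R by rewrite ler1n.
have kE : (n.+1 ^ 6)%:R = n.+1%:R ^+ 6 :> R by rewrite natrX.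
move: (n.+1 ^ 6)%N kE => k; move: (n.+1%:R) => x kE x1.
(* [x] stands for [n.+1] and [k] for the number of steps. *)
pose dt : R := x ^- 4.
have x0 : x != 0 by rewrite gt_eqF//; lra.
have xp m : 0 < x ^+ m by rewrite exprn_gt0//; lra.
have dt01 : 0 <= dt <= 1.
  by rewrite /dt invr_ge0 ltW//= invf_le1// exprn_ege1.
have timeE : k%:R * dt = x ^+ 2 by rewrite kE /dt; field.
have errE : k%:R * dt ^+ 2 = x ^- 2 by rewrite kE /dt; field.
have time0 j : 0 <= j%:R * dt by case/andP: dt01 => h _; rewrite mulr_ge0.
have [S HS] := choice (fun j => front_state adapted paths (time0 j)).
have start : {ae P, forall w, S 0%N w = (0, 3)}.
  have [_ S0 _] := HS 0%N; apply: filterS2 paths S0 => w [el path].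
  rewrite mul0r (rp_start path) => fS.
  have f0 : is_front [fset (0 : R)]%fset 0 3.
    by split; [rewrite inE|move=> y; rewrite inE => /eqP->|left].
  by have [] := front_unique fS f0; case: (S 0%N w) => a b /= -> ->.
have ae0 : 0 < e * x ^+ 2 by rewrite mulr_gt0.
have le1 : k%:R * dt ^+ 2 <= 1 by rewrite errE invf_le1// exprn_ege1.
have SP j A : measurable A -> <<s events_in N (past (j%:R * dt)) >> (S j @^-1` A).
  by have [h _ _] := HS j; exact: h.
have SF j : {ae P, forall w, is_front (eta w (j%:R * dt)) (S j w).1 (S j w).2}.
  by have [_ h _] := HS j.
have SR j w : 0 <= (S j w).1 /\ (0 <= (S j w).2 <= 1 \/ (S j w).2 = 3).
  by have [_ _ h] := HS j; exact: h.
have [A [mA PA hA]] := deviation_estimate HN paths dt01 SP SF SR start ae0 le1.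
exists A; split => //.
  apply: le_trans PA _; rewrite lee_fin timeE errE [leRHS]mulrDl lerD2l.
  have -> : C / e ^+ 2 / x ^+ 2 = C * x ^+ 2 / (e * x ^+ 2) ^+ 2.
    by field; rewrite x0 gt_eqF.
  apply: ler_wpM2r; first by rewrite invr_ge0 sqr_ge0.
  rewrite /C -mulrA; apply: ler_wpM2l; first exact: expR_ge0.
  by rewrite [leRHS]mulrDl lerD2r ler_peMr ?sqr_ge0// exprn_ege1.
have := SF k; rewrite timeE => SFk; apply: filterS SFk => w fS nAw X Z fX.
have [-> _] := front_unique fX fS.
have := hA _ nAw; rewrite timeE; have := front_potential_bound fS.
rewrite -surjective_pairing; move: (front_value _) => F h1 h2.
rewrite (_ : _ - _ = - (F - (S k w).1) + (F - v * x ^+ 2)); last by ring.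
by apply: le_trans (ler_normD _ _) _; rewrite normrN addrC lerD// ltW.
Qed.

Lemma front_at_squares : {ae P, forall w, forall e : R, 0 < e -> exists m, forall n,
  (m <= n)%N -> forall X Z, is_front (eta w (n.+1%:R ^+ 2)) X Z ->
  `|X - v * n.+1%:R ^+ 2| <= e * n.+1%:R ^+ 2 + jump_bound R}.
Proof.
suff : {ae P, forall w, forall k : nat, exists m, forall n,
    (m <= n)%N -> forall X Z, is_front (eta w (n.+1%:R ^+ 2)) X Z ->
    `|X - v * n.+1%:R ^+ 2| <= k.+1%:R^-1 * n.+1%:R ^+ 2 + jump_bound R}.
  apply: filterS => w h e e0; have [k ke] : exists k, k.+1%:R^-1 < e :> R.
    exists (Num.trunc e^-1); rewrite invf_plt ?posrE//.
    by have e1 : 0 <= e^-1; [rewrite invr_ge0 ltW|case/andP: (truncn_itv e1)].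
  have [m hm] := h k; exists m => n mn X Z fX; apply: le_trans (hm n mn X Z fX) _.
  by rewrite lerD2r ler_wpM2r ?sqr_ge0// ltW.
apply: ae_foralln => k.
have k0 : 0 < k.+1%:R^-1 :> R by rewrite invr_gt0.
have [A hA] := choice (fun n => square_time_estimate n k0).
have bc := @borel_cantelli_square P A _ (fun n => let: And3 h _ _ := hA n in h)
  (fun n => let: And3 _ h _ := hA n in h).
have out : {ae P, forall w, forall n, ~ A n w -> forall X Z,
    is_front (eta w (n.+1%:R ^+ 2)) X Z ->
    `|X - v * n.+1%:R ^+ 2| <= k.+1%:R^-1 * n.+1%:R ^+ 2 + jump_bound R}.
  by apply: ae_foralln => n; have [] := hA n.
apply: filterS2 bc out => w [m hm] hw; exists m => n mn X Z.
by apply: hw; exact: hm.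
Qed.

(** Consecutive squares around [t] differ by [O(sqrt t)], and [X] is monotone in [t]. *)
Lemma right_front_speed : {ae P, forall w, forall e : R, 0 < e -> exists t0, forall t,
  t0 <= t -> forall X Z, is_front (eta w t) X Z -> `|X - v * t| <= e * t}.
Proof.
apply: filterS2 front_at_squares paths => w sq [el path] e e0.
have e8 : 0 < e / 8 by rewrite divr_gt0.
have [m hm] := sq _ e8; have v0 := speed_gt0.
have D0 : 0 <= jump_bound R by rewrite /jump_bound; have := normr_ge0 (lone_potential R); lra.
set D := jump_bound R in hm D0.
(* Beyond this square root of time, the bounded errors [D] and [3 * v * s] are at most
   [e / 2 * s ^+ 2]. *)
pose s0 := m.+1%:R + 2 * (D + 3 * v) / e.
have s01 : 1 <= s0.
  rewrite /s0 -natr1 -addrA addrCA lerDl addr_ge0// divr_ge0//; lra.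
exists (s0 ^+ 2) => t tt0 X Z fX.
have t0 : 0 <= t by exact: le_trans (sqr_ge0 _) tt0.
have [s s1 tE] : exists2 s, s0 <= s & t = s ^+ 2.
  exists (Num.sqrt t); last by rewrite sqr_sqrtr.
  by rewrite -(ger0_norm (le_trans ler01 s01)) -sqrtr_sqr ler_wsqrtr.
have [n ns] : exists n : nat, n.+1%:R <= s < n.+1%:R + 1.
  have s10 : 0 <= s - 1 by lra.
  exists (Num.trunc (s - 1)); have := truncn_itv s10; rewrite -!natr1; lra.
have mn : (m <= n)%N.
  rewrite -ltnS -(ltr_nat R) -natr1.
  have h : 0 <= 2 * (D + 3 * v) / e by rewrite divr_ge0//; lra.
  have : m.+1%:R <= s by apply: le_trans s1; rewrite /s0 lerDl.
  by rewrite -natr1; case/andP: ns; rewrite -natr1; lra.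
have small : D + 3 * v * s <= e / 2 * s ^+ 2.
  have h : 2 * (D + 3 * v) / e <= s by apply: le_trans s1; rewrite /s0 lerDr.
  have {}h : D + 3 * v <= e / 2 * s by rewrite ler_pdivrMr// in h; lra.
  have sge1 : 1 <= s by lra.
  have := ler_wpM2r (_ : 0 <= s) h; have := ler_peMr D0 sge1; lra.
have s_ge0 : 0 <= s by lra.
case/andP: ns => ns sn.
have tn0 : 0 <= n.+1%:R ^+ 2 :> R by rewrite sqr_ge0.
have tn1 : n.+1%:R ^+ 2 <= t by rewrite tE lerXn2r ?nnegrE.
have tn2 : t <= n.+2%:R ^+ 2.
  by rewrite tE -[n.+2%:R]natr1 lerXn2r ?nnegrE ?addr_ge0// ltW.
have fmono t1 t2 X1 Z1 X2 Z2 : 0 <= t1 -> t1 <= t2 -> is_front (eta w t1) X1 Z1 ->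
    is_front (eta w t2) X2 Z2 -> X1 <= X2.
  by move=> h1 h2 [h3 _ _] [_ h4 _]; apply: h4; apply: (fsubsetP (rp_mono path h1 h2)).
have [X1 [Z1 f1]] := front_exists path tn0.
have [X2 [Z2 f2]] := front_exists path (le_trans t0 tn2).
have lo := fmono _ _ _ _ _ _ tn0 tn1 f1 fX.
have hi := fmono _ _ _ _ _ _ t0 tn2 fX f2.
have b1 := hm n mn _ _ f1; have b2 := hm n.+1 (leqW mn) _ _ f2.
move: tn1 tn2 b1 b2; rewrite -[n.+2%:R]natr1 tE => tn1 tn2; move: (n.+1%:R) ns sn tn1 tn2 => x xs sx tn1 tn2.
rewrite !ler_norml => /andP[b1 _] /andP[_ b2].
have s1' : 1 <= s by lra.
have up : (x + 1) ^+ 2 <= s ^+ 2 + 2 * s + 1.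
  by rewrite (_ : s ^+ 2 + _ + _ = (s + 1) ^+ 2) ?lerXn2r ?nnegrE//; [lra|lra|lra|ring].
have down : s ^+ 2 - 2 * s + 1 <= x ^+ 2.
  by rewrite (_ : s ^+ 2 - _ + _ = (s - 1) ^+ 2) ?lerXn2r ?nnegrE//; [lra|lra|lra|ring].
have vup := ler_wpM2l (ltW v0) up; have vdown := ler_wpM2l (ltW v0) down.
have eup := ler_wpM2l (ltW e8) up; have edown := ler_wpM2l (ltW e8) tn1.
have ss : s <= s ^+ 2 by rewrite expr2 ler_peMr.
have es := ler_wpM2l (ltW e8) ss; have vs := ler_wpM2l (ltW v0) s1'.
have ev := ler_wpM2l (ltW e8) (le_trans s1' ss).
rewrite !mulrDr !mulr1 in vup vdown eup *.
rewrite !mulrN in vdown.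
clear -v0 b1 b2 lo hi small vup vdown eup edown es vs ev.
apply/andP; split; lra.
Qed.

End LongTime.

(** * Reflection at the origin *)

Section ProductInvariance.
Context d1 d2 (T1 : measurableType d1) (T2 : measurableType d2) (R : realType).
Variables (m1 : {sigma_finite_measure set T1 -> \bar R})
  (m2 : {sigma_finite_measure set T2 -> \bar R}).

(** The image of the product under the product map has the right values on rectangles. *)
Lemma product_measure_invariant (f1 : T1 -> T1) (f2 : T2 -> T2) :
  measurable_fun setT f1 -> measurable_fun setT f2 ->
  (forall A, measurable A -> m1 (f1 @^-1` A) = m1 A) ->
  (forall A, measurable A -> m2 (f2 @^-1` A) = m2 A) ->
  forall X, measurable X ->
  (m1 \x m2)%E ((fun z => (f1 z.1, f2 z.2)) @^-1` X) = (m1 \x m2)%E X.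
Proof.
move=> mf1 mf2 inv1 inv2 X mX.
have mf : measurable_fun setT (fun z : T1 * T2 => (f1 z.1, f2 z.2)).
  by apply: measurable_fun_pair; [exact: measurableT_comp mf1 measurable_fst|
    exact: measurableT_comp mf2 measurable_snd].
apply: esym; apply: (@product_measure_unique _ _ _ _ _ m1 m2
  (image_measure (m1 \x m2)%E mf)) => // A B mA mB.
rewrite /image_measure /= /pushforward.
have -> : (fun z : T1 * T2 => (f1 z.1, f2 z.2)) @^-1` (A `*` B) =
  (f1 @^-1` A) `*` (f2 @^-1` B) by [].
have mpre1 : measurable (f1 @^-1` A) by rewrite -[X in measurable X]setTI; exact: mf1.
have mpre2 : measurable (f2 @^-1` B) by rewrite -[X in measurable X]setTI; exact: mf2.
apply: etrans (@product_measure1E _ _ _ _ R m1 m2 _ _ mpre1 mpre2) _.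
exact: congr2 (inv1 A mA) (inv2 B mB).
Qed.

End ProductInvariance.

Section Reflection.
Context d (T : measurableType d) (R : realType).
Local Notation mu := (@lebesgue_measure R).
Local Notation point_type := (space_time_mark R).

Definition mirror (z : point_type) : point_type := (z.1.1, - z.1.2, z.2).

Lemma mirrorK : involutive mirror.
Proof. by move=> [[s x] u]; rewrite /mirror/= opprK. Qed.

Lemma measurable_mirror : measurable_fun setT mirror.
Proof.
apply: measurable_fun_pair => //; apply: measurable_fun_pair.
  exact: measurableT_comp measurable_fst measurable_fst.
by apply: measurable_funN; exact: measurableT_comp measurable_snd measurable_fst.
Qed.

Lemma measurable_preimage_mirror (B : set point_type) :
  measurable B -> measurable (mirror @^-1` B).
Proof. by move=> mB; rewrite -[X in measurable X]setTI; exact: measurable_mirror. Qed.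

Lemma preimage_mirrorK (B : set point_type) : mirror @^-1` (mirror @^-1` B) = B.
Proof. by apply/seteqP; split => z /=; rewrite mirrorK. Qed.

Lemma preimage_mirror_state : mirror @^-1` (@state_space R) = @state_space R.
Proof. by apply/seteqP; split => -[[s x] u] [[? _] ?]; split. Qed.

Lemma mean_measure_mirror (B : set point_type) : measurable B ->
  mean_measure (mirror @^-1` B) = mean_measure B.
Proof.
move=> mB; rewrite /mean_measure -{1}preimage_mirror_state -preimage_setI.
pose m12 : {sigma_finite_measure set (measurableTypeR R * measurableTypeR R)%type -> \bar R} :=
  product_copy mu mu.
pose f1 (z : measurableTypeR R * measurableTypeR R) : measurableTypeR R * measurableTypeR R :=
  (z.1, - z.2).
have mN : measurable_fun setT (-%R : measurableTypeR R -> measurableTypeR R).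
  exact: measurable_funN.
have mf1 : measurable_fun setT f1.
  apply: measurable_fun_pair => //.
  exact: measurableT_comp mN measurable_snd.
have inv1 A : measurable A -> m12 (f1 @^-1` A) = m12 A.
  apply: (@product_measure_invariant _ _ _ _ R mu mu id (-%R)) => //.
  by move=> B' mB'; exact: lebesgue_measureN.
have mst : measurable (@state_space R) by do 2 apply: measurableX => //.
exact: (@product_measure_invariant _ _ _ _ R m12 mu f1 id mf1 (@measurable_id _ _ _) inv1
  (fun _ _ => erefl) _ (measurableI _ _ mB mst)).
Qed.

Variable N : R.-ker T ~> space_time_mark R.

Definition reflected_kernel (w : T) : {measure set point_type -> \bar R} :=
  image_measure (N w) measurable_mirror.

Let measurable_reflected_kernel B : measurable B ->
  measurable_fun [set: T] (reflected_kernel ^~ B).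
Proof. by move=> mB; exact: (measurable_kernel N _ (measurable_preimage_mirror mB)). Qed.

HB.instance Definition _ :=
  isKernel.Build _ _ T point_type R reflected_kernel measurable_reflected_kernel.

Lemma reflected_kernelE w B : reflected_kernel w B = N w (mirror @^-1` B).
Proof. by []. Qed.

Definition reflected_process (eta : T -> R -> {fset R}) (w : T) (t : R) : {fset R} :=
  [fset - x | x in eta w t]%fset.

Variable P : probability T R.
Hypothesis HN : poisson_point_process P N.

Lemma reflected_poisson : poisson_point_process P reflected_kernel.
Proof.
split.
- by move=> w B mB; exact: (ppp_counting HN w (measurable_preimage_mirror mB)).
- move=> w r; rewrite reflected_kernelE (_ : mirror @^-1` _ =
    `[- r, r] `*` `[- r, r] `*` `[- r, r])%R; first exact: (ppp_locally_finite HN).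
  apply/seteqP; split => -[[s x] u] [[/= h1 h2] h3]; split => //; split => //=;
    move: h2; rewrite /= !in_itv/=; lra.
- move=> B k mB fB; rewrite -mean_measure_mirror// in fB *.
  exact: (ppp_poisson HN k (measurable_preimage_mirror mB) fB).
- move=> n B A mB tB mA.
  apply: (ppp_independent HN (B := fun i => mirror @^-1` B i)) => //.
    by move=> i; exact: measurable_preimage_mirror.
  by move=> i j _ _ [z [Bi Bj]]; apply: tB => //; exists (mirror z).
Qed.

Variable eta : T -> R -> {fset R}.

Lemma count_in_reflected (c : {fset R}) (B : set R) :
  count_in [fset - x | x in c]%fset B = count_in c (-%R @^-1` B).
Proof.
rewrite /count_in; set D := [fset x in c | _]%fset.
have <- : #|` [fset - x | x in D]%fset| = #|` D| by rewrite card_imfset//; exact: oppr_inj.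
congr #|` _|; rewrite /D {D}.
apply/fsetP => y; rewrite !inE; apply/andP/imfsetP => /=.
  move=> [/imfsetP[x/= xc ->] xB]; exists x => //.
  by rewrite !inE xc; move/set_mem: xB => xB; apply/mem_set.
move=> [x]; rewrite !inE => /andP[xc /set_mem xB] ->.
by split; [apply/imfsetP; exists x|exact: xB].
Qed.

Lemma in_reflected (c : {fset R}) x : (x \in [fset - y | y in c]%fset) = (- x \in c).
Proof.
apply/imfsetP/idP => [[y/= yc ->]|xc]; first by rewrite opprK.
by exists (- x); rewrite ?opprK.
Qed.

Lemma reflected_adapted :
  (forall (t : R) (B : set (measurableTypeR R)) (k : nat), 0 <= t -> measurable B ->
    completed_filtration P N t [set w | count_in (eta w t) B = k]) ->
  forall (t : R) (B : set (measurableTypeR R)) (k : nat), 0 <= t -> measurable B ->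
    completed_filtration P reflected_kernel t
      [set w | count_in (reflected_process eta w t) B = k].
Proof.
move=> adapted t B k t0 mB.
have mN : measurable ((-%R : measurableTypeR R -> measurableTypeR R) @^-1` B).
  by rewrite -[X in measurable X]setTI; exact: measurable_funN.
have -> : [set w | count_in (reflected_process eta w t) B = k] =
    [set w | count_in (eta w t) (-%R @^-1` B) = k].
  by apply/seteqP; split => w /=; rewrite count_in_reflected.
have := adapted t _ k t0 mN; apply: smallest_sub; first exact: smallest_sigma_algebra.
move=> E [[C [A [mC Ct mA ->]]]|nE]; apply: sub_sigma_algebra; last by right.
left; exists (mirror @^-1` C), A; split => //.
- exact: measurable_preimage_mirror.
- by move=> [[s x] u] /Ct [[/= h1 h2] h3].
- by apply/seteqP; split => w /=; rewrite reflected_kernelE preimage_mirrorK.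
Qed.

Lemma truncated_rate_reflected x (c : {fset R}) :
  truncated_rate x [fset - y | y in c]%fset = truncated_rate (- x) c.
Proof.
rewrite /truncated_rate big_imfset/=; last by move=> y z _ _; exact: oppr_inj.
congr (Num.min _ _); apply: eq_bigr => y _.
by rewrite opprK -normrN opprD.
Qed.

Lemma reflected_path w el : regular_path (N w) (eta w) el ->
  regular_path (reflected_kernel w) (reflected_process eta w)
    (fun t => [fset - x | x in el t]%fset).
Proof.
move=> path.
have sets s t B : accepted (fun t => [fset - x | x in el t]%fset) `&` slab s t B =
    mirror @^-1` (accepted el `&` slab s t (-%R @^-1` B)).
  apply/seteqP; split => -[[a x] u];
    by rewrite /accepted /slab /= truncated_rate_reflected opprK.
have mN (B : set (measurableTypeR R)) : measurable B ->
    measurable ((-%R : measurableTypeR R -> measurableTypeR R) @^-1` B).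
  by move=> mB; rewrite -[X in measurable X]setTI; exact: measurable_funN.
split.
- by move=> B mB; exact: (rp_counting path (measurable_preimage_mirror mB)).
- rewrite reflected_kernelE -[RHS](rp_zero path); congr (N w _).
- by rewrite /reflected_process (rp_start path); apply/fsetP => x;
    rewrite in_reflected !inE oppr_eq0.
- move=> s t s0 st; apply/fsubsetP => x; rewrite !in_reflected.
  exact: (fsubsetP (rp_mono path s0 st)).
- move=> t t0; have [r r0 h] := rp_left path t0; exists r => // s rs.
  by rewrite /reflected_process h.
- move=> t t0; have [r r0 h] := rp_right path t0; exists r => // s rs.
  by rewrite /reflected_process h.
- move=> s t B s0 mB; rewrite sets; apply: measurable_preimage_mirror.
  by apply: (rp_measurable path) => //; exact: mN.
- move=> s t B s0 st mB.
  rewrite !count_in_reflected (rp_birth path s0 st (mN _ mB)).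
  by rewrite sets reflected_kernelE preimage_mirrorK.
Qed.

End Reflection.

Section PathsOfProcess.
Context d (T : measurableType d) (R : realType).
Variables (P : probability T R) (N : R.-ker T ~> space_time_mark R).
Variable eta : T -> R -> {fset R}.
Hypothesis HN : poisson_point_process P N.
Hypothesis Heta : birth_process P N (@truncated_rate R) [fset 0]%fset eta.

(** The set of points with mark 0 has mean measure 0.  On it, acceptance does not require a
    positive rate, so it has to be excluded in [no_isolated]. *)
Lemma no_mark0 : {ae P, forall w, N w [set z | z.2 = 0] = 0%E}.
Proof.
have m0 : measurable [set z : space_time_mark R | z.2 = 0] := @measurable_mark0 R.
have mean0 : mean_measure [set z : space_time_mark R | z.2 = 0] = 0%:E.
  pose mu3 : {measure set (space_time_mark R) -> \bar R} :=
    (@lebesgue_measure R \x @lebesgue_measure R \x @lebesgue_measure R)%E.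
  have e : mu3 (setT `*` [set 0]) = 0%E.
    pose mu := @lebesgue_measure R.
    apply: etrans (@product_measure1E _ _ _ _ R (mu \x mu)%E mu _ _ measurableT
      (measurable_set1 0)) _.
    by rewrite [X in (_ * X)%E](lebesgue_measure_set1 0) mule0.
  apply: (@subset_measure0 _ _ _ mu3 _ (setT `*` [set 0])) => //.
  - by apply: measurableI => //; do 2 apply: measurableX => //.
  - exact: measurableX.
  - by move=> z [z0 _]; split.
have p1 := poisson_count0 HN m0 mean0.
rewrite oppr0 expR0 in p1.
have mE : measurable [set w | N w [set z : space_time_mark R | z.2 = 0] = 0%E].
  exact: measurable_count_eq.
exists (~` [set w | N w [set z | z.2 = 0] = 0%E]); split => //.
  exact: measurableC.
by rewrite probability_setC// p1 subee.
Qed.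

Lemma paths_of_process : {ae P, forall w, exists el, regular_path (N w) (eta w) el}.
Proof.
have [_ cad eq] := Heta.
near=> w.
exists (left_limit (eta w)); apply: regular_path_of_equation.
- by near: w.
- by near: w.
- by move=> B mB; exact: (ppp_counting HN).
- by near: w; exact: no_mark0.
Unshelve. all: by end_near. Qed.

End PathsOfProcess.

(** * The occupied interval and its speed *)

Section OccupiedSet.
Variable R : realType.
Implicit Types c : {fset R}.
Local Notation reflected c := [fset - x | x in c]%fset.

(** The leftmost particle at or beyond [y] has a neighbour behind [y], at distance at most
    1 from it; one of the two is within distance 1 of [y]. *)
Lemma occupied_right c X y : connected_config c -> 0 \in c -> X \in c ->
  0 <= y <= X + 1 -> occupied c y.
Proof.
move=> [cr _] c0 cX /andP[y0 yX].
have occ z : z \in c -> z - 1 <= y <= z + 1 -> occupied c y.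
  by move=> zc zy; exists z => //=; rewrite in_itv.
have [y1|y1] := leP y 1; first by apply: (occ 0) => //; lra.
have [Xy|Xy] := ltP X y; first by apply: (occ X) => //; lra.
have [|m [mc ym mm]] := @fset_min R c (fun z => y <= z); first by exists X.
have [|z zc /andP[mz zm]] := cr m mc; first lra.
apply: (occ m) => //; have [yz|zy] := leP y z; last by lra.
by have := mm _ zc yz; lra.
Qed.

Lemma connected_reflected c : connected_config c -> connected_config (reflected c).
Proof.
move=> [cr cl]; split => x; rewrite in_reflected => xc x0.
  have [|y yc yx] := cl _ xc; first by lra.
  by exists (- y); rewrite ?in_reflected ?opprK//; lra.
have [|y yc yx] := cr _ xc; first by lra.
by exists (- y); rewrite ?in_reflected ?opprK//; lra.
Qed.

Lemma occupied_reflected c y : occupied (reflected c) y -> occupied c (- y).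
Proof.
move=> [x /= xc xy]; exists (- x) => /=; first by rewrite -in_reflected.
by move: xy; rewrite !in_itv/=; lra.
Qed.

Lemma occupied_interval c X Z X' Z' : connected_config c -> 0 \in c ->
  is_front c X Z -> is_front (reflected c) X' Z' ->
  occupied c = `[- (X' + 1), X + 1]%classic.
Proof.
move=> cc c0 [Xc mX _] [X'c mX' _]; apply/seteqP; split => [y [x /= xc]|y].
  have := mX x xc; have := mX' (- x); rewrite in_reflected opprK => /(_ xc).
  by rewrite !in_itv/=; lra.
rewrite /= in_itv/= => /andP[yX' yX]; have [y0|y0] := leP 0 y.
  by apply: (occupied_right cc c0 Xc); rewrite y0.
rewrite -[y]opprK; apply: occupied_reflected.
apply: (occupied_right (connected_reflected cc) _ X'c); last by lra.
by rewrite in_reflected oppr0.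
Qed.

Lemma scaled_interval (v eps t a b : R) : 0 < v -> 0 < eps < 1 -> 2 <= eps * v * t -> 0 < t ->
  `|a - v * t| <= eps * v / 2 * t -> `|b - v * t| <= eps * v / 2 * t ->
  scale_set (1 - eps) `[- v, v] `<=` scale_set t^-1 `[- (a + 1), b + 1] /\
  scale_set t^-1 `[- (a + 1), b + 1] `<=` scale_set (1 + eps) `[- v, v].
Proof.
move=> v0 /andP[e0 e1] evt t0; rewrite !ler_norml => /andP[a1 a2] /andP[b1 b2].
have vt : 0 < v * t by rewrite mulr_gt0.
split => z [x /=]; rewrite in_itv/= => /andP[x1 x2] <-.
  exists (t * ((1 - eps) * x)); last by rewrite mulKf// gt_eqF.
  rewrite /= in_itv/=.
  have e1' : 0 <= (1 - eps) * t by rewrite mulr_ge0//; lra.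
  have := ler_wpM2l e1' x1; have := ler_wpM2l e1' x2.
  rewrite mulrA [t * _]mulrC => h1 h2; apply/andP; split; lra.
have e2 : 0 < 1 + eps by lra.
exists (t^-1 * x / (1 + eps)); last by rewrite mulrC divfK// gt_eqF.
rewrite /= in_itv/= [t^-1 * x]mulrC -mulrA -invfM.
have te : 0 < t * (1 + eps) by rewrite mulr_gt0.
rewrite ler_pdivlMr// ler_pdivrMr//; apply/andP; split; lra.
Qed.

End OccupiedSet.

Section Speed.
Context d (T : measurableType d) (R : realType).
Variables (P : probability T R) (eta : T -> R -> {fset R}).

(** For small [eps], the interval of the smaller constant enlarged by [1 + eps] would
    contain the interval of the larger one reduced by [1 - eps]. *)
Lemma shape_constant_unique v v' :
  shape_constant P eta v -> shape_constant P eta v' -> v = v'.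
Proof.
suff le w w' : shape_constant P eta w -> shape_constant P eta w' -> w' <= w.
  by move=> h h'; apply/le_anti; rewrite !le.
move=> [w0 hw] [w'0 hw']; rewrite leNgt; apply/negP => ww'.
(* Half of the value for which [(1 + eps) * w = (1 - eps) * w']. *)
pose eps := (w' - w) / (2 * (w + w')).
have ww0 : 0 < 2 * (w + w') by rewrite mulr_gt0// addr_gt0.
have eps01 : 0 < eps < 1.
  by rewrite /eps divr_gt0 ?subr_gt0//= ltr_pdivrMr//; lra.
have gap : (1 + eps) * w < (1 - eps) * w'.
  have : eps * (2 * (w + w')) = w' - w by rewrite /eps divfK// gt_eqF.
  lra.
have PP : ProperFilter (almost_everywhere P).
  apply: ae_properfilter_algebraOfSetsType.
  by have := @probability_setT _ _ _ P => /= ->; exact: lte01.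
have [om [h h']] := filter_ex (filterI (hw _ eps01) (hw' _ eps01)).
have [t [[_ s1] [s2 _]]] := filter_ex (filterI h h').
have : scale_set (1 - eps) `[- w', w'] ((1 - eps) * w').
  by exists w' => //=; rewrite in_itv/= lexx andbT; lra.
move=> /s2/s1[x /=]; rewrite in_itv/= => /andP[_ xw] xE.
have : (1 + eps) * x <= (1 + eps) * w by rewrite ler_wpM2l//; lra.
lra.
Qed.

Variable N : R.-ker T ~> space_time_mark R.
Hypothesis HN : poisson_point_process P N.
Hypothesis Heta : birth_process P N (@truncated_rate R) [fset 0]%fset eta.

Lemma shape_constant_speed : shape_constant P eta (speed R).
Proof.
have v0 := speed_gt0 R; split => // eps eps01.
have paths := paths_of_process HN Heta.
have adapted := birth_adapted Heta.
have right := right_front_speed HN adapted paths.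
have paths' : {ae P, forall w, exists el,
    regular_path (reflected_kernel N w) (reflected_process eta w) el}.
  by apply: filterS paths => w [el path]; eexists; exact: reflected_path path.
have left := right_front_speed (reflected_poisson HN)
  (reflected_adapted adapted) paths'.
near=> w.
have [el path] : exists el, regular_path (N w) (eta w) el by near: w.
have [el' path'] : exists el,
  regular_path (reflected_kernel N w) (reflected_process eta w) el by near: w.
have r : forall e : R, 0 < e -> exists t0, forall t, t0 <= t ->
  forall X Z, is_front (eta w t) X Z -> `|X - speed R * t| <= e * t by near: w.
have l : forall e : R, 0 < e -> exists t0, forall t, t0 <= t ->
  forall X Z, is_front (reflected_process eta w t) X Z -> `|X - speed R * t| <= e * t by near: w.
have e0 : 0 < eps * speed R / 2 by case/andP: eps01 => h _; rewrite divr_gt0// mulr_gt0.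
have [t1 ht1] := r _ e0; have [t2 ht2] := l _ e0.
near=> t.
have t0 : 0 < t by near: t; apply: nbhs_pinfty_gt; exact: num_real.
have tt1 : t1 <= t by near: t; apply: nbhs_pinfty_ge; exact: num_real.
have tt2 : t2 <= t by near: t; apply: nbhs_pinfty_ge; exact: num_real.
have big : 2 / (eps * speed R) <= t by near: t; apply: nbhs_pinfty_ge; exact: num_real.
have [X [Z fX]] := front_exists path (ltW t0).
have [X' [Z' fX']] := front_exists path' (ltW t0).
rewrite (occupied_interval (path_connected path (ltW t0)) (origin_in path (ltW t0)) fX fX').
apply: scaled_interval => //.
- case/andP: eps01 => h _; have : 0 < eps * speed R by rewrite mulr_gt0.
  by move=> h'; rewrite -ler_pdivrMl// mulrC.
- exact: ht2 fX'.
- exact: ht1 fX.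
Unshelve. all: by end_near. Qed.

End Speed.

Theorem theorem2p10 (R : realType) (d : measure_display) (T : measurableType d)
    (P : probability T R) (N : R.-ker T ~> space_time_mark R)
    (eta : T -> R -> {fset R}) :
  poisson_point_process P N ->
  birth_process P N (@truncated_rate R) [fset 0]%fset eta ->
  speed_of_propagation P eta ((144 * ln 3 - 144 * ln 2 - 40) / 25).
Proof.
move=> HN Heta; split; first exact: shape_constant_speed HN Heta.
by move=> v'; apply: shape_constant_unique; exact: shape_constant_speed HN Heta.
Qed.
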